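(* Let $\Gamma$ be the Petersen graph with the labelling, spanning tree $T$ and arcs $x_1,\dots,x_6$ described in the context. Every connected, arc-transitive, primary finite abelian regular covering of $\Gamma$ is isomorphic (as a covering) to exactly one covering $\Gamma\times_\phi A$ from the following list, where $\phi$ is the $T$-reduced voltage assignment with the listed values $\phi(x_1),\dots,\phi(x_6)$. List 1 (elementary abelian): $X(2,1)$: $A=\mathbb{Z}_2$; $\phi(x_i)=1$ for all $i$. $X'(2,1)$: $A=\mathbb{Z}_2$; values $1,0,1,0,1,0$. $X(2,2)$: $A=\mathbb{Z}_2^2$; values $(1,0),(0,1),(1,0),(0,1),(1,0),(0,1)$. $X(5,3)$: $A=\mathbb{Z}_5^3$; values $(1,0,0),(1,3,4),(0,0,1),(3,1,1),(0,1,0),(1,4,3)$. $X^{\pm}(p,3)$, for primes $p\equiv\pm1\pmod{10}$: $A=\mathbb{Z}_p^3$; values $(1,0,0),(1,\lambda_\pm,-1),(0,0,1),(\lambda_\pm,1,1),(0,1,0),(1,-1,\lambda_\pm)$, where $\lambda_+,\lambda_-$ are the two roots of $\lambda^2-\lambda-1=0$ in $\mathbb{Z}_p$. $X(p,6)$, for every prime $p$: $A=\mathbb{Z}_p^6$; values $\epsilon_1,\epsilon_6,\epsilon_5,\epsilon_4,\epsilon_3,\epsilon_2$ (standard basis vectors $\epsilon_j$). List 2 (all with an integer $k>1$): $X_{k,1}(2,6)$: $A=\mathbb{Z}_{2^k}\times\mathbb{Z}_{2^{k-1}}^5$; values $(-1,0,0,0,0,1),(-1,0,0,0,1,0),(-1,0,0,1,0,0),(-1,0,1,1,0,0),(-1,1,0,0,0,0),(1,0,0,0,0,0)$.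 $X'_{k,1}(2,6)$: $A=\mathbb{Z}_{2^k}\times\mathbb{Z}_{2^{k-1}}^5$; values $(0,0,0,0,0,1),(-1,0,0,0,1,0),(0,0,0,1,0,0),(-1,0,1,0,0,0),(0,1,0,0,0,0),(1,0,0,0,0,0)$. $X_{k,2}(2,6)$: $A=\mathbb{Z}_{2^k}^2\times\mathbb{Z}_{2^{k-1}}^4$; values $(0,1,0,0,0,1),(1,0,0,0,1,0),(0,1,0,1,0,0),(1,0,1,0,0,0),(0,1,0,0,0,0),(1,0,0,0,0,0)$. $X^{\pm}_{k,3}(p,3)$, for primes $p\equiv\pm1\pmod{10}$: $A=\mathbb{Z}_{p^k}^3$; values $(0,0,1),(0,1,0),(1,-\lambda_\mp,-\lambda_\pm),(\lambda_\pm,\lambda_\pm,-\lambda_\pm),(-\lambda_\mp,1,-\lambda_\pm),(1,0,0)$, where $\lambda_+,\lambda_-$ are the two roots of $\lambda^2-\lambda-1=0$ in $\mathbb{Z}_{p^k}$. $X_{k,3}(5,6)$: $A=\mathbb{Z}_{5^k}^3\times\mathbb{Z}_{5^{k-1}}^3$; values $(0,0,1,0,0,0),(0,1,0,0,0,0),(1,2,2,0,0,1),(3,3,2,0,1,0),(2,1,2,1,0,0),(1,0,0,0,0,0)$. $X^{\pm}_{k,c,3}(p,6)$, for primes $p\equiv\pm1\pmod{10}$ and integers $c$ with $1\le c<k$: $A=\mathbb{Z}_{p^k}^3\times\mathbb{Z}_{p^c}^3$; values $(0,0,1,0,0,0),(0,1,0,0,0,0),(1,-\lambda_\mp,-\lambda_\pm,0,0,1),(\lambda_\pm,\lambda_\pm,-\lambda_\pm,0,1,0),(-\lambda_\mp,1,-\lambda_\pm,1,0,0),(1,0,0,0,0,0)$,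 where $\lambda_+,\lambda_-$ are the two roots of $\lambda^2-\lambda-1=0$ in $\mathbb{Z}_{p^{k-c}}$, each regarded as an element of $\mathbb{Z}_{p^k}$ via its representative in $\{0,\dots,p^{k-c}-1\}$. $X_{k,6}(p,6)$, for every prime $p$: $A=\mathbb{Z}_{p^k}^6$; values $\epsilon_1,\epsilon_2,\epsilon_3,\epsilon_4,\epsilon_5,\epsilon_6$. Moreover, among the coverings of List 2, $X_{k,1}(2,6)$, $X_{k,2}(2,6)$, $X_{k,3}(5,6)$ and $X_{k,6}(p,6)$ are $3$-arc-transitive, while $X'_{k,1}(2,6)$, $X^{\pm}_{k,3}(p,3)$ and $X^{\pm}_{k,c,3}(p,6)$ are $2$-arc-transitive but not $3$-arc-transitive. Finally, every connected arc-transitive finite abelian regular covering of $\Gamma$ is isomorphic to the fibered product of connected $p$-primary arc-transitive abelian regular coverings of $\Gamma$ for distinct primes $p$.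
   Context: The Petersen graph $\Gamma$: let $X=\{a,b,c,d,e\}$ and label the vertices $0=\{a,b\},1=\{c,d\},2=\{c,e\},3=\{d,e\},4=\{a,e\},5=\{b,e\},6=\{a,d\},7=\{b,d\},8=\{a,c\},9=\{b,c\}$; two vertices are adjacent iff the corresponding 2-subsets are disjoint. So the edges are $\{0,1\},\{0,2\},\{0,3\},\{1,4\},\{1,5\},\{2,6\},\{2,7\},\{3,8\},\{3,9\},\{4,7\},\{4,9\},\{5,6\},\{5,8\},\{6,9\},\{7,8\}$, and $\mathrm{Aut}(\Gamma)\cong S_5$ acting via $X$. The spanning tree $T$ consists of the edges $\{0,1\},\{0,2\},\{0,3\},\{1,4\},\{1,5\},\{2,6\},\{2,7\},\{3,8\},\{3,9\}$; the cotree arcs are $x_1=(5,8),x_2=(7,8),x_3=(4,7),x_4=(4,9),x_5=(6,9),x_6=(5,6)$. A voltage assignment in a finite abelian group $A$ is a map $\phi$ from arcs to $A$ with $\phi(v,u)=-\phi(u,v)$; it is $T$-reduced if it vanishes on all arcs of $T$, so it is determined by $\phi(x_1),\dots,\phi(x_6)$. The regular covering $\Gamma\times_\phi A$ has vertex set $V(\Gamma)\times A$ and edges $\{(u,g),(v,\phi(u,v)+g)\}$ for $\{u,v\}\in E(\Gamma)$, $g\in A$, with covering map the first projection; every regular covering with covering transformation group $A$ is isomorphic to one of this form. In the lists, vectors give elements of the stated product group in the order of the factors (e.g. in $\mathbb{Z}_{2^k}\times\mathbb{Z}_{2^{k-1}}^5$ the first coordinate lies in $\mathbb{Z}_{2^k}$),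 integer entries being reduced into the corresponding factor. A covering is primary if its covering transformation group is a $p$-group for some prime $p$. Two coverings $\pi:\Lambda\to\Gamma$, $\pi':\Lambda'\to\Gamma$ are isomorphic if there are an automorphism $\alpha$ of $\Gamma$ and a graph isomorphism $\tilde\alpha:\Lambda\to\Lambda'$ with $\alpha\circ\pi=\pi'\circ\tilde\alpha$. The fibered product of coverings $\Gamma\times_{\phi_i}A_i$ is $\Gamma\times_\phi\prod A_i$ with $\phi(x)=(\phi_1(x),\dots,\phi_m(x))$. A graph is $s$-arc-transitive if its automorphism group acts transitively on $s$-arcs (walks $(v_0,\dots,v_s)$ with $v_{i-1}\ne v_{i+1}$); arc-transitive means $1$-arc-transitive.
   Formalization: Uniqueness counts X^+ and X^- (same p, k, c) as one list item, since they are isomorphic as coverings via the transposition (d e); ''primary'' requires a nontrivial p-group, since the identity covering is not in the list. *)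

(* Defs.v *)
From HB Require Import structures.
From mathcomp Require Import all_boot all_algebra all_fingroup pgroup.

Set Implicit Arguments.
Unset Strict Implicit.
Unset Printing Implicit Defensive.

Import GRing.Theory.

Local Open Scope ring_scope.

Record sgraph := SGraph {
  vertex :> finType;
  adj : rel vertex;
  adj_sym : symmetric adj;
  adj_irr : irreflexive adj
}.

Arguments adj {s} x y.

Definition connected (G : sgraph) : Prop := forall x y : G, connect adj x y.

Definition aut (G : sgraph) : {set {perm G}} :=
  [set s : {perm G} | [forall x, forall y, adj (s x) (s y) == adj x y]].

Definition is_sarc (G : sgraph) (s : nat) (w : 'I_s.+1 -> G) : Prop :=
  (forall i j : 'I_s.+1, j = i.+1 :> nat -> adj (w i) (w j)) /\
  (forall i j : 'I_s.+1, j = i.+2 :> nat -> w i <> w j).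

Definition s_arc_transitive (s : nat) (G : sgraph) : Prop :=
  forall w w' : 'I_s.+1 -> G, is_sarc w -> is_sarc w' ->
    exists2 f : {perm G}, f \in aut G & forall i, f (w i) = w' i.

Notation arc_transitive := (s_arc_transitive 1).

Record covering (G : sgraph) := Covering {
  cgraph :> sgraph;
  cmap : cgraph -> G;
  cmap_surj : forall v, exists x, cmap x = v;
  cmap_hom : forall x y, adj x y -> adj (cmap x) (cmap y);
  cmap_lift : forall x v, adj (cmap x) v ->
    exists! y, adj x y /\ cmap y = v
}.

Arguments cmap {G} c x.

Definition cov_iso (G : sgraph) (C D : covering G) : Prop :=
  exists2 a : {perm G}, a \in aut G &
  exists f : C -> D,
    [/\ bijective f,
        forall x y, adj (f x) (f y) = adj x y &
        forall x, a (cmap C x) = cmap D (f x)].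

Definition cov_trans (G : sgraph) (C : covering G) : {set {perm C}} :=
  [set s in aut C | [forall x, cmap C (s x) == cmap C x]].

Definition regular (G : sgraph) (C : covering G) : Prop :=
  forall x y, cmap C x = cmap C y ->
    exists! s : {perm C}, s \in cov_trans C /\ s x = y.

Definition abelian_regular (G : sgraph) (C : covering G) : Prop :=
  regular C /\ abelian (cov_trans C).

(* The p-group is required to be nontrivial: the identity covering is not
   counted as a primary covering. *)
Definition p_primary (p : nat) (G : sgraph) (C : covering G) : Prop :=
  [/\ prime p, (p.-group (cov_trans C))%g & cov_trans C <> [1 {perm C}]%g].

Definition primary (G : sgraph) (C : covering G) : Prop :=
  exists p, p_primary p C.

Definition dprodz (I : finType) (A : I -> finZmodType) : Type :=
  {dffun forall i, A i}.

Section Dprodz.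
Variables (I : finType) (A : I -> finZmodType).
Implicit Types f g h : dprodz A.

HB.instance Definition _ := Finite.on (dprodz A).

Definition dprodz_zero : dprodz A := [ffun i => 0 : A i].
Definition dprodz_opp f : dprodz A := [ffun i => - f i].
Definition dprodz_add f g : dprodz A := [ffun i => f i + g i].

Fact dprodz_addA : associative dprodz_add.
Proof. by move=> f g h; apply/ffunP=> i; rewrite !ffunE addrA. Qed.
Fact dprodz_addC : commutative dprodz_add.
Proof. by move=> f g; apply/ffunP=> i; rewrite !ffunE addrC. Qed.
Fact dprodz_add0 : left_id dprodz_zero dprodz_add.
Proof. by move=> f; apply/ffunP=> i; rewrite !ffunE add0r. Qed.
Fact dprodz_addN : left_inverse dprodz_zero dprodz_opp dprodz_add.
Proof. by move=> f; apply/ffunP=> i; rewrite !ffunE addNr. Qed.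

HB.instance Definition _ := GRing.isZmodule.Build (dprodz A)
  dprodz_addA dprodz_addC dprodz_add0 dprodz_addN.

End Dprodz.

(* Only the values at arcs are meaningful. *)
Record voltage (G : sgraph) (A : finZmodType) := Voltage {
  volt :> G -> G -> A;
  volt_anti : forall u v, adj u v -> volt v u = - volt u v
}.

Section VoltageCovering.
Variables (G : sgraph) (A : finZmodType) (phi : voltage G A).

Definition vadj : rel (G * A) :=
  fun x y => adj x.1 y.1 && (y.2 == phi x.1 y.1 + x.2).

Lemma vadj_sym : symmetric vadj.
Proof.
move=> [u g] [v h]; rewrite /vadj /= (adj_sym v u).
case uv: (adj u v) => //=; rewrite (volt_anti phi uv).
by apply/eqP/eqP=> ->; rewrite ?addKr ?addNKr.
Qed.

Lemma vadj_irr : irreflexive vadj.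
Proof. by move=> [u g]; rewrite /vadj /= adj_irr. Qed.

Definition vgraph : sgraph := SGraph vadj_sym vadj_irr.

Lemma vmap_surj (v : G) : exists x : vgraph, x.1 = v.
Proof. by exists (v, 0). Qed.

Lemma vmap_hom (x y : vgraph) : adj x y -> adj x.1 y.1.
Proof. by case/andP. Qed.

Lemma vmap_lift (x : vgraph) (v : G) : adj x.1 v ->
  exists! y : vgraph, adj x y /\ y.1 = v.
Proof.
move=> xv; exists (v, phi x.1 v + x.2); split.
  by split=> //; rewrite /= /vadj /= xv eqxx.
by move=> [w h] [/andP[_ /eqP /= ->] <-].
Qed.

Definition vcover : covering G := Covering vmap_surj vmap_hom vmap_lift.

End VoltageCovering.

Section FiberedProduct.
Variables (G : sgraph) (m : nat) (A : 'I_m -> finZmodType).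
Variable phi : forall i, voltage G (A i).

Definition fibered_volt (u v : G) : dprodz A := [ffun i => phi i u v].

Lemma fibered_volt_anti u v : adj u v -> fibered_volt v u = - fibered_volt u v.
Proof. by move=> uv; apply/ffunP=> i; rewrite !ffunE (volt_anti (phi i) uv). Qed.

Definition fibered_product : covering G := vcover (Voltage fibered_volt_anti).

End FiberedProduct.

(* The points a, b, c, d, e of X are 0, 1, 2, 3, 4; a 2-subset is given by its
   two elements. *)
Definition pair_of (v : nat) : seq nat :=
  nth [::] [:: [:: 0; 1]; [:: 2; 3]; [:: 2; 4]; [:: 3; 4]; [:: 0; 4];
               [:: 1; 4]; [:: 0; 3]; [:: 1; 3]; [:: 0; 2]; [:: 1; 2]]%N v.

Definition padj : rel 'I_10 :=
  fun u v => ~~ has (mem (pair_of u)) (pair_of v).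

Lemma padj_sym : symmetric padj.
Proof. by move=> u v; rewrite /padj has_sym. Qed.

Lemma padj_irr : irreflexive padj.
Proof. by case=> u; do 10?[case: u => [//|u]]. Qed.

Definition petersen : sgraph := SGraph padj_sym padj_irr.

Definition tree : seq (nat * nat) :=
  [:: (0, 1); (0, 2); (0, 3); (1, 4); (1, 5); (2, 6); (2, 7); (3, 8); (3, 9)]%N.

Definition cotree : seq (nat * nat) :=
  [:: (5, 8); (7, 8); (4, 7); (4, 9); (6, 9); (5, 6)]%N.

Lemma petersen_edges (u v : petersen) :
  adj u v = (((u : nat), (v : nat)) \in tree ++ cotree) ||
            (((v : nat), (u : nat)) \in tree ++ cotree).
Proof.
case: u v => [u ltu] [v ltv].
by do 10?[case: u ltu => [|u] ltu //]; do 10?[case: v ltv => [|v] ltv //].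
Qed.

(* The T-reduced voltage assignment with values a_1, ..., a_6 at x_1, ..., x_6.
   As [index] returns 6 outside [cotree], a term whose arc is not some x_i
   contributes 0. *)
Definition reduced_volt (A : finZmodType) (a : 6.-tuple A) (u v : petersen) : A :=
  nth 0 a (index ((u : nat), (v : nat)) cotree) -
  nth 0 a (index ((v : nat), (u : nat)) cotree).

Lemma reduced_volt_anti (A : finZmodType) (a : 6.-tuple A) u v :
  adj u v -> reduced_volt a v u = - reduced_volt a u v.
Proof. by rewrite /reduced_volt opprB. Qed.

Definition reduced (A : finZmodType) (a : 6.-tuple A) : voltage petersen A :=
  Voltage (@reduced_volt_anti A a).

Lemma reduced_tree (A : finZmodType) (a : 6.-tuple A) (u v : petersen) :
  ((u : nat), (v : nat)) \in tree -> reduced a u v = 0.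
Proof.
case: u v => [u ltu] [v ltv]; rewrite /= /reduced_volt /=.
by do 10?[case: u ltu => [|u] ltu //]; do 10?[case: v ltv => [|v] ltv //] => _;
  rewrite !nth_default ?size_tuple ?subrr.
Qed.

Lemma reduced_cotree (A : finZmodType) (a : 6.-tuple A) (u v : petersen) :
  ((u : nat), (v : nat)) \in cotree ->
  reduced a u v = nth 0 a (index ((u : nat), (v : nat)) cotree).
Proof.
case: u v => [u ltu] [v ltv]; rewrite /= /reduced_volt /=.
by do 10?[case: u ltu => [|u] ltu //]; do 10?[case: v ltv => [|v] ltv //] => _;
  rewrite [X in _ - X]nth_default ?size_tuple ?subr0.
Qed.

(* The group Z_(m_0) x ... x Z_(m_(n-1)); the moduli have to be at least 2,
   because 'Z_0 and 'Z_1 are not the integers modulo 0 and 1. *)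
Definition Zprod (m : seq nat) : finZmodType :=
  dprodz (fun i : 'I_(size m) => 'Z_(nth 0%N m i)).

Definition vec (m : seq nat) (s : seq int) : Zprod m :=
  [ffun i : 'I_(size m) => (nth 0 s i)%:~R : 'Z_(nth 0%N m i)].

Definition Xcover (m : seq nat) (a : 6.-tuple (seq int)) : covering petersen :=
  vcover (reduced (map_tuple (vec m) a)).

(* [l] and [l'] are the representatives in {0, ..., N - 1} of two distinct
   roots of x^2 - x - 1 in Z_N; for N = p^j with p = 1, 9 mod 10 these are all
   the roots. *)
Definition two_roots (N l l' : nat) : bool :=
  [&& (l < N)%N, (l' < N)%N, l != l',
      (l%:R ^+ 2 - l%:R - 1 == 0 :> 'Z_N) &
      (l'%:R ^+ 2 - l'%:R - 1 == 0 :> 'Z_N)].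

Definition pm1_prime (p : nat) : bool := prime p && (p %% 10 \in [:: 1; 9])%N.

(* In X^s, with s a sign, the arguments [l l'] are lambda_s and lambda_(-s), so
   that exchanging them exchanges X^+ and X^-. These two coverings are
   isomorphic: the transposition (d e) of X fixes T and sends x_1, x_2, x_3,
   x_4, x_5, x_6 to x_2, x_1, - x_6, x_5, x_4, - x_3, and composing it with an
   automorphism of the group takes the voltages of X^+ to those of X^-. *)
Inductive Xname :=
  | X_2_1
  | X'_2_1
  | X_2_2
  | X_5_3
  | X_p_3 (p l l' : nat)
  | X_p_6 (p : nat)
  | Xk1_2_6 (k : nat)
  | X'k1_2_6 (k : nat)
  | Xk2_2_6 (k : nat)
  | Xk3_p_3 (k p l l' : nat)
  | Xk3_5_6 (k : nat)
  | Xkc3_p_6 (k c p l l' : nat)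
  | Xk6_p_6 (k p : nat).

Definition listed (n : Xname) : bool :=
  match n with
  | X_2_1 | X'_2_1 | X_2_2 | X_5_3 => true
  | X_p_3 p l l' => pm1_prime p && two_roots p l l'
  | X_p_6 p => prime p
  | Xk1_2_6 k | X'k1_2_6 k | Xk2_2_6 k | Xk3_5_6 k => (1 < k)%N
  | Xk3_p_3 k p l l' => [&& (1 < k)%N, pm1_prime p & two_roots (p ^ k) l l']
  | Xkc3_p_6 k c p l l' =>
      [&& (1 < k)%N, (1 <= c < k)%N, pm1_prime p & two_roots (p ^ (k - c)) l l']
  | Xk6_p_6 k p => (1 < k)%N && prime p
  end.

Definition opposite_sign (n : Xname) : Xname :=
  match n with
  | X_p_3 p l l' => X_p_3 p l' l
  | Xk3_p_3 k p l l' => Xk3_p_3 k p l' l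
  | Xkc3_p_6 k c p l l' => Xkc3_p_6 k c p l' l
  | _ => n
  end.

Definition X (n : Xname) : covering petersen :=
  match n with
  | X_2_1 => Xcover [:: 2%N]
      [tuple [:: 1]; [:: 1]; [:: 1]; [:: 1]; [:: 1]; [:: 1]]
  | X'_2_1 => Xcover [:: 2%N]
      [tuple [:: 1]; [:: 0]; [:: 1]; [:: 0]; [:: 1]; [:: 0]]
  | X_2_2 => Xcover (nseq 2 2%N)
      [tuple [:: 1; 0]; [:: 0; 1]; [:: 1; 0]; [:: 0; 1]; [:: 1; 0]; [:: 0; 1]]
  | X_5_3 => Xcover (nseq 3 5%N)
      [tuple [:: 1; 0; 0]; [:: 1; 3; 4]; [:: 0; 0; 1];
             [:: 3; 1; 1]; [:: 0; 1; 0]; [:: 1; 4; 3]]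
  | X_p_3 p l l' => Xcover (nseq 3 p)
      [tuple [:: 1; 0; 0]; [:: 1; l%:Z; -1]; [:: 0; 0; 1];
             [:: l%:Z; 1; 1]; [:: 0; 1; 0]; [:: 1; -1; l%:Z]]
  | X_p_6 p => Xcover (nseq 6 p)
      [tuple [:: 1; 0; 0; 0; 0; 0]; [:: 0; 0; 0; 0; 0; 1];
             [:: 0; 0; 0; 0; 1; 0]; [:: 0; 0; 0; 1; 0; 0];
             [:: 0; 0; 1; 0; 0; 0]; [:: 0; 1; 0; 0; 0; 0]]
  | Xk1_2_6 k => Xcover ((2 ^ k)%N :: nseq 5 (2 ^ k.-1)%N)
      [tuple [:: -1; 0; 0; 0; 0; 1]; [:: -1; 0; 0; 0; 1; 0];
             [:: -1; 0; 0; 1; 0; 0]; [:: -1; 0; 1; 1; 0; 0];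
             [:: -1; 1; 0; 0; 0; 0]; [:: 1; 0; 0; 0; 0; 0]]
  | X'k1_2_6 k => Xcover ((2 ^ k)%N :: nseq 5 (2 ^ k.-1)%N)
      [tuple [:: 0; 0; 0; 0; 0; 1]; [:: -1; 0; 0; 0; 1; 0];
             [:: 0; 0; 0; 1; 0; 0]; [:: -1; 0; 1; 0; 0; 0];
             [:: 0; 1; 0; 0; 0; 0]; [:: 1; 0; 0; 0; 0; 0]]
  | Xk2_2_6 k => Xcover (nseq 2 (2 ^ k)%N ++ nseq 4 (2 ^ k.-1)%N)
      [tuple [:: 0; 1; 0; 0; 0; 1]; [:: 1; 0; 0; 0; 1; 0];
             [:: 0; 1; 0; 1; 0; 0]; [:: 1; 0; 1; 0; 0; 0];
             [:: 0; 1; 0; 0; 0; 0]; [:: 1; 0; 0; 0; 0; 0]]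
  | Xk3_p_3 k p l l' => Xcover (nseq 3 (p ^ k)%N)
      [tuple [:: 0; 0; 1]; [:: 0; 1; 0];
             [:: 1; - l'%:Z; - l%:Z]; [:: l%:Z; l%:Z; - l%:Z];
             [:: - l'%:Z; 1; - l%:Z]; [:: 1; 0; 0]]
  | Xk3_5_6 k => Xcover (nseq 3 (5 ^ k)%N ++ nseq 3 (5 ^ k.-1)%N)
      [tuple [:: 0; 0; 1; 0; 0; 0]; [:: 0; 1; 0; 0; 0; 0];
             [:: 1; 2; 2; 0; 0; 1]; [:: 3; 3; 2; 0; 1; 0];
             [:: 2; 1; 2; 1; 0; 0]; [:: 1; 0; 0; 0; 0; 0]]
  | Xkc3_p_6 k c p l l' => Xcover (nseq 3 (p ^ k)%N ++ nseq 3 (p ^ c)%N)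
      [tuple [:: 0; 0; 1; 0; 0; 0]; [:: 0; 1; 0; 0; 0; 0];
             [:: 1; - l'%:Z; - l%:Z; 0; 0; 1];
             [:: l%:Z; l%:Z; - l%:Z; 0; 1; 0];
             [:: - l'%:Z; 1; - l%:Z; 1; 0; 0]; [:: 1; 0; 0; 0; 0; 0]]
  | Xk6_p_6 k p => Xcover (nseq 6 (p ^ k)%N)
      [tuple [:: 1; 0; 0; 0; 0; 0]; [:: 0; 1; 0; 0; 0; 0];
             [:: 0; 0; 1; 0; 0; 0]; [:: 0; 0; 0; 1; 0; 0];
             [:: 0; 0; 0; 0; 1; 0]; [:: 0; 0; 0; 0; 0; 1]]
  end.

(* Main.v *)
(** The voltage covering attached to [phi] is determined by the kernel of the
    induced map from the homology of the Petersen graph, a lattice of rank 6.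
    A 4-arc of the Petersen graph is good or bad according as its ends are
    adjacent or not.  An automorphism of the covering that fixes a vertex and
    permutes its neighbours cyclically either preserves the good 4-arcs, and then
    it projects to the Petersen graph, or it exchanges good and bad in a pattern
    that forces closed walks of small length to lift to closed walks, which leaves
    only a few small coverings.  So the kernel is invariant under A5.  The homology
    is a module over Z[t], with t ^ 2 = t + 1 and t commuting with A5, and away
    from 2 the invariant sublattices of index a power of p come from the ideals of
    Z[t] above p; this yields the inert primes, p = 5 and p = +-1 mod 10.  The
    members of the list are told apart by order, exponent and the action of S5 on
    the kernels, and the last claim splits the covering group into its Sylow
    subgroups. *)

From Stdlib Require Import ZArith.
From Stdlib Require Classical_Prop.
Require Import Defs.
From HB Require Import structures.
From mathcomp Require Import all_boot all_algebra all_fingroup pgroup cyclic.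
From mathcomp Require Import zify ring ssrZ.

Set Implicit Arguments.
Unset Strict Implicit.
Unset Printing Implicit Defensive.

Import GRing.Theory.

(* MathComp uses the key %Z for [int]. *)
Delimit Scope Z_scope with ZZ.

Local Open Scope ring_scope.

(** * The Petersen graph on an enumerated type *)

(** Arc-transitivity concerns all automorphisms of the covering graph, and these need not permute
    the fibres; this is the main obstacle. Every 3-arc of the Petersen graph has one good and one
    bad continuation, so an automorphism acts around each 2-arc through a single bit [eps]. A closed
    walk with trivial homology lifts to a closed walk in every abelian covering; its image is closed
    again, and the class of the projected image lies in the kernel of [phi]. Unknown bits are
    guessed, and every guess either keeps an image from closing up or puts a short class into the
    kernel. The element t has its origin in representation theory: over Q(sqrt 5) the homology is
    the sum of the two conjugate 3-dimensional representations of A5. An involution fixes a line in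
    each, so its fixed part has rank 1 over Z[t], and an invariant lattice leaves an ideal of Z[t]
    there. The ideal determines the lattice only up to a factor 2, hence the separate treatment of
    2. Odd permutations conjugate t to 1 - t, so a kernel that belongs to a root l admits them only
    if l = 1 - l for the modulus in question. *)

Inductive pt := p0 | p1 | p2 | p3 | p4 | p5 | p6 | p7 | p8 | p9.

Definition npt (u : pt) : nat :=
  match u with p0 => 0 | p1 => 1 | p2 => 2 | p3 => 3 | p4 => 4
             | p5 => 5 | p6 => 6 | p7 => 7 | p8 => 8 | p9 => 9 end.

Definition eqpt (u v : pt) : bool :=
  match u, v with
  | p0, p0 | p1, p1 | p2, p2 | p3, p3 | p4, p4
  | p5, p5 | p6, p6 | p7, p7 | p8, p8 | p9, p9 => true
  | _, _ => false
  end.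

Lemma eqptP : Equality.axiom eqpt.
Proof. by move=> u v; apply: (iffP idP) => [|<-]; [case: u; case: v | case: u]. Qed.

HB.instance Definition _ := hasDecEq.Build pt eqptP.

Definition allpt := [:: p0; p1; p2; p3; p4; p5; p6; p7; p8; p9].

Lemma allptP (P : pt -> bool) : all P allpt -> forall u, P u.
Proof. by move/allP=> h u; apply: h; case: u. Qed.

Lemma npt_lt u : (npt u < 10)%N. Proof. by case: u. Qed.

(** All large checks run on [pt], whose constructors reduce under [vm_compute] without the proofs
    inside ordinals; [vx] and [tp] translate. *)
Definition vx (u : pt) : petersen := @Ordinal 10 (npt u) (npt_lt u).
Definition tp (v : petersen) : pt := nth p0 allpt (v : 'I_10).

Lemma vxK : cancel vx tp. Proof. by case. Qed.
Lemma tpK : cancel tp vx.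
Proof.
by case=> u ltu; apply: val_inj; do 10?[case: u ltu => [|u] ltu //].
Qed.

Definition adjp (u v : pt) : bool :=
  match u with
  | p0 => match v with p1 | p2 | p3 => true | _ => false end
  | p1 => match v with p0 | p4 | p5 => true | _ => false end
  | p2 => match v with p0 | p6 | p7 => true | _ => false end
  | p3 => match v with p0 | p8 | p9 => true | _ => false end
  | p4 => match v with p1 | p7 | p9 => true | _ => false end
  | p5 => match v with p1 | p6 | p8 => true | _ => false end
  | p6 => match v with p2 | p5 | p9 => true | _ => false end
  | p7 => match v with p2 | p4 | p8 => true | _ => false end
  | p8 => match v with p3 | p5 | p7 => true | _ => false end
  | p9 => match v with p3 | p4 | p6 => true | _ => false end
  end.

(* The two neighbours of [d] other than its neighbour [c]. *)
Definition oth (d c : pt) : pt * pt :=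
  match d with
  | p0 => match c with p1 => (p2, p3) | p2 => (p1, p3) | _ => (p1, p2) end
  | p1 => match c with p0 => (p4, p5) | p4 => (p0, p5) | _ => (p0, p4) end
  | p2 => match c with p0 => (p6, p7) | p6 => (p0, p7) | _ => (p0, p6) end
  | p3 => match c with p0 => (p8, p9) | p8 => (p0, p9) | _ => (p0, p8) end
  | p4 => match c with p1 => (p7, p9) | p7 => (p1, p9) | _ => (p1, p7) end
  | p5 => match c with p1 => (p6, p8) | p6 => (p1, p8) | _ => (p1, p6) end
  | p6 => match c with p2 => (p5, p9) | p5 => (p2, p9) | _ => (p2, p5) end
  | p7 => match c with p2 => (p4, p8) | p4 => (p2, p8) | _ => (p2, p4) end
  | p8 => match c with p3 => (p5, p7) | p5 => (p3, p7) | _ => (p3, p5) end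
  | p9 => match c with p3 => (p4, p6) | p4 => (p3, p6) | _ => (p3, p4) end
  end.

(* A 4-arc is good if its ends are adjacent, i.e. if it lies on a 5-cycle.
   Every 3-arc [(a, _, c, d)] has one good continuation ([l = false]) and one
   bad continuation ([l = true]). *)
Definition cont (a c d : pt) (l : bool) : pt :=
  let: (s, t) := oth d c in if xorb (adjp a s) l then s else t.

Lemma adj_vx u v : adj (vx u) (vx v) = adjp u v.
Proof. by case: u; case: v. Qed.

Lemma adjpC u v : adjp u v = adjp v u.
Proof. by case: u; case: v. Qed.

Definition arcp (a b c d : pt) :=
  [&& adjp a b, adjp b c, adjp c d, ~~ eqpt a c & ~~ eqpt b d].

Definition all2pt (P : pt -> pt -> bool) := all (fun u => all (P u) allpt) allpt.
Lemma all2ptP P : all2pt P -> forall u v, P u v.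
Proof. by move=> /allptP h u v; apply: (allptP (h u)). Qed.

Lemma cont_ok a b c d l : arcp a b c d ->
  [/\ adjp d (cont a c d l), ~~ eqpt (cont a c d l) c &
      adjp a (cont a c d l) = ~~ l].
Proof.
have /allptP h : all (fun a => all (fun b => all2pt (fun c d =>
    if arcp a b c d then all (fun l => [&& adjp d (cont a c d l),
      ~~ eqpt (cont a c d l) c & adjp a (cont a c d l) == ~~ l]) [:: true; false]
    else true)) allpt) allpt by vm_compute.
move=> abcd; have := all2ptP (allptP (h a) b) c d; rewrite abcd.
by move=> /allP/(_ l); rewrite mem_seq2; case: {h}l => /(_ isT) /and3P[? ? /eqP].
Qed.

Lemma cont_uniq a b c d x l : arcp a b c d -> adjp d x -> ~~ eqpt x c ->
  adjp a x = ~~ l -> x = cont a c d l.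
Proof.
have /allptP h : all (fun a => all (fun b => all2pt (fun c d =>
    if arcp a b c d then all (fun x => if adjp d x && ~~ eqpt x c then
      (x == cont a c d (~~ adjp a x)) else true) allpt else true)) allpt) allpt.
  by vm_compute.
move=> abcd dx xc ax; have := all2ptP (allptP (h a) b) c d; rewrite abcd.
by move=> /allptP/(_ x); rewrite dx xc ax negbK => /eqP.
Qed.

(* In a 4-arc, exchanging either end for the other possibility exchanges good
   and bad. *)
Lemma good_toggle a b c d e a' e' : arcp a b c d -> arcp b c d e ->
  adjp a' b -> ~~ eqpt a' c -> adjp d e' -> ~~ eqpt e' c ->
  adjp a' e' = xorb (adjp a e) (xorb (~~ eqpt a a') (~~ eqpt e e')).
Proof.
have /allptP h : all (fun a => all (fun b => all2pt (fun c d =>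
    if arcp a b c d then all (fun e => if arcp b c d e then all2pt (fun a' e' =>
     if [&& adjp a' b, ~~ eqpt a' c, adjp d e' & ~~ eqpt e' c] then
     (adjp a' e' == xorb (adjp a e) (xorb (~~ eqpt a a') (~~ eqpt e e')))
     else true) else true) allpt else true)) allpt) allpt by vm_compute.
move=> abcd bcde h1 h2 h3 h4.
have := all2ptP (allptP (h a) b) c d; rewrite abcd => /allptP/(_ e).
by rewrite bcde => /all2ptP/(_ a' e'); rewrite h1 h2 h3 h4 => /eqP.
Qed.

(** * Homology coordinates and voltage coverings *)

(** Coordinates are kept in the binary type [Z] for computation, while [*~] expects [int]. *)
Definition iz : Z -> int := int_of_Z.

Section Phi.
Variable A : finZmodType.

(** The homomorphism from homology to the voltage group, given by its values on the fundamental
    cycles. It is stated for lists of any length so that echelon rows can drop leading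
    coordinates. *)
Fixpoint phil (a : seq A) (h : seq Z) : A :=
  match a, h with x :: a', z :: h' => x *~ iz z + phil a' h' | _, _ => 0 end.

(** The case [y = 0] is split off to save arithmetic in the searches. *)
Fixpoint vsubq (q : Z) (v w : seq Z) : seq Z :=
  match v, w with
  | x :: v', y :: w' =>
    match y with 0%ZZ => x | _ => (x - q * y)%ZZ end :: vsubq q v' w'
  | _, _ => [::]
  end.

Lemma izD x y : iz (x + y)%ZZ = iz x + iz y. Proof. exact: (rmorphD int_of_Z). Qed.
Lemma izB x y : iz (x - y)%ZZ = iz x - iz y. Proof. exact: (rmorphB int_of_Z). Qed.
Lemma izM x y : iz (x * y)%ZZ = iz x * iz y. Proof. exact: (rmorphM int_of_Z). Qed.
Lemma izN x : iz (- x)%ZZ = - iz x. Proof. exact: (rmorphN int_of_Z). Qed.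

Lemma size_vsubq q v w : size v = size w -> size (vsubq q v w) = size w.
Proof. by elim: v w => [|x v IH] [|y w] //= [/IH ->]. Qed.

Lemma phil_vsubq (a : seq A) q v w : size v = size w ->
  phil a (vsubq q v w) = phil a v - phil a w *~ iz q.
Proof.
elim: a v w => [|x a IH] [|z v] [|y w] //=; rewrite ?mul0rz ?subr0 //.
move=> [/IH ->].
have -> : (match y with 0%ZZ => z | _ => (z - q * y)%ZZ end) = (z - q * y)%ZZ.
  by case: y => //; lia.
by rewrite izB izM [iz q * _]mulrC mulrzDr mulrNz mulrzA mulrzDl opprD addrACA.
Qed.

Lemma phil_opp (a : seq A) v : phil a (map Z.opp v) = - phil a v.
Proof.
elim: a v => [|x a IH] [|z v] //=; rewrite ?oppr0 //.
by rewrite IH izN mulrNz opprD.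
Qed.

Definition vaddl (v w : seq Z) : seq Z := vsubq (-1) v w.
Definition vscale (q : Z) (v : seq Z) : seq Z := vsubq (- q) (nseq (size v) 0%ZZ) v.

Lemma phil_nseq0 (a : seq A) n : phil a (nseq n 0%ZZ) = 0.
Proof. by elim: n a => [|n IH] [|x a] //=; rewrite IH mulr0z addr0. Qed.

Lemma phil_vaddl (a : seq A) v w : size v = size w ->
  phil a (vaddl v w) = phil a v + phil a w.
Proof. by move=> h; rewrite phil_vsubq // mulrN1z opprK. Qed.

Lemma phil_vscale (a : seq A) q v : phil a (vscale q v) = phil a v *~ iz q.
Proof. by rewrite phil_vsubq ?size_nseq // phil_nseq0 sub0r izN mulrNz opprK. Qed.

End Phi.

Fixpoint vaddn (k : nat) (s : Z) (v : seq Z) : seq Z :=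
  match v, k with
  | x :: v', O => (x + s)%ZZ :: v'
  | x :: v', S k' => x :: vaddn k' s v'
  | [::], _ => [::]
  end.

(** The coordinates of a walk are its signed numbers of passages through the cotree arcs; tree arcs
    contribute nothing. *)
Definition hstep (u v : pt) (h : seq Z) : seq Z :=
  match u, v with
  | p5, p8 => vaddn 0 1 h | p8, p5 => vaddn 0 (-1) h
  | p7, p8 => vaddn 1 1 h | p8, p7 => vaddn 1 (-1) h
  | p4, p7 => vaddn 2 1 h | p7, p4 => vaddn 2 (-1) h
  | p4, p9 => vaddn 3 1 h | p9, p4 => vaddn 3 (-1) h
  | p6, p9 => vaddn 4 1 h | p9, p6 => vaddn 4 (-1) h
  | p5, p6 => vaddn 5 1 h | p6, p5 => vaddn 5 (-1) h
  | _, _ => h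
  end.

Definition z6 : seq Z := [:: 0; 0; 0; 0; 0; 0]%ZZ.

Lemma size_vaddn k s v : size (vaddn k s v) = size v.
Proof. by elim: v k => [|x v IH] [|k] //=; rewrite IH. Qed.

Lemma size_hstep u v h : size (hstep u v h) = size h.
Proof. by case: u; case: v => //; apply: size_vaddn. Qed.

Lemma phil_vaddn (A : finZmodType) (a : seq A) k s v : (k < size v)%N ->
  phil a (vaddn k s v) = nth 0 a k *~ iz s + phil a v.
Proof.
elim: k a v => [|k IH] [|x a] [|z v] //= ltk; rewrite ?mul0rz ?addr0 //.
  by rewrite izD mulrzDr [x *~ iz z + _]addrC -addrA.
by rewrite IH // addrCA.
Qed.

Section Cover.
Variables (A : finZmodType) (a : 6.-tuple A).

Definition vg : sgraph := vgraph (reduced a).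
Definition phi (h : seq Z) : A := phil a h.
Definition pr (y : vg) : pt := tp y.1.
Definition nb (y : vg) (v : pt) : vg := (vx v, reduced a y.1 (vx v) + y.2).
(** A vertex is addressed by the end and the coordinates of a walk leading to it. Addresses with the
    same end name the same vertex exactly when the coordinates have the same voltage. *)
Definition Vtx (g : A) (q : pt * seq Z) : vg := (vx q.1, phi q.2 + g).

Lemma phi_hstep u v h : adjp u v -> size h = 6 ->
  phi (hstep u v h) = reduced a (vx u) (vx v) + phi h.
Proof.
move=> uv sh; have lt6 k : (k < 6)%N -> (k < size h)%N by rewrite sh.
have d6 : nth 0 a 6 = 0 by rewrite nth_default ?size_tuple.
by case: u uv; case: v => // _;
  rewrite /hstep /phi ?phil_vaddn ?lt6 // /= /reduced_volt /= ?d6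
    ?mulr1z ?mulrN1z ?subr0 ?sub0r ?add0r.
Qed.

Lemma nbE (y : vg) v : nb y v = (vx v, reduced a (vx (pr y)) (vx v) + y.2).
Proof. by rewrite /nb /pr tpK. Qed.

Lemma pr_nb y v : pr (nb y v) = v.
Proof. by rewrite /pr vxK. Qed.

Lemma pr_Vtx g q : pr (Vtx g q) = q.1.
Proof. by rewrite /pr vxK. Qed.

Lemma adjE (y z : vg) : adj y z = adjp (pr y) (pr z) && (z == nb y (pr z)).
Proof.
case: y z => [u g] [v h]; rewrite /nb /pr /= -adj_vx !tpK /= /vadj /=.
by rewrite -pair_eqE /pair_eq /= eqxx.
Qed.

Lemma adj_nb y v : adjp (pr y) v -> adj y (nb y v).
Proof. by move=> h; rewrite adjE pr_nb h eqxx. Qed.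

Lemma nbK y v : adjp (pr y) v -> nb (nb y v) (pr y) = y.
Proof.
move=> h; rewrite nbE pr_nb nbE (volt_anti (reduced a)) ?adj_vx //.
by rewrite /= addKr /pr tpK; case: y h.
Qed.

Lemma nb_Vtx g u v h : adjp u v -> size h = 6 ->
  nb (Vtx g (u, h)) v = Vtx g (v, hstep u v h).
Proof. by move=> uv sh; rewrite nbE pr_Vtx /= /Vtx /= phi_hstep ?addrA. Qed.

Lemma phi_z6 : phi z6 = 0.
Proof. exact: (phil_nseq0 a 6). Qed.

Lemma Vtx0 (y : vg) : y = Vtx y.2 (pr y, z6).
Proof. by rewrite /Vtx /= phi_z6 add0r /pr tpK; case: y. Qed.

Section Aut.
Variable f : {perm vg}.
Hypothesis fA : f \in Defs.aut vg.

Lemma aut_adj y z : adj (f y) (f z) = adj y z.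
Proof. by move: fA; rewrite inE => /forallP/(_ y)/forallP/(_ z)/eqP. Qed.

Lemma aut_nb y v : adjp (pr y) v ->
  adjp (pr (f y)) (pr (f (nb y v))) /\ f (nb y v) = nb (f y) (pr (f (nb y v))).
Proof. by move/adj_nb; rewrite -aut_adj adjE => /andP[? /eqP]. Qed.

Lemma aut_nb_inj y v w : adjp (pr y) v -> adjp (pr y) w ->
  pr (f (nb y v)) = pr (f (nb y w)) -> v = w.
Proof.
move=> /aut_nb[_ ev] /aut_nb[_ ew] e; move: ev; rewrite e -ew.
by move/perm_inj/(congr1 pr); rewrite !pr_nb.
Qed.

(* [eps y u w] tells whether [f] exchanges good and bad for the 4-arcs whose
   middle 2-arc lies over [(u, pr y, w)] and is centred at [y]. *)
Definition eps (y : vg) (u w : pt) : bool :=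
  let u' := (oth u (pr y)).1 in let w' := (oth w (pr y)).1 in
  xorb (adjp u' w') (adjp (pr (f (nb (nb y u) u'))) (pr (f (nb (nb y w) w')))).

Lemma epsC y u w : eps y u w = eps y w u.
Proof. by rewrite /eps adjpC [X in xorb _ X]adjpC. Qed.

Lemma oth_ok d c : adjp d c ->
  [/\ adjp d (oth d c).1, ~~ eqpt (oth d c).1 c,
      adjp d (oth d c).2, ~~ eqpt (oth d c).2 c & ~~ eqpt (oth d c).1 (oth d c).2].
Proof. by case: d; case: c. Qed.

Lemma aut_nb_neq y v w : adjp (pr y) v -> adjp (pr y) w -> ~~ eqpt v w ->
  ~~ eqpt (pr (f (nb y v))) (pr (f (nb y w))).
Proof.
by move=> yv yw; apply: contra => /eqptP /(aut_nb_inj yv yw) ->; case: (w).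
Qed.

Lemma aut_back y v w : adjp (pr y) v -> adjp v w -> ~~ eqpt w (pr y) ->
  ~~ eqpt (pr (f (nb (nb y v) w))) (pr (f y)).
Proof.
move=> yv vw wy; rewrite -{2}(nbK yv).
by apply: aut_nb_neq; rewrite ?pr_nb // adjpC.
Qed.

Lemma aut_arcp y u w u' w' : adjp (pr y) u -> adjp (pr y) w -> ~~ eqpt u w ->
  adjp u u' -> ~~ eqpt u' (pr y) -> adjp w w' -> ~~ eqpt w' (pr y) ->
  arcp (pr (f (nb (nb y u) u'))) (pr (f (nb y u))) (pr (f y)) (pr (f (nb y w))) /\
  arcp (pr (f (nb y u))) (pr (f y)) (pr (f (nb y w))) (pr (f (nb (nb y w) w'))).
Proof.
move=> yu yw uw uu' u'y ww' w'y.
have eqC p q : eqpt p q = eqpt q p by case: p; case: q.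
have [yu1 _] := aut_nb yu; have [yw1 _] := aut_nb yw.
have [] := @aut_nb (nb y u) u'; first by rewrite pr_nb.
have [] := @aut_nb (nb y w) w'; first by rewrite pr_nb.
move=> h1 _ h2 _; have n1 := aut_nb_neq yu yw uw.
have n2 := aut_back yu uu' u'y; have n3 := aut_back yw ww' w'y.
by split; apply/and5P; split; rewrite // 1?adjpC 1?eqC.
Qed.

(** [eps] is computed from one choice of ends. By [good_toggle] another choice changes goodness in
    the base and in the image alike. *)
Lemma eps_ok y u w u' w' : adjp (pr y) u -> adjp (pr y) w -> ~~ eqpt u w ->
  adjp u u' -> ~~ eqpt u' (pr y) -> adjp w w' -> ~~ eqpt w' (pr y) ->
  adjp (pr (f (nb (nb y u) u'))) (pr (f (nb (nb y w) w'))) =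
    xorb (adjp u' w') (eps y u w).
Proof.
move=> yu yw uw uu' u'y ww' w'y.
have eqC p q : eqpt p q = eqpt q p by case: p; case: q.
have uy : adjp u (pr y) by rewrite adjpC.
have wy : adjp w (pr y) by rewrite adjpC.
have [uo uoy _ _ _] := oth_ok uy; have [wo woy _ _ _] := oth_ok wy.
rewrite /eps; set u0 := (oth u _).1 in uo uoy *; set w0 := (oth w _).1 in wo woy *.
have [a1 a2] := aut_arcp yu yw uw uo uoy wo woy.
have [b1 b2] := aut_arcp yu yw uw uu' u'y ww' w'y.
have inj x x' z : adjp (pr y) x -> adjp x x' -> adjp x z ->
    eqpt (pr (f (nb (nb y x) x'))) (pr (f (nb (nb y x) z))) = eqpt x' z.
  move=> yx xx' xz; case e: (eqpt x' z).
    by move/eqptP: e => ->; case: (pr _).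
  by apply/negbTE/aut_nb_neq; rewrite ?pr_nb ?e.
case/and5P: b1 => c1 c2 c3 c4 c5; case/and5P: b2 => d1 d2 d3 d4 d5.
rewrite (good_toggle a1 a2 c1 c4 d3 _) 1?eqC // !inj //.
have ar1 : arcp u0 u (pr y) w by rewrite /arcp adjpC uo uy yw uoy uw.
have ar2 : arcp u (pr y) w w0 by rewrite /arcp uy yw wo uw eqC woy.
rewrite [adjp u' w'](good_toggle ar1 ar2 _ u'y ww' w'y) 1?adjpC //.
rewrite [eqpt u' u0]eqC; case: (eqpt u0 u'); case: (eqpt w0 w');
  by case: (adjp u0 w0); case: (adjp _ _).
Qed.

End Aut.
End Cover.

(** * A search for the images of closed walks of length 16 *)

(** G and B stand for a good and a bad step. [Gs n] and [Bs n] refer to a bit already on the stack;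
    [Gnew] and [Bnew] meet their middle 2-arc for the first time. A constraint consists of the
    positions of an initial 3-arc and of the steps that follow it. *)
Inductive thstep := Gs of nat | Bs of nat | Gnew | Bnew.
Inductive thconstr := TH of nat & nat & nat & nat & seq thstep.

(* A row in position [i] stands for the vector with [i] zeros put in front. *)
Definition lat := seq (option (seq Z)).

Fixpoint euclid (n : nat) (r v : seq Z) : seq Z * seq Z :=
  match n, v with
  | S n', z :: _ => if (z =? 0)%ZZ then (r, v) else
      euclid n' v (vsubq (head 0%ZZ r / z)%ZZ r v)
  | _, _ => (r, v)
  end.

Arguments euclid : simpl never.

(** The boolean tells whether the lattice has grown. Rows change by integer combinations only, so if
    [euclid] runs out of fuel a generator is lost but nothing false enters; [ladd_ok] records just
    this soundness. *)
Fixpoint ladd (L : lat) (v : seq Z) : lat * bool :=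
  match L, v with
  | o :: L', z :: v' =>
    if (z =? 0)%ZZ then let: (L1, c) := ladd L' v' in (o :: L1, c) else
    match o with
    | None => (Some (if (z <? 0)%ZZ then map Z.opp v else v) :: L', true)
    | Some r =>
      let: (q, m) := Z.div_eucl z (head 0%ZZ r) in
      if (m =? 0)%ZZ then
        let w := vsubq q v r in
        if (head 0%ZZ w =? 0)%ZZ then
          let: (L1, c) := ladd L' (behead w) in (o :: L1, c)
        else (L, false)
      else let: (r1, v1) := euclid 50 r v in
        if (head 0%ZZ v1 =? 0)%ZZ then
          let: (L1, _) := ladd L' (behead v1) in (Some r1 :: L1, true)
        else (L, false)
    end
  | _, _ => (L, false)
  end.

Fixpoint lmem (L : lat) (v : seq Z) : bool :=
  match L, v with
  | _, [::] => true
  | o :: L', z :: v' =>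
    if (z =? 0)%ZZ then lmem L' v' else
    match o with
    | None => false
    | Some r =>
      match head 0%ZZ r with
      | 1%ZZ => lmem L' (vsubq z v' (behead r))
      | z' => let: (q, m) := Z.div_eucl z z' in
        if (z' * q =? z)%ZZ then lmem L' (vsubq q v' (behead r)) else false
      end
    end
  | _, _ => false
  end.

Section LatOk.
Variable A : finZmodType.

Fixpoint lok (a : seq A) (L : lat) : Prop :=
  match L with
  | o :: L' => match o with
      | Some r => size r = size a /\ phil a r = 0
      | None => True end /\ lok (behead a) L'
  | [::] => True
  end.

Lemma euclid_ok n (a : seq A) r v : size r = size a -> size v = size a ->
  phil a r = 0 -> phil a v = 0 ->
  let: (r1, v1) := euclid n r v in
  [/\ size r1 = size a, size v1 = size a, phil a r1 = 0 & phil a v1 = 0].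
Proof.
elim: n r v => [|n IH] r v sr sv pr pv //; case: v sv pv => [|z v] sv pv //.
rewrite -[euclid _ _ _]/(if (z =? 0)%ZZ then (r, z :: v) else
  euclid n (z :: v) (vsubq (head 0 r / z)%ZZ r (z :: v))).
case: ifP => _ //; apply: IH => //; first by rewrite size_vsubq ?sr ?sv.
by rewrite phil_vsubq ?sr ?sv // pr pv mul0rz subr0.
Qed.

Lemma phil_behead (a : seq A) v : head 0%ZZ v = 0%ZZ ->
  phil (behead a) (behead v) = phil a v.
Proof.
case: a v => [|x a] [|z v] //=; first by case: a.
by move=> ->; rewrite mulr0z add0r.
Qed.

Lemma ladd_ok (a : seq A) L v : size v = size a -> phil a v = 0 ->
  lok a L -> lok a (ladd L v).1.
Proof.
elim: L a v => [|o L IH] a v sv pv //= [ho hL].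
have rec w : size w = size a -> phil a w = 0 -> head 0%ZZ w = 0%ZZ ->
    lok (behead a) (ladd L (behead w)).1.
  by move=> sw pw w0; apply: IH; rewrite ?size_behead ?sw // phil_behead.
case: v sv pv => [|z v] sv pv //.
case: ifP => [/Z.eqb_eq z0|_].
  by have := rec _ sv pv z0; rewrite /=; case: (ladd _ _).
case: o ho => [r [sr pr]|_]; last first.
  have sm : size (map Z.opp (z :: v)) = size a /\ phil a (map Z.opp (z :: v)) = 0.
    by rewrite size_map phil_opp pv oppr0.
  by split=> //; case: ifP => _; [exact: sm | split].
have sw q : size (vsubq q (z :: v) r) = size a by rewrite size_vsubq ?sr.
have pw q : phil a (vsubq q (z :: v) r) = 0.
  by rewrite phil_vsubq ?sr // pr pv mul0rz subr0.
case: (Z.div_eucl _ _) => q m; case: ifP => _.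
  case: ifP => [/Z.eqb_eq w0|_]; last by [].
  by have := rec _ (sw q) (pw q) w0; case: (ladd _ _).
have := euclid_ok 50 sr sv pr pv; case: (euclid _ _ _) => r1 v1 [sr1 sv1 pr1 pv1].
case: ifP => [/Z.eqb_eq w0|_]; last by [].
by have := rec _ sv1 pv1 w0; case: (ladd _ _).
Qed.

Lemma lmem_ok (a : seq A) L v : size v = size a -> lok a L -> lmem L v ->
  phil a v = 0.
Proof.
elim: L a v => [|o L IH] a [|z v] //=; try by case: a.
case: a => // x a [sv] [ho hL].
case: ifP => [/Z.eqb_eq -> /(IH a v sv hL) /= ->|_]; first by rewrite mulr0z addr0.
case: o ho => // r [sr pr] h.
have {h} [q eq1 h] : exists2 q, (head 0 r * q)%ZZ = z & lmem L (vsubq q v (behead r)).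
  have gen z' : (let: (q, m) := Z.div_eucl z z' in
      if (z' * q =? z)%ZZ then lmem L (vsubq q v (behead r)) else false) ->
      exists2 q, (z' * q)%ZZ = z & lmem L (vsubq q v (behead r)).
    case: (Z.div_eucl _ _) => q m; case e: (_ =? _)%ZZ => // hq.
    by exists q => //; apply/Z.eqb_eq.
  move: h; case: (head _ _) => [|[p|p|]|p]; try exact: gen.
  by move=> h; exists z; rewrite ?Z.mul_1_l.
case: r sr pr eq1 h => [|y r] // [sr] /= pr eq1 h.
have := IH a _ _ hL h; rewrite size_vsubq ?sr // phil_vsubq ?sr // => /(_ (erefl _)).
move/eqP; rewrite subr_eq0 => /eqP ->.
by rewrite -eq1 izM mulrzA -mulrzDl pr mul0rz.
Qed.
End LatOk.

(** The image of a step is the continuation whose letter is corrected by the bit of its 2-arc. For a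
    new 2-arc both bits are tried. A branch that fails a test cannot occur and counts as settled. *)
Fixpoint walk (st : seq thstep) (ts : seq (pt -> bool)) (x0 x1 x2 x3 : pt)
   (bits : seq bool) (vs : seq pt) (k : seq bool -> seq pt -> bool) : bool :=
  match st, ts with
  | s :: st', t :: ts' =>
    let go l bits' := let x := cont x0 x2 x3 l in
      if t x then walk st' ts' x1 x2 x3 x bits' (x :: vs) k else true in
    match s with
    | Gs n => go (nth false bits n) bits
    | Bs n => go (~~ nth false bits n) bits
    | Gnew => if go false (false :: bits) then go true (true :: bits) else false
    | Bnew => if go true (false :: bits) then go false (true :: bits) else false
    end
  | _, _ => k bits vs
  end.

Definition yes (_ : pt) := true.

(** The last four tests say that the image closes up on its initial 3-arc. The two before them prune
    earlier: two steps before its return to [s0] the image is at distance 2, one step before at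
    distance 1. *)
Definition tests (s0 s1 s2 s3 : pt) : seq (pt -> bool) :=
  [:: yes; yes; yes; yes; yes; yes; yes; yes; yes; yes;
      (fun v => ~~ (eqpt v s0 || adjp v s0)); adjp s0;
      eqpt s0; eqpt s1; eqpt s2; eqpt s3].

(** The newest vertex is on top of the stack, so this follows the walk backwards; the sign of the
    class does not matter. *)
Fixpoint hstack (n : nat) (vs : seq pt) (h : seq Z) : seq Z :=
  match n, vs with
  | S n', u :: ((v :: _) as vs') => hstack n' vs' (hstep u v h)
  | _, _ => h
  end.

(* The stacks [vs] and [bits] hold the images of the vertices and the values of
   [eps] met so far; the numbers in a constraint are positions in these stacks.
   The result [true] means that all branches are contradictory, or end in [fin]. *)
Fixpoint search (sh : seq (seq Z)) (cs : seq thconstr) (bits : seq bool)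
    (vs : seq pt) (L : lat) (fin : lat -> bool) : bool :=
  match cs with
  | [::] => fin L
  | TH k0 k1 k2 k3 st :: cs' =>
    let s0 := nth p0 vs k0 in let s1 := nth p0 vs k1 in
    let s2 := nth p0 vs k2 in let s3 := nth p0 vs k3 in
    walk st (tests s0 s1 s2 s3) s0 s1 s2 s3 bits vs (fun bits' vs' =>
      (* Position 15 holds the first of the 16 new vertices; its arc to [s3] closes the reversed
         walk. *)
      let h := hstack 15 vs' (hstep (nth p0 vs' 15) s3 z6) in
      if all (Z.eqb 0) h then search sh cs' bits' vs' L fin else
      let: (L', c) := ladd L h in
      if c then if has (lmem L') sh then true else search sh cs' bits' vs' L' fin
      else search sh cs' bits' vs' L' fin)
  end.

(** A vertex of the free abelian covering with group Z^6. Each constraint is verified there once,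
    and so holds in every [vg a]. *)
Definition coord := (pt * seq Z)%type.
Definition pkey := (coord * pt * pt)%type.
Definition letter (s : thstep) : bool :=
  match s with Gs _ | Gnew => false | Bs _ | Bnew => true end.
Definition snext (s : thstep) (q0 q2 q3 : coord) : coord :=
  let x := cont q0.1 q2.1 q3.1 (letter s) in (x, hstep q3.1 x q3.2).
Definition skey (q1 q2 q3 : coord) : pkey := (q2, q1.1, q3.1).
Definition pkey0 : pkey := ((p0, z6), p0, p0).
(** A 2-arc and its reverse share their bit, by [epsC]. *)
Definition samekey (k k' : pkey) := (k == k') || (k == (k'.1.1, k'.2, k'.1.2)).

Fixpoint sprod (st : seq thstep) (q0 q1 q2 q3 : coord) : seq coord :=
  match st with
  | s :: st' => let q4 := snext s q0 q2 q3 in q4 :: sprod st' q1 q2 q3 q4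
  | [::] => [::]
  end.

Fixpoint swalk (st : seq thstep) (q0 q1 q2 q3 : coord) (ps : seq pkey) :
    option (seq pkey) :=
  match st with
  | s :: st' =>
    let q4 := snext s q0 q2 q3 in let key := skey q1 q2 q3 in
    match s with
    | Gnew | Bnew => swalk st' q1 q2 q3 q4 (key :: ps)
    | Gs n | Bs n => if (n < size ps)%N && samekey (nth pkey0 ps n) key then
        swalk st' q1 q2 q3 q4 ps else None
    end
  | [::] => Some ps
  end.

Definition arcok (q0 q1 q2 q3 : coord) :=
  [&& arcp q0.1 q1.1 q2.1 q3.1, size q0.2 == 6%N,
      q1.2 == hstep q0.1 q1.1 q0.2, q2.2 == hstep q1.1 q2.1 q1.2 &
      q3.2 == hstep q2.1 q3.1 q2.2].

(* The constraint is a closed walk of length 16 with trivial homology, and its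
   references to the stacks are correct. *)
Definition sconstr (c : thconstr) (ps : seq pkey) (src : seq coord) :
    option (seq pkey * seq coord) :=
  let: TH k0 k1 k2 k3 st := c in
  let q0 := nth (p0, z6) src k0 in let q1 := nth (p0, z6) src k1 in
  let q2 := nth (p0, z6) src k2 in let q3 := nth (p0, z6) src k3 in
  let pd := sprod st q0 q1 q2 q3 in
  if [&& (k0 < size src)%N, (k1 < size src)%N, (k2 < size src)%N,
         (k3 < size src)%N, arcok q0 q1 q2 q3, size st == 16%N &
         drop 12 pd == [:: q0; q1; q2; q3]]
  then omap (fun ps' => (ps', catrev pd src)) (swalk st q0 q1 q2 q3 ps) else None.

Fixpoint swf (cs : seq thconstr) (ps : seq pkey) (src : seq coord) : bool :=
  match cs with
  | [::] => true
  | c :: cs' =>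
    match sconstr c ps src with
    | Some (ps', src') => swf cs' ps' src'
    | None => false
    end
  end.

Section SearchOk.
Variables (A : finZmodType) (a : 6.-tuple A) (f : {perm vg a}) (x : A).
Hypothesis fA : f \in Defs.aut (vg a).

Local Notation F q := (f (Vtx a x q)).
Local Notation im q := (pr (F q)).
Local Notation bt k := (eps f (Vtx a x k.1.1) k.1.2 k.2).

Lemma arcok_next s q0 q1 q2 q3 : arcok q0 q1 q2 q3 ->
  arcok q1 q2 q3 (snext s q0 q2 q3).
Proof.
case/and5P=> ar /eqP s0 /eqP e1 /eqP e2 /eqP e3.
have [h1 h2 h3] := cont_ok (letter s) ar; case/and5P: ar => a1 a2 a3 a4 a5.
have h2' : ~~ eqpt q2.1 (cont q0.1 q2.1 q3.1 (letter s)).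
  by apply: contra h2 => /eqptP <-; case: (q2.1).
by apply/and5P; split; [apply/and5P | rewrite e1 size_hstep s0 | apply/eqP..].
Qed.

Lemma coord_nb (q q' : coord) : adjp q.1 q'.1 -> size q.2 = 6%N ->
  q'.2 = hstep q.1 q'.1 q.2 -> Vtx a x q' = nb (Vtx a x q) q'.1.
Proof.
by case: q q' => [u h] [v h'] /= uv sh ->; rewrite nb_Vtx.
Qed.

Lemma arcok_Vtx q0 q1 q2 q3 : arcok q0 q1 q2 q3 ->
  [/\ Vtx a x q0 = nb (nb (Vtx a x q2) q1.1) q0.1,
      Vtx a x q1 = nb (Vtx a x q2) q1.1 & Vtx a x q3 = nb (Vtx a x q2) q3.1].
Proof.
case/and5P=> /and5P[a1 a2 a3 a4 a5] /eqP s0 /eqP e1 /eqP e2 /eqP e3.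
have s1 : size q1.2 = 6%N by rewrite e1 size_hstep.
have s2 : size q2.2 = 6%N by rewrite e2 size_hstep.
have v1 := coord_nb a1 s0 e1; have v2 := coord_nb a2 s1 e2.
have v3 := coord_nb a3 s2 e3.
have w1 : Vtx a x q1 = nb (Vtx a x q2) q1.1.
  by have := @nbK _ a (Vtx a x q1) q2.1; rewrite pr_Vtx v2 => ->.
by split=> //; have := @nbK _ a (Vtx a x q0) q1.1; rewrite pr_Vtx -w1 v1 => ->.
Qed.

Lemma arcok_im q0 q1 q2 q3 : arcok q0 q1 q2 q3 ->
  arcp (im q0) (im q1) (im q2) (im q3).
Proof.
move=> ok; have [-> -> ->] := arcok_Vtx ok.
case/and5P: ok => /and5P[a1 a2 a3 a4 a5] _ _ _ _.
have [u1 u2 _ _ _] := oth_ok (etrans (adjpC _ _) a3).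
have [] := @aut_arcp _ a f fA (Vtx a x q2) q1.1 q3.1 q0.1 (oth q3.1 q2.1).1;
  by rewrite ?pr_Vtx // adjpC.
Qed.

(** This makes the search faithful: by [eps_ok] the letter of the source step and the bit of its
    middle 2-arc together give the letter of the image step. *)
Lemma im_next s q0 q1 q2 q3 : arcok q0 q1 q2 q3 ->
  im (snext s q0 q2 q3) =
    cont (im q0) (im q2) (im q3) (xorb (letter s) (bt (skey q1 q2 q3))).
Proof.
move=> ok; have okn := arcok_next s ok.
apply: (cont_uniq (arcok_im ok)).
- by case/and5P: (arcok_im okn).
- by case/and5P: (arcok_im okn) => _ _ _ _; apply: contra => /eqptP->; case: pr.
have [v0 _ _] := arcok_Vtx ok; have [_ _ v4] := arcok_Vtx okn.
have [_ _ v3] := arcok_Vtx ok.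
rewrite v0 v4 v3 /skey /=.
case/and5P: (ok) => /and5P[a1 a2 a3 a4 a5] _ _ _ _.
case/and5P: (okn) => /and5P[b1 b2 b3 b4 b5] _ _ _ _.
rewrite (eps_ok fA) ?pr_Vtx //; first 1 last.
- by rewrite adjpC.
- by rewrite adjpC.
- by apply: contra b5 => /eqptP e; rewrite /= e; case: (q2.1).
have /and5P[ar _ _ _ _] := ok; have [_ _ ->] := cont_ok (letter s) ar.
by case: (letter s); case: eps.
Qed.

Lemma btE k k' : samekey k k' -> bt k = bt k'.
Proof. by case/orP=> /eqP-> //=; rewrite epsC. Qed.

Fixpoint tall (ts : seq (pt -> bool)) (qs : seq coord) : bool :=
  match ts, qs with t :: ts', q :: qs' => t (im q) && tall ts' qs' | _, _ => true end.

Lemma walk_ok st ts q0 q1 q2 q3 ps src ps' k : arcok q0 q1 q2 q3 ->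
  swalk st q0 q1 q2 q3 ps = Some ps' -> size ts = size st ->
  tall ts (sprod st q0 q1 q2 q3) ->
  walk st ts (im q0) (im q1) (im q2) (im q3) [seq bt k | k <- ps]
    [seq im q | q <- src] k ->
  k [seq bt k | k <- ps'] [seq im q | q <- catrev (sprod st q0 q1 q2 q3) src].
Proof.
elim: st ts q0 q1 q2 q3 ps src => [|s st IH] [|t ts] q0 q1 q2 q3 ps src ok //=.
  by case=> ->.
move=> sw [sz] /andP[tq tl]; have okn := arcok_next s ok; have e := im_next s ok.
have rec ps1 : swalk st q1 q2 q3 (snext s q0 q2 q3) ps1 = Some ps' ->
   (if t (im (snext s q0 q2 q3)) then
      walk st ts (im q1) (im q2) (im q3) (im (snext s q0 q2 q3))
        [seq bt k | k <- ps1] (im (snext s q0 q2 q3) :: [seq im q | q <- src]) k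
    else true) ->
   k [seq bt k | k <- ps'] [seq im q | q <- catrev
     (sprod st q1 q2 q3 (snext s q0 q2 q3)) (snext s q0 q2 q3 :: src)].
  by rewrite tq => sw1 w1; apply: (IH ts _ _ _ _ ps1 (_ :: src)).
case: s sw e okn tq tl rec => [n|n||] /=.
- case: ifP => // /andP[ln /btE en] sw e _ tq tl rec h; apply: (rec _ sw).
  by move: h; rewrite (nth_map pkey0) // en e.
- case: ifP => // /andP[ln /btE en] sw e _ tq tl rec h; apply: (rec _ sw).
  by move: h; rewrite (nth_map pkey0) // en e.
- move=> sw e _ tq tl rec h; apply: (rec _ sw); move: h; rewrite e /=.
  by case: (eps _ _ _ _); case: ifP.
- move=> sw e _ tq tl rec h; apply: (rec _ sw); move: h; rewrite e /=.
  by case: (eps _ _ _ _); case: ifP.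
Qed.

(** Each backward step contributes a difference of second components of image vertices; along the
    whole closed walk these differences telescope to 0. *)
Lemma im_back (q q' : coord) h : adjp q.1 q'.1 -> size q.2 = 6%N ->
  q'.2 = hstep q.1 q'.1 q.2 -> size h = 6%N ->
  phi a (hstep (im q') (im q) h) = (F q).2 - (F q').2 + phi a h.
Proof.
move=> adj sq e sh; have v' := coord_nb adj sq e.
have [aj _] : adjp (im q) (im q') /\ True.
  by have [] := @aut_nb _ a f fA (Vtx a x q) q'.1; rewrite ?pr_Vtx // -v'.
rewrite phi_hstep ?[adjp (im q') _]adjpC //; congr (_ + _).
have [_ ev] := @aut_nb _ a f fA (Vtx a x q) q'.1 (etrans (congr1 (adjp^~ _) (pr_Vtx _ _ _)) adj).
have : F q = nb (F q') (im q) by rewrite v' ev nbK // -v'.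
by move/(congr1 snd); rewrite nbE /= => ->; rewrite addrK.
Qed.

(** The true values of [eps] select one branch. Along it every computed class lies in the kernel, so
    the branch cannot end with a short class and must reach [fin]. *)
Lemma search_ok sh cs ps src L fin : swf cs ps src -> lok a L ->
  (forall h, h \in sh -> size h = 6%N /\ phi a h <> 0) ->
  search sh cs [seq bt k | k <- ps] [seq im q | q <- src] L fin ->
  exists2 L', lok a L' & fin L'.
Proof.
move=> + + shP; elim: cs ps src L => [|c cs IH] ps src L /=.
  by move=> _ hL h; exists L.
case ec: (sconstr c ps src) => [[ps' src']|] // wf hL.
case: c ec => k0 k1 k2 k3 st /=; case: ifP => // /and5P[l0 l1 l2 l3].
set q0 := nth _ src k0; set q1 := nth _ src k1; set q2 := nth _ src k2.
set q3 := nth _ src k3; move=> /and3P[ok /eqP st16 /eqP dr].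
case sw: (swalk _ _ _ _ _ _) => [ps1|] //= [e1 e2].
rewrite !(nth_map (p0, z6)) // -/q0 -/q1 -/q2 -/q3 => w.
suff [tl hom] : tall (tests (im q0) (im q1) (im q2) (im q3)) (sprod st q0 q1 q2 q3) /\
   phi a (hstack 15 [seq im q | q <- catrev (sprod st q0 q1 q2 q3) src]
     (hstep (nth p0 [seq im q | q <- catrev (sprod st q0 q1 q2 q3) src] 15) (im q3) z6)) = 0 /\
   size (hstack 15 [seq im q | q <- catrev (sprod st q0 q1 q2 q3) src]
     (hstep (nth p0 [seq im q | q <- catrev (sprod st q0 q1 q2 q3) src] 15) (im q3) z6)) = 6%N.
  have sz : size (tests (im q0) (im q1) (im q2) (im q3)) = size st by rewrite st16.
  move: {w}(walk_ok ok sw sz tl w) hom; rewrite e1 e2.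
  set h := hstack _ _ _ => /= k [ph sh6].
  case: ifP k => [_|_]; first exact: IH wf hL.
  have := @ladd_ok _ a L h; rewrite size_tuple => /(_ sh6 ph hL).
  case: (ladd L h) => L' c /= hL'; case: c; last exact: IH wf hL'.
  case: ifP => [/hasP[v vsh vL] _|_]; last exact: IH wf hL'.
  have [sv pv] := shP _ vsh; case: pv.
  by apply: lmem_ok hL' vL; rewrite size_tuple.
move: st st16 dr {w sw e2} => [|t0 [|t1 [|t2 [|t3 [|t4 [|t5 [|t6 [|t7 [|t8 [|t9
  [|t10 [|t11 [|t12 [|t13 [|t14 [|t15 [|//]]]]]]]]]]]]]]]]] // _.
rewrite [sprod _ _ _ _ _]/=.
pose q4 := snext t0 q0 q2 q3; have o1 : arcok q1 q2 q3 q4 := arcok_next t0 ok.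
rewrite -/q4.
pose q5 := snext t1 q1 q3 q4; have o2 : arcok q2 q3 q4 q5 := arcok_next t1 o1.
rewrite -/q5.
pose q6 := snext t2 q2 q4 q5; have o3 : arcok q3 q4 q5 q6 := arcok_next t2 o2.
rewrite -/q6.
pose q7 := snext t3 q3 q5 q6; have o4 : arcok q4 q5 q6 q7 := arcok_next t3 o3.
rewrite -/q7.
pose q8 := snext t4 q4 q6 q7; have o5 : arcok q5 q6 q7 q8 := arcok_next t4 o4.
rewrite -/q8.
pose q9 := snext t5 q5 q7 q8; have o6 : arcok q6 q7 q8 q9 := arcok_next t5 o5.
rewrite -/q9.
pose q10 := snext t6 q6 q8 q9; have o7 : arcok q7 q8 q9 q10 := arcok_next t6 o6.
rewrite -/q10.
pose q11 := snext t7 q7 q9 q10; have o8 : arcok q8 q9 q10 q11 := arcok_next t7 o7.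
rewrite -/q11.
pose q12 := snext t8 q8 q10 q11; have o9 : arcok q9 q10 q11 q12 := arcok_next t8 o8.
rewrite -/q12.
pose q13 := snext t9 q9 q11 q12; have o10 : arcok q10 q11 q12 q13 := arcok_next t9 o9.
rewrite -/q13.
pose q14 := snext t10 q10 q12 q13; have o11 : arcok q11 q12 q13 q14 := arcok_next t10 o10.
rewrite -/q14.
pose q15 := snext t11 q11 q13 q14; have o12 : arcok q12 q13 q14 q15 := arcok_next t11 o11.
rewrite -/q15.
pose q16 := snext t12 q12 q14 q15; have o13 : arcok q13 q14 q15 q16 := arcok_next t12 o12.
rewrite -/q16.
pose q17 := snext t13 q13 q15 q16; have o14 : arcok q14 q15 q16 q17 := arcok_next t13 o13.
rewrite -/q17.
pose q18 := snext t14 q14 q16 q17; have o15 : arcok q15 q16 q17 q18 := arcok_next t14 o14.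
rewrite -/q18.
pose q19 := snext t15 q15 q17 q18; have o16 : arcok q16 q17 q18 q19 := arcok_next t15 o15.
rewrite -/q19 => -[e16 e17 e18 e19].
split.
  have eqtt u : eqpt u u by case: u.
  rewrite [tall _ _]/= -e16 -e17 -e18 -e19 !eqtt !andbT.
  (* [q14] and [q16] are the ends of a 2-arc in a graph of girth 5, hence distinct and not adjacent,
     as the pruning test asks. *)
  have /and5P[_ h2 h3 _ h5] := arcok_im o13.
  move: h2 h3 h5; case: (im q16); case: (im q14) => //; by case: (im q15).
have bk q r s t h : arcok q r s t -> size h = 6%N ->
    phi a (hstep (im t) (im s) h) = (F s).2 - (F t).2 + phi a h.
  case/and5P=> /and5P[_ _ aj _ _] /eqP s0 /eqP h1 /eqP h2 /eqP h3 s6.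
  by apply: im_back => //; rewrite h2 size_hstep h1 size_hstep.
rewrite [catrev _ _]/= [map _ _]/= [nth _ _ _]/= [hstack _ _ _]/=.
rewrite !size_hstep; split=> //.
rewrite (bk _ _ _ _ _ o2) ?size_hstep // (bk _ _ _ _ _ o3) ?size_hstep //.
rewrite (bk _ _ _ _ _ o4) ?size_hstep // (bk _ _ _ _ _ o5) ?size_hstep //.
rewrite (bk _ _ _ _ _ o6) ?size_hstep // (bk _ _ _ _ _ o7) ?size_hstep //.
rewrite (bk _ _ _ _ _ o8) ?size_hstep // (bk _ _ _ _ _ o9) ?size_hstep //.
rewrite (bk _ _ _ _ _ o10) ?size_hstep // (bk _ _ _ _ _ o11) ?size_hstep //.
rewrite (bk _ _ _ _ _ o12) ?size_hstep // (bk _ _ _ _ _ o13) ?size_hstep //.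
rewrite (bk _ _ _ _ _ o14) ?size_hstep // (bk _ _ _ _ _ o15) ?size_hstep //.
rewrite (bk _ _ _ _ _ o16) ?size_hstep // (bk _ _ _ _ _ o1) // phi_z6 e19.
have tele (r s t w : A) : r - s + (s - t + w) = r - t + w by rewrite addrA subrKA.
by rewrite !tele addr0 subrr.
Qed.

End SearchOk.

(** * Exclusion of bad rotations *)

(* Products of two commutators of 8-cycles, found by computer; the positions refer to
   the stacks of [search]. *)
Definition thetas : seq thconstr := [::
  TH 4 8 9 7 [:: Bs 2; Bnew; Bnew; Gnew; Gnew; Bnew; Gnew; Gnew; Bnew; Bnew; Bnew; Gnew; Gnew; Bnew; Gnew; Gnew];
  TH 17 22 1 0 [:: Gs 16; Gs 14; Bs 13; Gs 12; Gs 11; Bs 10; Bs 9; Bnew; Gnew; Gnew; Bnew; Gnew; Gnew; Bnew; Bnew; Bnew];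
  TH 21 20 19 18 [:: Gs 10; Bs 9; Gs 24; Gs 0; Bs 1; Bs 2; Bs 3; Gnew; Gnew; Bnew; Gnew; Gnew; Bnew; Bnew; Bnew; Gs 19];
  TH 3 4 5 6 [:: Bs 2; Gs 3; Gs 4; Bs 5; Bs 6; Bnew; Gs 14; Gs 15; Bs 16; Gnew; Gs 26; Bs 25; Bs 24; Bs 23; Gnew; Gs 4];
  TH 44 43 8 9 [:: Bs 19; Gs 18; Gs 17; Bs 16; Bs 15; Bnew; Gnew; Gnew; Bnew; Gnew; Gnew; Bnew; Bnew; Bnew; Gnew; Gs 39];
  TH 34 33 32 47 [:: Bs 30; Gs 45; Gs 21; Bs 22; Gs 23; Gnew; Bs 9; Bs 8; Bnew; Gnew; Gnew; Bnew; Gnew; Gnew; Bnew; Bs 39];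
  TH 7 8 9 10 [:: Bs 6; Bs 15; Gs 16; Gs 17; Bs 28; Gs 27; Gs 26; Bnew; Bnew; Bnew; Gnew; Gnew; Bnew; Gnew; Gnew; Bs 13];
  TH 3 4 5 6 [:: Bs 2; Gs 3; Gs 4; Bs 5; Gs 6; Gnew; Bs 33; Bs 32; Bs 31; Gs 30; Gnew; Bs 11; Gs 12; Gs 13; Bnew; Bs 4];
  TH 1 2 3 4 [:: Bs 0; Gs 14; Gs 13; Bs 12; Bs 1; Bs 52; Gs 53; Gs 54; Bnew; Gnew; Gnew; Bnew; Bnew; Bnew; Gnew; Gs 11];
  TH 8 9 10 11 [:: Gs 61; Bs 60; Gs 36; Gs 40; Bs 41; Bs 42; Bs 9; Gnew; Gnew; Bnew; Gnew; Gnew; Bnew; Bnew; Bnew; Gs 14];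
  TH 3 4 5 6 [:: Bs 2; Gs 3; Gs 4; Bs 5; Bs 6; Bnew; Gs 24; Gs 23; Bs 22; Gnew; Gs 11; Bs 12; Bs 13; Bs 14; Gnew; Gs 4];
  TH 15 14 13 12 [:: Gs 9; Bs 10; Gs 28; Gs 55; Bs 56; Bs 49; Bs 63; Gnew; Gnew; Bnew; Gnew; Gnew; Bnew; Bnew; Bnew; Gs 16];
  TH 3 4 5 6 [:: Bs 2; Gs 3; Gs 4; Bs 5; Bs 6; Bnew; Gs 74; Gs 57; Bs 83; Gnew; Gs 13; Bs 14; Bs 15; Bs 16; Gnew; Gs 4];
  TH 38 37 36 7 [:: Gs 26; Bs 27; Bs 1; Bs 85; Gs 59; Gs 76; Bs 2; Gs 9; Gnew; Bnew; Bnew; Bnew; Gnew; Gnew; Bnew; Gs 32];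
  TH 6 7 8 9 [:: Bs 5; Gs 6; Gs 16; Bs 9; Bs 83; Bs 84; Gs 94; Gs 55; Bs 56; Gs 57; Gnew; Bnew; Bnew; Bnew; Gnew; Gs 9];
  TH 128 143 142 60 [:: Bs 69; Bs 85; Gs 86; Gs 22; Bs 21; Gs 11; Gs 10; Bnew; Bnew; Bnew; Gnew; Gnew; Bnew; Gnew; Gnew; Bs 76];
  TH 90 89 88 114 [:: Bs 54; Gs 53; Gs 52; Bs 65; Gs 66; Gnew; Bs 2; Bs 3; Bs 4; Gnew; Gnew; Bnew; Gnew; Gnew; Bnew; Bs 62];
  TH 39 199 200 13 [:: Gs 80; Gs 81; Bs 6; Bs 8; Bs 9; Gs 10; Gs 11; Bs 12; Gs 13; Gnew; Bs 16; Bs 17; Bs 18; Gs 19; Gnew; Bs 81];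
  TH 67 119 17 18 [:: Gs 41; Gs 64; Bs 2; Gs 3; Gs 4; Bs 5; Bs 6; Bnew; Gs 15; Gs 16; Bs 2; Gs 26; Gs 25; Bs 24; Bnew; Bs 54];
  TH 16 46 47 32 [:: Gs 63; Bs 64; Gs 53; Gs 54; Bs 0; Bs 25; Bs 26; Gnew; Gs 21; Bs 22; Gs 23; Gs 3; Bs 84; Bs 85; Bnew; Gs 78];
  TH 27 26 44 45 [:: Bs 16; Bs 15; Gs 14; Gs 13; Bs 89; Gs 90; Gs 101; Bnew; Bnew; Bnew; Gnew; Gnew; Bnew; Gnew; Gnew; Bs 19];
  TH 128 143 92 93 [:: Bs 49; Gs 50; Gs 51; Bs 115; Gs 101; Gs 7; Bs 6; Bs 5; Bs 4; Gnew; Gnew; Bnew; Gnew; Gnew; Bnew; Bs 54];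
  TH 1 107 55 56 [:: Bs 34; Bs 33; Gs 32; Gs 17; Bs 6; Gs 7; Gs 8; Bnew; Bs 5; Bs 4; Gs 3; Gs 2; Bs 1; Gs 55; Gnew; Bs 47];
  TH 28 27 26 25 [:: Bs 13; Gs 12; Gs 11; Bs 10; Bs 9; Bnew; Gs 26; Gs 25; Bs 24; Gnew; Gs 88; Bs 89; Bs 90; Bs 117; Gnew; Gs 17];
  TH 387 352 288 303 [:: Bs 146; Bs 121; Bs 122; Gs 123; Gs 99; Bs 108; Gs 107; Gs 106; Bnew; Bnew; Bnew; Gnew; Gnew; Bnew; Gnew; Gnew];
  TH 9 8 7 6 [:: Bs 5; Gs 4; Gs 3; Bs 2; Bs 1; Bnew; Gs 152; Gs 151; Bs 150; Gnew; Gs 111; Bs 112; Bs 113; Bs 114; Gnew; Gs 9];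
  TH 287 272 97 98 [:: Gs 107; Bs 108; Gs 30; Gs 10; Bs 9; Bs 8; Bs 7; Gnew; Gnew; Bnew; Gnew; Gnew; Bnew; Bnew; Bnew; Gs 114];
  TH 3 302 301 338 [:: Bs 111; Bs 150; Gs 149; Gs 166; Bs 11; Gs 12; Gs 13; Bnew; Bs 7; Bs 6; Gs 5; Gs 4; Bs 3; Gs 2; Gnew; Bs 114];
  TH 5 4 3 18 [:: Bs 2; Gs 116; Gs 117; Bs 118; Bs 40; Bs 126; Gs 125; Gs 124; Bnew; Gnew; Gnew; Bnew; Bnew; Bnew; Gnew; Gs 10];
  TH 6 5 4 3 [:: Bs 1; Gs 0; Gs 10; Bs 9; Bs 123; Bs 109; Gs 113; Gs 102; Bs 103; Gs 104; Gnew; Bnew; Bnew; Bnew; Gnew; Gs 7]].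

(* The homology classes of the 6-cycles and 8-cycles, up to sign. *)
Definition shorts : seq (seq Z) := [::
  [:: 0; 0; 0; 0; 1; 1]; [:: 0; 0; 0; 1; -1; 0]; [:: 0; 0; 0; 1; 0; -1];
  [:: 0; 0; 1; -1; 0; 0]; [:: 0; 0; 1; -1; 1; 1]; [:: 0; 0; 1; 0; 0; -1];
  [:: 0; 0; 1; 0; 1; 0]; [:: 0; 1; 0; 0; -1; 0]; [:: 0; 1; 1; 0; 0; 0];
  [:: 0; 1; 0; -1; 0; 0]; [:: 0; 1; 0; 0; 0; 1]; [:: 0; 1; 1; 0; -1; -1];
  [:: 0; 1; 1; -1; 1; 0]; [:: 1; -1; 0; 0; 0; 0]; [:: 1; -1; -1; 1; -1; -1];
  [:: 1; -1; 0; -1; 1; 0]; [:: 1; -1; -1; 1; 0; 0]; [:: 1; -1; 0; 0; -1; -1];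
  [:: 1; -1; -1; 0; 0; -1]; [:: 1; 0; -1; 0; 0; 0]; [:: 1; 0; 1; -1; 0; -1];
  [:: 1; 0; 0; -1; 0; 0]; [:: 1; 0; 0; 0; 0; -1]; [:: 1; 0; 0; 0; -1; 0];
  [:: 1; 0; 0; 1; -1; -1]]%ZZ.

(* The base images of the ball of radius 2 about a vertex over [p0] under a
   rotation that turns two of the three pairings of the ball from bad to good. *)
Definition rimg (u : pt) : pt :=
  match u with p0 => p0 | p1 => p2 | p2 => p3 | p3 => p1 | p4 => p7
             | p5 => p6 | p6 => p9 | p7 => p8 | p8 => p4 | p9 => p5 end.

(* The automorphism induced by (b c), which conjugates [rimg] into its inverse. *)
Definition sigp (u : pt) : pt :=
  match u with p0 => p0 | p1 => p3 | p2 => p2 | p3 => p1 | p4 => p8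
             | p5 => p9 | p6 => p6 | p7 => p7 | p8 => p4 | p9 => p5 end.

Definition ball := [:: p9; p8; p7; p6; p5; p4; p3; p2; p1; p0].
Definition ballc (s : pt -> pt) : seq coord := [seq (s u, z6) | u <- ball].
Definition ballp (s : pt -> pt) : seq pkey :=
  [:: ((s p0, z6), s p3, s p1); ((s p0, z6), s p2, s p3); ((s p0, z6), s p1, s p2)].

Lemma swf_id : swf (take 15 thetas) (ballp id) (ballc id).
Proof. by vm_cast_no_check (erefl true). Qed.

Lemma swf_sigp : swf (take 30 thetas) (ballp sigp) (ballc sigp).
Proof. by vm_cast_no_check (erefl true). Qed.

(** Branches that survive the constraints for [f] hand their lattice to a second search, for the
    inverse of [f]. After relabelling by [sigp] the inverse shows the same local pattern, so the
    same walks serve again. *)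
Lemma search_empty :
  search shorts (take 15 thetas) [:: true; true; false] [seq rimg u | u <- ball]
    (nseq 6 None) (fun L =>
  search shorts (take 30 thetas) [:: true; true; false]
    [seq sigp (rimg u) | u <- ball] L (fun _ => false)).
Proof. by vm_cast_no_check (erefl true). Qed.

Definition tpath (v : pt) : seq pt :=
  match v with
  | p0 => [::] | p1 | p2 | p3 => [:: v]
  | p4 | p5 => [:: p1; v] | p6 | p7 => [:: p2; v] | p8 | p9 => [:: p3; v]
  end.

Lemma aut1P (G : sgraph) (f : {perm G}) :
  reflect (forall x y, adj (f x) (f y) = adj x y) (f \in Defs.aut G).
Proof.
rewrite inE; apply: (iffP forallP) => [h x y | h x].
  by move: (h x) => /forallP/(_ y)/eqP.
by apply/forallP=> y; apply/eqP.
Qed.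

Lemma autV (G : sgraph) (f : {perm G}) : f \in Defs.aut G -> f^-1%g \in Defs.aut G.
Proof. by move/aut1P=> h; apply/aut1P=> x y; rewrite -h !permKV. Qed.

Lemma autM (G : sgraph) (f k : {perm G}) :
  f \in Defs.aut G -> k \in Defs.aut G -> (f * k)%g \in Defs.aut G.
Proof. by move=> /aut1P h /aut1P h'; apply/aut1P=> x y; rewrite !permM h' h. Qed.

Definition walkv (A : finZmodType) (a : 6.-tuple A) (y : vg a) (p : seq pt) : vg a :=
  foldl (@nb A a) y p.

Definition noshort (A : finZmodType) (a : 6.-tuple A) :=
  forall h, h \in shorts -> phi a h <> 0.

Section NoBadRotation.
Variables (A : finZmodType) (a : 6.-tuple A) (f : {perm vg a}) (y : vg a).
Hypotheses (fA : f \in Defs.aut (vg a)) (y0 : pr y = p0) (fy : f y = y).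

Lemma Vtx_ball v : Vtx a y.2 (v, z6) = walkv y (tpath v).
Proof.
by rewrite {2}(Vtx0 y) y0; case: v => //; rewrite /walkv /= !nb_Vtx.
Qed.

Lemma no_bad_rotation : noshort a ->
  (forall v, pr (f (walkv y (tpath v))) = rimg v) -> False.
Proof.
move=> ns im.
have lev1 v : adjp p0 v -> f (nb y v) = nb y (rimg v).
  move=> v0; have [_ ->] : _ /\ _ := aut_nb fA (etrans (congr1 (adjp^~ v) y0) v0).
  rewrite fy; congr nb; rewrite -im; by case: v v0.
have fE v : f (Vtx a y.2 (v, z6)) = Vtx a y.2 (rimg v, z6).
  have lev2 u w : adjp p0 u -> adjp u w ->
      f (nb (nb y u) w) = nb (nb y (rimg u)) (pr (f (nb (nb y u) w))).
    move=> hu uw; have [_ e] := @aut_nb _ a f fA (nb y u) w (etrans (congr1 (adjp^~ w) (pr_nb _ _)) uw).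
    by rewrite {1}e lev1.
  rewrite !Vtx_ball; case: v; rewrite /walkv /= ?lev1 //;
    rewrite lev2 //; congr nb; exact: (im p4) || exact: (im p5) || exact: (im p6)
      || exact: (im p7) || exact: (im p8) || exact: (im p9).
(* By the choice of [sigp], [rimg (sigp (rimg v))] is [sigp v]. *)
have fV v : f^-1%g (Vtx a y.2 (sigp v, z6)) = Vtx a y.2 (sigp (rimg v), z6).
  by apply: (@perm_inj _ f); rewrite permKV fE; case: v.
have sh h : h \in shorts -> size h = 6%N /\ phi a h <> 0.
  move=> hs; split; last exact: ns.
  by have /allP/(_ h hs)/eqP := isT : all (fun h => size h == 6%N) shorts.
have yE : Vtx a y.2 (p0, z6) = y by rewrite Vtx_ball.
have l0 : lok a (nseq 6 None) by [].
have imE k (u w : pt) : (k = f \/ k = f^-1%g) -> adjp p0 u -> adjp u w -> ~~ eqpt w p0 ->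
  pr (k (nb (nb y u) w)) = pr (k (Vtx a y.2 (w, z6))).
  by move=> _; rewrite Vtx_ball; case: u => // _; case: w.
have e1 : [seq eps f (Vtx a y.2 k.1.1) k.1.2 k.2 | k <- ballp id] = [:: true; true; false].
  rewrite /= yE /eps y0 /= !(imE f) //; try by left.
  by rewrite !fE !pr_Vtx.
have e2 : [seq eps f^-1%g (Vtx a y.2 k.1.1) k.1.2 k.2 | k <- ballp sigp] = [:: true; true; false].
  rewrite /= yE /eps y0 /= !(imE f^-1%g) //; try by right.
  by rewrite -[p4]/(sigp p8) -[p6]/(sigp p6) -[p8]/(sigp p4) !fV !pr_Vtx.
have i1 : [seq pr (f (Vtx a y.2 q)) | q <- ballc id] = [seq rimg u | u <- ball].
  by rewrite -map_comp; apply: eq_map => u /=; rewrite fE pr_Vtx.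
have i2 : [seq pr (f^-1%g (Vtx a y.2 q)) | q <- ballc sigp] = [seq sigp (rimg u) | u <- ball].
  by rewrite -map_comp; apply: eq_map => u /=; rewrite fV pr_Vtx.
have := search_empty; rewrite -{1}e1 -{1}i1.
case/(search_ok fA swf_id l0 sh) => L lL; rewrite -e2 -i2.
by case/(search_ok (autV fA) swf_sigp lL sh).
Qed.

End NoBadRotation.

(** * Automorphisms of the Petersen graph and relabelling *)

Definition isaut (s : pt -> pt) := forall u v, adjp (s u) (s v) = adjp u v.

Lemma isaut_inj s : isaut s -> injective s.
Proof.
move=> sA u v e; have h w : adjp u w = adjp v w by rewrite -sA e sA.
by move: (h p0) (h p1) (h p2) (h p3) (h p4) (h p5) (h p6) (h p7) (h p8) (h p9);
  case: u {h e}; case: v.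
Qed.

(* The automorphism that sends the 3-arc [(p4, p1, p0, p2)] to [(x, y, z, w)]. *)
Definition ext (x y z w : pt) (u : pt) : pt :=
  let s6 := cont x z w true in
  let s3 := if eqpt (oth z y).1 w then (oth z y).2 else (oth z y).1 in
  match u with
  | p4 => x | p1 => y | p0 => z | p2 => w | p7 => cont x z w false | p6 => s6
  | p5 => cont s6 z y false | p3 => s3 | p9 => cont x z s3 false
  | p8 => cont x z s3 true
  end.

Definition nbl (u : pt) : seq pt := [seq v <- allpt | adjp u v].

Lemma mem_nbl u v : (v \in nbl u) = adjp u v.
Proof. by rewrite mem_filter andbC; case: v. Qed.

Definition all_arc3 (P : pt -> pt -> pt -> pt -> bool) : bool :=
  all (fun x => all (fun y => all (fun z => if eqpt x z then true else
    all (fun w => if eqpt y w then true else P x y z w) (nbl z)) (nbl y)) (nbl x)) allpt.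

Lemma all_arc3P P : all_arc3 P -> forall x y z w, arcp x y z w -> P x y z w.
Proof.
move=> /allptP h x y z w /and5P[xy yz zw xz yw].
have /allP/(_ y) := h x; rewrite mem_nbl => /(_ xy) /allP/(_ z).
rewrite mem_nbl => /(_ yz); rewrite (negbTE xz) => /allP/(_ w).
by rewrite mem_nbl => /(_ zw); rewrite (negbTE yw).
Qed.

Lemma ext_aut x y z w : arcp x y z w -> isaut (ext x y z w).
Proof.
have /all_arc3P h : all_arc3 (fun x y z w =>
  all2pt (fun u v => adjp (ext x y z w u) (ext x y z w v) == adjp u v)).
  by vm_compute.
by move/h=> /all2ptP e u v; apply/eqP.
Qed.

Lemma cont_aut s a b c d l : isaut s -> arcp a b c d ->
  s (cont a c d l) = cont (s a) (s c) (s d) l.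
Proof.
move=> sA ar; have sI := isaut_inj sA.
have eqs u v : eqpt (s u) (s v) = eqpt u v.
  by apply/eqptP/eqptP=> [/sI|->].
have ar' : arcp (s a) (s b) (s c) (s d) by rewrite /arcp !sA !eqs.
have [h1 h2 h3] := cont_ok l ar.
by apply: (cont_uniq ar'); rewrite ?sA ?eqs.
Qed.

Fixpoint hwalk (u : pt) (p : seq pt) (h : seq Z) : seq Z :=
  if p is v :: p' then hwalk v p' (hstep u v h) else h.

Lemma size_hwalk u p h : size (hwalk u p h) = size h.
Proof. by elim: p u h => //= v p IH u h; rewrite IH size_hstep. Qed.

(** The potential that makes the voltage pulled back along [s] vanish on the tree. *)
Definition csum (s : pt -> pt) (v : pt) : seq Z := hwalk (s p0) (map s (tpath v)) z6.

Lemma size_csum s v : size (csum s v) = 6%N.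
Proof. exact: size_hwalk. Qed.

(* The class of the image under [s] of the fundamental cycle of a cotree arc. *)
Definition Mcol (s : pt -> pt) (u v : pt) : seq Z :=
  vsubq 1 (hstep (s u) (s v) (csum s u)) (csum s v).

Definition Mat (s : pt -> pt) : 6.-tuple (seq Z) :=
  [tuple Mcol s p5 p8; Mcol s p7 p8; Mcol s p4 p7; Mcol s p4 p9; Mcol s p6 p9;
         Mcol s p5 p6].

Fixpoint lcomb (h : seq Z) (m : seq (seq Z)) : seq Z :=
  match h, m with
  | z :: h', r :: m' => vaddl (vscale z r) (lcomb h' m')
  | _, _ => z6
  end.

Definition mulM (s : pt -> pt) (h : seq Z) : seq Z := lcomb h (Mat s).

Lemma size_Mat s r : r \in (Mat s : seq _) -> size r = 6%N.
Proof.
by rewrite !inE => /or3P[|| /or4P[]] /eqP->; rewrite /Mcol size_vsubq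
  ?size_hstep ?size_csum.
Qed.

Lemma size_lcomb h m : (forall r, r \in m -> size r = 6%N) -> size (lcomb h m) = 6%N.
Proof.
elim: h m => [|z h IH] [|r m] //= hm; rewrite size_vsubq IH ?size_vsubq ?size_nseq //.
- by move=> r' r'm; apply: hm; rewrite inE r'm orbT.
- by rewrite hm ?mem_head.
- by move=> r' r'm; apply: hm; rewrite inE r'm orbT.
Qed.

Lemma size_mulM s h : size (mulM s h) = 6%N.
Proof. exact/size_lcomb/size_Mat. Qed.

Section Relabel.
Variables (A : finZmodType) (b : 6.-tuple A) (s : pt -> pt).
Hypothesis sA : isaut s.

(** The voltage pulled back along [s] and made T-reduced by the potential [csum]; [psi] is the
    resulting isomorphism of coverings over [s]. *)
Definition relab : 6.-tuple A := map_tuple (phi b) (Mat s).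

Lemma phiD v w : size v = size w -> phi b (vaddl v w) = phi b v + phi b w.
Proof. exact: phil_vaddl. Qed.

Lemma phiZ q v : phi b (vscale q v) = phi b v *~ iz q.
Proof. exact: phil_vscale. Qed.

Lemma phi_lcomb h m : (forall r, r \in m -> size r = 6%N) ->
  phi b (lcomb h m) = phil (map (phi b) m) h.
Proof.
elim: h m => [|z h IH] [|r m] hm; rewrite ?phi_z6 //=.
have hm' r' : r' \in m -> size r' = 6%N by move=> r'm; apply: hm; rewrite inE r'm orbT.
by rewrite phiD ?phiZ ?IH // size_lcomb // size_vsubq ?size_nseq // hm ?mem_head.
Qed.

Lemma phi_relab h : phi relab h = phi b (mulM s h).
Proof. by rewrite phi_lcomb //; apply: size_Mat. Qed.

Lemma relab_volt u v : adjp u v ->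
  reduced b (vx (s u)) (vx (s v)) + phi b (csum s u) =
  reduced relab (vx u) (vx v) + phi b (csum s v).
Proof.
have stp u' v' : adjp u' v' -> reduced b (vx (s u')) (vx (s v')) + phi b (csum s u') =
    phi b (hstep (s u') (s v') (csum s u')).
  by move=> h; rewrite phi_hstep ?sA ?size_csum.
have cot u' v' : adjp u' v' -> phi b (Mcol s u' v') =
    reduced b (vx (s u')) (vx (s v')) + phi b (csum s u') - phi b (csum s v').
  move=> h; rewrite /Mcol /phi phil_vsubq ?size_hstep ?size_csum //.
  by rewrite mulr1z -/(phi b _) -stp.
have d6 : nth 0 relab 6 = 0 by rewrite nth_default ?size_tuple.
pose l := [:: (p0, p1); (p0, p2); (p0, p3); (p1, p4); (p1, p5); (p2, p6);
  (p2, p7); (p3, p8); (p3, p9); (p5, p8); (p7, p8); (p4, p7); (p4, p9); (p6, p9); (p5, p6)].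
have half u' v' : adjp u' v' -> (u', v') \in l ->
   reduced b (vx (s u')) (vx (s v')) + phi b (csum s u') =
   reduced relab (vx u') (vx v') + phi b (csum s v').
  move=> uv; rewrite stp //; case: u' uv; case: v' => // uv _;
    rewrite [reduced relab _ _]/= /reduced_volt /= ?d6 ?subr0 ?add0r //;
    by rewrite cot // subrK stp.
move=> uv; have [h|h] : (u, v) \in l \/ (v, u) \in l.
- by move: uv; case: u; case: v => // _; (by left) || (by right).
- exact: half uv h.
have vu : adjp v u by rewrite adjpC.
have := half _ _ vu h; rewrite (volt_anti (reduced b)) ?adj_vx ?sA //.
rewrite (volt_anti (reduced relab)) ?adj_vx // => e.
apply: (addrI (- reduced b (vx (s u)) (vx (s v)))).
by rewrite addKr addrCA e addNKr.
Qed.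

Definition psi_fun (y : petersen * A) : petersen * A :=
  (vx (s (tp y.1)), y.2 + phi b (csum s (tp y.1))).

Lemma psi_inj : injective psi_fun.
Proof.
move=> [u x] [v y] e; have := congr1 (fun z => tp z.1) e.
rewrite /= !vxK => /(isaut_inj sA) /(can_inj tpK) uv.
by have := congr1 snd e; rewrite /= uv => /addIr ->.
Qed.

Definition psi : {perm petersen * A} := perm psi_inj.

Definition psiv (y : vg relab) : vg b := psi y.

Lemma pr_psi y : pr (psiv y) = s (pr y).
Proof. by rewrite /psiv permE /pr vxK. Qed.

Lemma psi_nb y v : adjp (pr y) v -> psiv (nb y v) = nb (psiv y) (s v).
Proof.
move=> yv; rewrite [RHS]nbE pr_psi /psiv !permE /psi_fun /= vxK; congr pair.
rewrite -[y.1]tpK -/(pr y) [in RHS]addrCA [in RHS]vxK.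
rewrite -addrA [y.2 + _]addrC addrA -(relab_volt yv).
by rewrite -addrA [_ + y.2]addrC addrCA.
Qed.

Lemma psi_adj y z : adj (psiv y) (psiv z) = adj y z.
Proof.
rewrite !adjE !pr_psi sA; case yz: (adjp _ _) => //=.
rewrite -psi_nb //; apply/eqP/eqP=> [|->]; last by rewrite pr_nb.
exact: perm_inj.
Qed.

Definition conj_psi (f : {perm vg b}) : {perm vg relab} := (psi * f * psi^-1)%g.

Lemma psi_conj f y : psiv (conj_psi f y) = f (psiv y).
Proof. by rewrite /psiv /conj_psi !permM permKV. Qed.

Lemma conj_psi_aut f : f \in Defs.aut (vg b) -> conj_psi f \in Defs.aut (vg relab).
Proof. by move/aut1P=> fA; apply/aut1P=> y z; rewrite -psi_adj !psi_conj fA psi_adj. Qed.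

End Relabel.

(** * Rotations *)

(** The order 3 is demanded on the ball of radius 2 only, which is all that can be arranged from
    arc-transitivity. *)
Definition rotation (G : sgraph) (f : {perm G}) (y : G) : Prop :=
  [/\ f \in Defs.aut G, f y = y, forall z, adj y z -> f z <> z,
      forall z, adj y z -> f (f (f z)) = z &
      forall z w, adj y z -> adj z w -> f (f (f w)) = w].

Lemma rotation_conj (G : sgraph) (f k : {perm G}) y : k \in Defs.aut G ->
  rotation f y -> rotation (k^-1 * f * k)%g (k y).
Proof.
move=> kA [fA fy nf f3 f33]; have kV := aut1P _ (autV kA).
have e x : (k^-1 * f * k)%g x = k (f (k^-1%g x)) by rewrite !permM.
have back z : adj (k y) z -> adj y (k^-1%g z) by rewrite -{1}kV permK.
split; first by rewrite !autM ?autV.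
- by rewrite e permK fy.
- by move=> z /back yz; rewrite e => h; apply: (nf _ yz); rewrite -{2}h permK.
- by move=> z /back yz; rewrite !e !permK f3 // permKV.
- by move=> z w /back yz zw; rewrite !e !permK (f33 _ _ yz) ?kV // permKV.
Qed.

Lemma arc_transitiveP (G : sgraph) x y x' y' : arc_transitive G -> adj x y ->
  adj x' y' -> exists2 f : {perm G}, f \in Defs.aut G & f x = x' /\ f y = y'.
Proof.
move=> tr xy xy'; pose w (u v : G) (i : 'I_2) := if i == 0 :> nat then u else v.
have sw u v : adj u v -> is_sarc (w u v).
  move=> uv; split=> -[i li] [j lj] /= e; rewrite /w /=.
    by case: i li e => [|i] li e; rewrite e // in lj *.
  by case: i li e => [|i] li e; rewrite e // in lj.
have [f fA h] := tr _ _ (sw _ _ xy) (sw _ _ xy').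
by exists f => //; split; [exact: (h ord0) | exact: (h (Ordinal (isT : 1 < 2)%N))].
Qed.

Section Rotations.
Variables (A : finZmodType) (a : 6.-tuple A).

Lemma third_nb (y U W : vg a) : adj y U -> adj y W -> U <> W ->
  exists T, [/\ adj y T, T <> U, T <> W &
    forall z, adj y z -> [\/ z = U, z = W | z = T]].
Proof.
have third d u w : adjp d u -> adjp d w -> u <> w -> exists t, [/\ adjp d t, t <> u,
    t <> w & forall z, adjp d z -> [\/ z = u, z = w | z = t]].
  pose t := nth p0 [seq z <- nbl d | ~~ eqpt z u && ~~ eqpt z w] 0.
  move=> du dw uw; exists t; rewrite {}/t; move: du dw uw.
  by case: d; case: u => //; case: w => // _ _ // _; (split=> //; case=> // _;
    (by constructor 1) || (by constructor 2) || (by constructor 3)).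
rewrite !adjE => /andP[yu /eqP eU] /andP[yw /eqP eW] UW.
have [|t [yt tu tw ht]] := third _ _ _ yu yw; first by move=> e; case: UW; rewrite eU eW e.
exists (nb y t); split; first exact: adj_nb.
- by rewrite eU => /(congr1 (@pr _ a)); rewrite !pr_nb.
- by rewrite eW => /(congr1 (@pr _ a)); rewrite !pr_nb.
move=> z; rewrite adjE => /andP[/ht[] e /eqP->]; rewrite e.
- by constructor 1; rewrite -eU.
- by constructor 2; rewrite -eW.
by constructor 3.
Qed.

(** Such an [h] fixes or exchanges the two neighbours of [z] other than [y]. *)
Lemma aut_fix2 (h : {perm vg a}) y z w : h \in Defs.aut (vg a) -> h y = y -> h z = z ->
  adj y z -> adj z w -> h (h w) = w.
Proof.
move=> /aut1P hA hy hz yz zw; case: (eqVneq w y) => [->|/eqP wy]; first by rewrite !hy.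
have zy : adj z y by rewrite adj_sym.
have [T [zT Tw Ty hT]] := third_nb zw zy wy.
have zh v : adj z v -> adj z (h v) by move=> zv; rewrite -{1}hz hA.
have ny v : v <> y -> h v <> y by move=> vy e; apply: vy; apply: (@perm_inj _ h); rewrite hy.
case: (hT _ (zh _ zw)) => e; [by rewrite !e | by case: (ny _ wy) | rewrite e].
case: (hT _ (zh _ zT)) => e' //; first by case: (ny _ Ty).
by case: Tw; apply: (@perm_inj _ h); rewrite e e'.
Qed.

Lemma rotation_exists (y U W : vg a) : arc_transitive (vg a) -> adj y U -> adj y W ->
  U <> W -> exists2 f, rotation f y & f U = W.
Proof.
move=> tr yU yW UW; have [T [yT TU TW hT]] := third_nb yU yW UW.
suff [k kA [ky kU kW kT]] : exists2 k : {perm vg a}, k \in Defs.aut (vg a) &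
    [/\ k y = y, k U = W, k W = T & k T = U].
  (* The cube of [k] fixes the neighbours of [y], so by [aut_fix2] its sixth power fixes the ball of
     radius 2. Hence the fourth power acts on the neighbours as [k] does, and its cube, the twelfth
     power of [k], is trivial on the ball. *)
  exists (k * k * k * k)%g; last by rewrite !permM kU kW kT.
  have kE x : (k * k * k * k)%g x = k (k (k (k x))) by rewrite !permM.
  split; rewrite ?kE ?ky // ?autM //.
  - by move=> z /hT[] ->; rewrite !kE ?(kU, kW, kT) // => /esym.
  - by move=> z /hT[] ->; rewrite !kE !(kU, kW, kT).
  move=> z w yz zw; rewrite !kE.
  have k3 x : (k * k * k)%g x = k (k (k x)) by rewrite !permM.
  have h := @aut_fix2 (k * k * k)%g y z w.
  have h2 : (k * k * k)%g ((k * k * k)%g w) = w.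
    by apply: h => //; rewrite ?autM // k3 ?ky //; case/hT: yz => ->;
      rewrite ?(kU, kW, kT).
  by rewrite !k3 in h2; rewrite !h2.
have cl k z : k \in Defs.aut (vg a) -> k y = y -> adj y z -> adj y (k z).
  by move=> /aut1P kA ky yz; rewrite -{1}ky kA.
(* A transitive group on three points contains a 3-cycle: it is found among [f1], the inverse of
   [f2] and the product of two reflections. *)
have [f1 A1 [y1 u1]] := arc_transitiveP tr yU yW.
have [f2 A2 [y2 u2]] := arc_transitiveP tr yU yT.
have inj (k : {perm vg a}) u v : u <> v -> k u <> k v by move=> uv /perm_inj.
have w1 := hT _ (cl _ _ A1 y1 yW); have t1 := hT _ (cl _ _ A1 y1 yT).
have w2 := hT _ (cl _ _ A2 y2 yW); have t2 := hT _ (cl _ _ A2 y2 yT).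
have n1 := inj f1 _ _ UW; have n2 := inj f1 _ _ TW; have n3 := inj f1 _ _ TU.
have m1 := inj f2 _ _ UW; have m2 := inj f2 _ _ TW; have m3 := inj f2 _ _ TU.
case: w1 => w1; rewrite ?u1 ?w1 // in n1 n2 n3.
  case: t1 => t1; rewrite ?t1 // in n2 n3.
  case: t2 => t2; rewrite ?u2 ?t2 // in m1 m2 m3.
    exists (f1 * f2)%g; first exact: autM.
    case: w2 => w2; rewrite ?w2 // in m1 m2.
    by rewrite !permM y1 y2 u1 w1 t1 u2 w2 t2.
  case: w2 => w2; rewrite ?w2 // in m1 m2.
  exists f2^-1%g; first exact: autV.
  by split; apply: (@perm_inj _ f2); rewrite permKV.
case: t1 => t1; rewrite ?t1 // in n2 n3.
by exists f1.
Qed.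

(* The 4-arcs that join a vertex at distance 2 from [y] to its image are bad. *)
Definition locally_bad (f : {perm vg a}) (y : vg a) : Prop :=
  forall v c, adjp (pr y) v -> adjp v c -> ~~ eqpt c (pr y) ->
  adjp c (pr (f (nb (nb y v) c))) = false.

End Rotations.

Definition has_arc3 (P : pt -> pt -> pt -> pt -> bool) : bool :=
  has (fun x => has (fun y => has (fun z => if eqpt x z then false else
    has (fun w => if eqpt y w then false else P x y z w) (nbl z)) (nbl y)) (nbl x)) allpt.

Lemma has_arc3P P : has_arc3 P -> exists x y z w, arcp x y z w /\ P x y z w.
Proof.
case/hasP=> x _ /hasP[y + /hasP[z + +]]; rewrite !mem_nbl => xy yz.
case: ifP => // xz /hasP[w]; rewrite mem_nbl => zw; case: ifP => // yw h.
by exists x, y, z, w; rewrite /arcp xy yz zw xz yw.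
Qed.

Definition mfun (l : seq pt) (u : pt) : pt := nth p0 l (npt u).

(* Up to conjugation, [rimg] is the only rotation of the ball that is not
   locally bad. *)
Definition rotcheck (l : seq pt) : bool :=
  let m := mfun l in
  if all (fun v => ~~ eqpt (m v) v) [:: p1; p2; p3] &&
     all (fun v => eqpt (m (m (m v))) v) allpt then
    all (fun c => ~~ adjp c (m c)) [:: p4; p5; p6; p7; p8; p9] ||
    has_arc3 (fun x y z w => let s := ext x y z w in
      eqpt z p0 && all (fun v => eqpt (m (s v)) (s (rimg v)) &&
        ([seq s u | u <- tpath v] == tpath (s v))) allpt)
  else true.

Lemma rotcheck_ok m1 m2 m3 m4 m5 m6 m7 m8 m9 :
  [&& adjp p0 m1, adjp p0 m2 & adjp p0 m3] ->
  [&& adjp m1 m4, adjp m1 m5, ~~ eqpt m4 p0 & ~~ eqpt m5 p0] ->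
  [&& adjp m2 m6, adjp m2 m7, ~~ eqpt m6 p0 & ~~ eqpt m7 p0] ->
  [&& adjp m3 m8, adjp m3 m9, ~~ eqpt m8 p0 & ~~ eqpt m9 p0] ->
  rotcheck [:: p0; m1; m2; m3; m4; m5; m6; m7; m8; m9].
Proof.
pose ch u := [seq v <- nbl u | ~~ eqpt v p0].
have mch u v : adjp u v -> ~~ eqpt v p0 -> v \in ch u.
  by move=> uv v0; rewrite mem_filter v0 mem_nbl.
have /allP h : all (fun m1 => all (fun m2 => all (fun m3 =>
   all (fun m4 => all (fun m5 => all (fun m6 => all (fun m7 => all (fun m8 =>
   all (fun m9 => rotcheck [:: p0; m1; m2; m3; m4; m5; m6; m7; m8; m9])
   (ch m3)) (ch m3)) (ch m2)) (ch m2)) (ch m1)) (ch m1)) (nbl p0)) (nbl p0)) (nbl p0).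
  by vm_cast_no_check (erefl true).
move=> /and3P[h1 h2 h3] /and4P[h4 h5 n4 n5] /and4P[h6 h7 n6 n7] /and4P[h8 h9 n8 n9].
have := h m1; rewrite mem_nbl => /(_ h1)/allP/(_ m2); rewrite mem_nbl.
move=> /(_ h2)/allP/(_ m3); rewrite mem_nbl => /(_ h3).
move=> /allP/(_ _ (mch _ _ h4 n4))/allP/(_ _ (mch _ _ h5 n5)).
move=> /allP/(_ _ (mch _ _ h6 n6))/allP/(_ _ (mch _ _ h7 n7)).
by move=> /allP/(_ _ (mch _ _ h8 n8))/allP/(_ _ (mch _ _ h9 n9)).
Qed.

(** Automorphisms permute the 6-cycles and the 8-cycles. *)
Lemma shorts_ext x y z w h : arcp x y z w -> h \in shorts ->
  (mulM (ext x y z w) h \in shorts) || (map Z.opp (mulM (ext x y z w) h) \in shorts).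
Proof.
have /all_arc3P c : all_arc3 (fun x y z w => all (fun h =>
    let h' := mulM (ext x y z w) h in
    has (fun k => all2 Z.eqb k h' || all2 Z.eqb k (map Z.opp h')) shorts) shorts).
  by vm_cast_no_check (erefl true).
move=> /c /allP h1 /h1 /hasP[k ks] /orP[] e; apply/orP; [left|right].
  suff -> : mulM (ext x y z w) h = k by [].
  by elim: k (mulM _ _) e {ks} => [|i k IH] [|j l] //= /andP[/Z.eqb_eq -> /IH ->].
suff -> : map Z.opp (mulM (ext x y z w) h) = k by [].
by elim: k (map _ _) e {ks} => [|i k IH] [|j l] //= /andP[/Z.eqb_eq -> /IH ->].
Qed.

Lemma noshort_relab (A : finZmodType) (a : 6.-tuple A) x y z w : arcp x y z w ->
  noshort a -> noshort (relab a (ext x y z w)).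
Proof.
move=> ar ns h hs; rewrite phi_relab => e0.
case/orP: (shorts_ext ar hs) => /ns; first by [].
by rewrite /phi phil_opp -/(phi a _) e0 oppr0.
Qed.

Section LocallyBad.
Variables (A : finZmodType) (a : 6.-tuple A).

Lemma psi_walk s (sA : isaut s) (y : vg (relab a s)) p : path adjp (pr y) p ->
  psiv sA (walkv y p) = walkv (psiv sA y) (map s p).
Proof.
elim: p y => //= v p IH y /andP[yv vp].
by rewrite IH ?pr_nb // psi_nb.
Qed.

Lemma psi_surj s (sA : isaut s) (y : vg a) : exists y', psiv sA y' = y.
Proof. by exists ((psi a sA)^-1%g y); rewrite /psiv permKV. Qed.

Lemma psi_injv s (sA : isaut s) : injective (@psiv A a s sA).
Proof. by move=> x y /perm_inj. Qed.

Lemma tpath_path v : path adjp p0 (tpath v).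
Proof. by case: v. Qed.

(** On the ball, [f] is coded by ten base vertices. By [rotcheck_ok] it is locally bad or conjugate
    to [rimg]; relabelling reduces the latter to [no_bad_rotation]. *)
Lemma rotation_p0 (f : {perm vg a}) y : noshort a -> pr y = p0 -> rotation f y ->
  locally_bad f y.
Proof.
move=> ns y0 [fA fy nf f3 f33]; pose m v := pr (f (walkv y (tpath v))).
pose bl v := walkv y (tpath v).
have nb1 v : adjp p0 v -> bl v = nb y v by case: v.
have nb2 u v : adjp p0 u -> adjp u v -> ~~ eqpt v p0 -> bl v = nb (nb y u) v.
  by case: u => // _; case: v.
have f1 v : adjp p0 v -> f (nb y v) = nb y (m v) /\ adjp p0 (m v).
  move=> v0; have [] := @aut_nb _ a f fA y v; first by rewrite y0.
  by rewrite /m -/(bl v) nb1 // fy y0.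
have f2 u v : adjp p0 u -> adjp u v -> ~~ eqpt v p0 ->
    [/\ f (nb (nb y u) v) = nb (nb y (m u)) (m v), adjp (m u) (m v) & ~~ eqpt (m v) p0].
  move=> u0 uv v0; have [] := @aut_nb _ a f fA (nb y u) v; first by rewrite pr_nb.
  have := @aut_back _ a f fA y u v; rewrite y0 fy y0 => /(_ u0 uv v0).
  by rewrite /m -/(bl v) (nb2 u) // (f1 u u0).1 pr_nb.
have m0 : m p0 = p0 by rewrite /m /= fy.
have fb v : f (bl v) = bl (m v).
  have c1 w : adjp p0 w -> f (bl w) = bl (m w).
    by move=> w0; have [e ?] := f1 _ w0; rewrite !nb1.
  have c2 u w : adjp p0 u -> adjp u w -> ~~ eqpt w p0 -> f (bl w) = bl (m w).
    move=> u0 uw w0; have [e h1 h2] := f2 _ _ u0 uw w0; have [_ h3] := f1 _ u0.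
    by rewrite (nb2 u) // (nb2 (m u)).
  case: v; first (by rewrite m0; exact: fy); try exact: c1;
    (by apply: (c2 p1)) || (by apply: (c2 p2)) || (by apply: (c2 p3)).
have prb v : pr (bl v) = v by case: v; rewrite /bl /walkv /= ?pr_nb.
have m3 v : m (m (m v)) = v.
  suff : f (f (f (bl v))) = bl v by rewrite !fb => /(congr1 (@pr _ a)); rewrite !prb.
  have g1 w : adjp p0 w -> f (f (f (bl w))) = bl w.
    by move=> w0; apply: f3; rewrite nb1 // adj_nb ?y0.
  have g2 u w : adjp p0 u -> adjp u w -> ~~ eqpt w p0 -> f (f (f (bl w))) = bl w.
    move=> u0 uw w0; apply: (f33 (nb y u)); first by rewrite adj_nb ?y0.
    by rewrite (nb2 u) // adj_nb ?pr_nb.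
  case: v; first (by rewrite /bl /walkv /= !fy); try exact: g1;
    (by apply: (g2 p1)) || (by apply: (g2 p2)) || (by apply: (g2 p3)).
pose l := [:: p0; m p1; m p2; m p3; m p4; m p5; m p6; m p7; m p8; m p9].
have lE v : mfun l v = m v by case: v.
have : rotcheck l.
  apply: rotcheck_ok.
  - by rewrite !(f1 _ _).2.
  - by have [//|//|//|_ -> ->] := f2 p1 p4; have [//|//|//|_ -> ->] := f2 p1 p5.
  - by have [//|//|//|_ -> ->] := f2 p2 p6; have [//|//|//|_ -> ->] := f2 p2 p7.
  - by have [//|//|//|_ -> ->] := f2 p3 p8; have [//|//|//|_ -> ->] := f2 p3 p9.
rewrite /rotcheck ifT; last first.
  apply/andP; split; apply/allP=> v; rewrite !lE; last by rewrite m3; case: v.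
  move=> vin; have v0 : adjp p0 v by case: v vin.
  apply/negP=> /eqptP e; apply: (nf (nb y v)); first by rewrite adj_nb ?y0.
  by rewrite (f1 v v0).1 e.
case/orP=> [/allP good v c|].
  rewrite y0 => v0 vc c0; rewrite -(nb2 v) // fb prb -lE; apply/negbTE/good.
  by move: c0 v0 vc; case: c => //; case: v.
case/has_arc3P=> x [x1 [z [w [ar /andP[/eqptP z0 /allptP h]]]]].
have sA := ext_aut ar; set s := ext _ _ _ _ in sA h.
have [y' yE] := psi_surj sA y; have s0 : s p0 = p0 by [].
have y'0 : pr y' = p0 by apply: (isaut_inj sA); rewrite -pr_psi yE y0.
case: (@no_bad_rotation _ _ (conj_psi sA f) y' (conj_psi_aut sA fA) y'0).
- by apply: (@psi_injv s sA); rewrite psi_conj yE fy.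
- exact: noshort_relab.
move=> v; apply: (isaut_inj sA); rewrite -(pr_psi sA) psi_conj psi_walk ?y'0 ?tpath_path //.
by rewrite yE; have /andP[/eqptP <- /eqP ->] := h v; rewrite lE.
Qed.

End LocallyBad.

Lemma rotation_locally_bad (A : finZmodType) (a : 6.-tuple A) (f : {perm vg a}) y :
  noshort a -> rotation f y -> locally_bad f y.
Proof.
move=> ns rt; have : has_arc3 (fun _ _ z _ => eqpt z (pr y)) by case: (pr y).
case/has_arc3P=> x [x1 [z [w [ar /eqptP zy]]]].
have sA := ext_aut ar; set s := ext _ _ _ _ in sA.
have [y' yE] := psi_surj sA y; have s0 : s p0 = pr y by [].
have y'0 : pr y' = p0 by apply: (isaut_inj sA); rewrite -pr_psi yE.
case: rt => fA fy nf f3 f33.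
have rt' : rotation (conj_psi sA f) y'.
  split; first exact: conj_psi_aut.
  - by apply: (@psi_injv _ _ _ sA); rewrite psi_conj yE fy.
  - move=> t; rewrite -(psi_adj sA) yE => /nf h e; apply: h.
    by rewrite -psi_conj e.
  - move=> t; rewrite -(psi_adj sA) yE => /f3 h; apply: (@psi_injv _ _ _ sA).
    by rewrite !psi_conj.
  move=> t t'; rewrite -!(psi_adj sA) yE => h1 h2; apply: (@psi_injv _ _ _ sA).
  by rewrite !psi_conj; apply: f33 h1 h2.
have lb := rotation_p0 (noshort_relab ar ns) y'0 rt'.
have sS u : exists v, s v = u.
  have : has (fun v => eqpt (s v) u) allpt.
    have /all_arc3P c : all_arc3 (fun x y z w => all (fun u =>
      has (fun v => eqpt (ext x y z w v) u) allpt) allpt) by vm_compute.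
    exact: (allptP (c _ _ _ _ ar)).
  by case/hasP=> v _ /eqptP; exists v.
move=> v c; have [v' <-] := sS v; have [c' <-] := sS c.
rewrite -s0 !sA -yE => h1 h2 h3.
rewrite -psi_nb ?y'0 // -psi_nb ?pr_nb // -psi_conj pr_psi sA.
apply: lb; rewrite ?y'0 //; apply: contra h3 => /eqptP->.
by case: (s p0).
Qed.

(** * Automorphisms of coverings without short cycles project to the base *)

Section Induced.
Variables (A : finZmodType) (a : 6.-tuple A).
Hypotheses (ns : noshort a) (tr : arc_transitive (vg a)).

(** A rotation at [y] that takes [u] to [w] joins a vertex beyond [u] to its image by a bad 4-arc.
    Its conjugate by [k] is a rotation at [k y], so the image of this 4-arc is bad as well: [k] does
    not exchange good and bad here. *)
Lemma eps0 (k : {perm vg a}) y u w : k \in Defs.aut (vg a) ->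
  adjp (pr y) u -> adjp (pr y) w -> ~~ eqpt u w -> eps k y u w = false.
Proof.
move=> kA yu yw uw.
have UW : nb y u <> nb y w.
  by move/(congr1 (@pr _ a)); rewrite !pr_nb => e; move: uw; rewrite e; case: (w).
have [f rt fU] := rotation_exists tr (adj_nb yu) (adj_nb yw) UW.
have [u1 u2 _ _ _] := oth_ok (etrans (adjpC _ _) yu).
set u' := (oth u (pr y)).1 in u1 u2.
have [fA fy _ _ _] := rt.
have [w1 w2] := @aut_nb _ a f fA (nb y u) u' (etrans (congr1 (adjp^~ _) (pr_nb _ _)) u1).
have w3 := aut_back fA yu u1 u2; rewrite fU pr_nb in w1 w2; rewrite fy in w3.
set w' := pr (f (nb (nb y u) u')) in w1 w2 w3.
have b1 := rotation_locally_bad ns rt yu u1 u2; rewrite -/w' in b1.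
have [h1 h2] := aut_nb kA yu.
have [g1 g2] := @aut_nb _ a k kA (nb y u) u' (etrans (congr1 (adjp^~ _) (pr_nb _ _)) u1).
have b2 := rotation_locally_bad ns (rotation_conj kA rt) h1 g1 (aut_back kA yu u1 u2).
rewrite -h2 -g2 !permM permK w2 in b2.
by have := eps_ok kA yu yw uw u1 u2 w1 w3; rewrite b1 b2; case: eps.
Qed.

Lemma aut_next (k : {perm vg a}) y u w u' w' : k \in Defs.aut (vg a) ->
  adjp (pr y) u -> adjp (pr y) w -> ~~ eqpt u w -> adjp u u' -> ~~ eqpt u' (pr y) ->
  adjp w w' -> ~~ eqpt w' (pr y) ->
  pr (k (nb (nb y w) w')) =
    cont (pr (k (nb (nb y u) u'))) (pr (k y)) (pr (k (nb y w))) (~~ adjp u' w').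
Proof.
move=> kA yu yw uw uu' u'y ww' w'y.
have [ar1 ar2] := aut_arcp kA yu yw uw uu' u'y ww' w'y.
apply: (cont_uniq ar1); first by case/and5P: ar2.
  exact: aut_back.
by rewrite (eps_ok kA) // (eps0 kA) // negbK; case: adjp.
Qed.

(* The 3-arc through an edge in the intersection of the two balls shows that
   the base maps of [k] near adjacent vertices agree. *)
Lemma aut_induced (k : {perm vg a}) : connected (vg a) -> k \in Defs.aut (vg a) ->
  forall y, pr y = p0 ->
  let s := ext (pr (k (nb (nb y p1) p4))) (pr (k (nb y p1))) (pr (k y)) (pr (k (nb y p2))) in
  isaut s /\ forall z, pr (k z) = s (pr z).
Proof.
move=> conn kA y y0; set s := ext _ _ _ _ => /=.
have yv v : adjp p0 v -> adjp (pr y) v by rewrite y0.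
have ar : arcp (pr (k (nb (nb y p1) p4))) (pr (k (nb y p1))) (pr (k y)) (pr (k (nb y p2))).
  by have [] := @aut_arcp _ a k kA y p1 p2 p4 p6; rewrite ?y0.
have sA : isaut s by apply: ext_aut.
pose near y := [/\ pr (k y) = s (pr y),
  forall u, adjp (pr y) u -> pr (k (nb y u)) = s u &
  forall u v, adjp (pr y) u -> adjp u v -> pr (k (nb (nb y u) v)) = s v].
suff all_near z : near z by split=> // z; have [] := all_near z.
have next y1 u : near y1 -> adjp (pr y1) u -> near (nb y1 u).
  case=> n0 n1 n2 yu; split; rewrite ?pr_nb; first exact: n1.
    by move=> v uv; apply: n2.
  move=> v w uv vw; have [e|e] := boolP (eqpt v (pr y1)).
    by move/eqptP: e vw => -> yw; rewrite nbK // n1.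
  have [e'|e'] := boolP (eqpt w u).
    move/eqptP: e' vw => -> vw; have := @nbK _ a (nb y1 u) v.
    by rewrite pr_nb => ->; rewrite ?n1.
  have [t1 t2 _ _ _] := oth_ok yu; set t := (oth _ _).1 in t1 t2.
  have eqC p q : eqpt p q = eqpt q p by case: p; case: q.
  have := @aut_next k (nb y1 u) (pr y1) v t w kA.
  rewrite pr_nb nbK // eqC e adjpC => /(_ yu uv isT t1) -> //.
  rewrite n1 // n1 // n2 //.
  have ar' : arcp t (pr y1) u v by rewrite /arcp adjpC t1 yu uv t2 eqC e.
  rewrite -(cont_aut (~~ adjp t w) sA ar'); congr s; apply/esym.
  by apply: (cont_uniq ar'); rewrite ?negbK.
have near_y : near y.
  have s3 : pr (k (nb y p3)) = s p3.
    have o3 d u v t : adjp d u -> adjp d v -> adjp d t -> ~~ eqpt u v -> ~~ eqpt u t ->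
      ~~ eqpt v t -> t = if eqpt (oth d u).1 v then (oth d u).2 else (oth d u).1.
      by case: d; case: u => //; case: v => // _ _; case: t.
    have kb v : adjp p0 v -> adjp (pr (k y)) (pr (k (nb y v))).
      by move=> /yv /(aut_nb kA)[].
    apply: o3; try exact: kb;
      by apply: (aut_nb_neq kA); rewrite ?y0.
  have s7 : pr (k (nb (nb y p2) p7)) = s p7 by apply: (@aut_next k y p1 p2 p4 p7); rewrite ?y0.
  have s6 : pr (k (nb (nb y p2) p6)) = s p6 by apply: (@aut_next k y p1 p2 p4 p6); rewrite ?y0.
  have s5 : pr (k (nb (nb y p1) p5)) = s p5.
    by rewrite (@aut_next k y p2 p1 p6 p5) ?y0 // s6.
  have s9 : pr (k (nb (nb y p3) p9)) = s p9.
    by rewrite (@aut_next k y p1 p3 p4 p9) ?y0 // s3.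
  have s8 : pr (k (nb (nb y p3) p8)) = s p8.
    by rewrite (@aut_next k y p1 p3 p4 p8) ?y0 // s3.
  split; rewrite y0 //; first by case.
  by move=> u v; case: u => // _; case: v => // _; rewrite -?y0 ?nbK ?y0.
have /connectP[p + ->] := conn y z.
elim: p (y) near_y => //= t p IH y1 n1 /andP[y1t tp]; apply: IH tp.
by have : @adj (vg a) y1 t := y1t; rewrite adjE => /andP[h /eqP->]; apply: next.
Qed.

End Induced.

(** * Lifting automorphisms *)

(** Induction over integer combinations of two families in parallel, one generator at a time. *)
Lemma phil_gen2 (A B : finZmodType) (a : seq A) (b : seq B) (P : A -> B -> Prop) :
  size a = size b ->
  (forall i x y, (i < size a)%N -> P x y ->
     P (x + nth 0 a i) (y + nth 0 b i) /\ P (x - nth 0 a i) (y - nth 0 b i)) ->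
  P 0 0 -> forall h, P (phil a h) (phil b h).
Proof.
move=> sz clo P0 h; suff gen x y : P x y -> P (x + phil a h) (y + phil b h).
  by have := gen 0 0 P0; rewrite !add0r.
move: x y; elim: a b h sz clo {P0} => [|u a IH] [|v b] [|z h] //= sz clo x y Pxy;
  rewrite ?addr0 //= !addrA.
have clo' i x' y' : (i < size a)%N -> P x' y' ->
  P (x' + nth 0 a i) (y' + nth 0 b i) /\ P (x' - nth 0 a i) (y' - nth 0 b i) :=
  clo i.+1 x' y'.
apply: IH clo' _ _ _; first by case: sz.
have nat_clo n : P (x + u *+ n) (y + v *+ n) /\ P (x - u *+ n) (y - v *+ n).
  elim: n => [|n [h1 h2]]; first by rewrite !subr0 !addr0.
  rewrite !mulrSr !opprD !addrA.
  by split; [apply: (clo 0%N _ _ _ h1).1 | apply: (clo 0%N _ _ _ h2).2].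
case: (iz z) => n; first by have [] := nat_clo n; rewrite !pmulrn.
by have [_] := nat_clo n.+1; rewrite NegzE !mulrNz !pmulrn.
Qed.

Definition lifts (A : finZmodType) (a : 6.-tuple A) (s : pt -> pt) : Prop :=
  exists2 k : {perm vg a}, k \in Defs.aut (vg a) & forall z, pr (k z) = s (pr z).

Definition phi_surj (A : finZmodType) (a : 6.-tuple A) : Prop :=
  forall x : A, exists h, (size h == 6%N) && (phi a h == x).

Definition ker_le (A B : finZmodType) (a : 6.-tuple A) (b : 6.-tuple B) : Prop :=
  forall h, size h = 6%N -> phi a h = 0 -> phi b h = 0.

Definition invariant (A : finZmodType) (a : 6.-tuple A) (s : pt -> pt) : Prop :=
  forall h, size h = 6%N -> phi a h = 0 -> phi a (mulM s h) = 0.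

Definition unit6 : seq (seq Z) := [seq vaddn i 1 z6 | i <- iota 0 6].

(** It says that the power [n.+1] of the matrix is the identity, since the rows of [Mat s] are
    already the images of the basis. *)
Definition ordM (s : pt -> pt) (n : nat) : bool :=
  [seq iter n (mulM s) r | r <- Mat s] == unit6.

Lemma phi_unit (A : finZmodType) (a : 6.-tuple A) i : (i < 6)%N -> phi a (vaddn i 1 z6) = nth 0 a i.
Proof. by move=> li; rewrite /phi phil_vaddn // mulr1z -/(phi a z6) phi_z6 addr0. Qed.

Section Lifts.
Variables (A : finZmodType) (a : 6.-tuple A).

Lemma phi_unit6 : map (phi a) unit6 = a.
Proof.
apply: (@eq_from_nth _ 0) => [|i]; first by rewrite !size_map size_iota size_tuple.
by rewrite !size_map size_iota => li; rewrite -map_comp (nth_map 0%N) ?size_iota //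
  nth_iota //= phi_unit.
Qed.

Lemma phi_iter s n h : ordM s n -> phi a (iter n.+1 (mulM s) h) = phi a h.
Proof.
move=> /eqP e; rewrite iterSr.
have it m v : phi a (iter m (mulM s) v) = phi (iter m (fun c => relab c s) a) v.
  by elim: m v => // m IH v; rewrite iterSr IH /= phi_relab.
rewrite it phi_lcomb; last exact: size_Mat.
have <- : [seq phi a (iter n (mulM s) r) | r <- Mat s] =
    [seq phi (iter n (fun c => relab c s) a) r | r <- Mat s] by apply: eq_map => r.
by rewrite (map_comp (phi a) (iter n (mulM s))) e phi_unit6.
Qed.

Lemma lifts_comp s t : lifts a s -> lifts a t -> lifts a (s \o t).
Proof.
move=> [k kA hk] [l lA hl]; exists (l * k)%g; first exact: autM.
by move=> z; rewrite permM hk hl.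
Qed.

Lemma eq_lifts s t : s =1 t -> lifts a s -> lifts a t.
Proof. by move=> st [k kA hk]; exists k => // z; rewrite hk st. Qed.

Definition cotp := [:: (p5, p8); (p7, p8); (p4, p7); (p4, p9); (p6, p9); (p5, p6)].

Lemma cot_volt (B : finZmodType) (b : 6.-tuple B) i : (i < 6)%N ->
  let: (u, v) := nth (p0, p0) cotp i in
  adjp u v /\ reduced b (vx u) (vx v) = nth 0 b i.
Proof.
have d6 : nth 0 b 6 = 0 by rewrite nth_default ?size_tuple.
by do 6?[case: i => [|i]] => // _; split; rewrite // /= /reduced_volt /= d6 subr0.
Qed.

Lemma tree_ind (P : pt -> Prop) : P p0 ->
  (forall u v, adjp u v ->
     (forall (B : finZmodType) (b : 6.-tuple B), reduced b (vx u) (vx v) = 0) ->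
     P u -> P v) ->
  forall v, P v.
Proof.
move=> h0 hs.
have tr u v : adjp u v -> index (npt u, npt v) cotree = 6 ->
    index (npt v, npt u) cotree = 6 -> P u -> P v.
  by move=> uv e1 e2; apply: hs => // B b; rewrite -[reduced b _ _]/(nth 0 b
    (index (npt u, npt v) cotree) - nth 0 b (index (npt v, npt u) cotree)) e1 e2 subrr.
have h1 : P p1 by apply: (tr p0).
have h2 : P p2 by apply: (tr p0).
have h3 : P p3 by apply: (tr p0).
by case=> //; [apply: (tr p1)|apply: (tr p1)|apply: (tr p2)|apply: (tr p2)|
  apply: (tr p3)|apply: (tr p3)].
Qed.

Lemma lifts_invariant s : isaut s -> lifts a s -> invariant a s.
Proof.
move=> sA [k kA hk] h _ ph; pose b := relab a s.
(* [G] compares [k] with the isomorphism [psi] over [s]. It does not depend on the vertex, because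
   tree arcs carry voltage 0, and along a closed walk it turns the voltage in [a] into the voltage
   in [b]. *)
pose G v x := (k (vx v, x)).2 - phi a (csum s v).
have kst u v x : adjp u v ->
    G v (reduced a (vx u) (vx v) + x) = reduced b (vx u) (vx v) + G u x.
  move=> uv; have [_ e] := @aut_nb _ a k kA (vx u, x) v (etrans (congr1 (adjp^~ _) (vxK _)) uv).
  have E : (k (vx v, reduced a (vx u) (vx v) + x)).2 =
      reduced a (vx (s u)) (vx (s v)) + (k (vx u, x)).2.
    have := congr1 snd e; rewrite [in RHS]nbE !hk pr_nb.
    by rewrite -[pr (vx u, x)]/(tp (vx u)) vxK.
  rewrite /G E; have := relab_volt a sA uv; move/(canRL (addrK _)) => ->.
  have zid (t c d l : A) : t + c - d + l - c = t + (l - d).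
    by rewrite [t + c]addrC -!addrA [LHS]addrC -!addrA addNr addr0 [- d + l]addrC.
  exact: zid.
have Gt v x : G v x = G p0 x.
  move: v; apply: tree_ind => // u v uv e <-; have := kst u v x uv.
  by rewrite !e !add0r.
have Ga x h' : G p0 (x + phi a h') = G p0 x + phi b h'.
  apply: (@phil_gen2 _ _ a b (fun y z => G p0 (x + y) = G p0 x + z)); rewrite ?size_tuple ?addr0 //.
  move=> i y z li; have /= := cot_volt a li; have := cot_volt b li.
  case: (nth _ cotp i) => p q [pq eb] [_ ea].
  have st c : G p0 (nth 0 a i + c) = nth 0 b i + G p0 c.
    by rewrite -ea -eb -(Gt q) -(Gt p) kst.
  move=> e; split.
    have -> : x + (y + nth 0 a i) = nth 0 a i + (x + y) by rewrite addrA addrC.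
    by rewrite st e [RHS]addrA [RHS]addrC.
  apply: (addrI (nth 0 b i)); rewrite -st.
  have -> : nth 0 a i + (x + (y - nth 0 a i)) = x + y.
    by rewrite addrCA [nth 0 a i + _]addrC subrK.
  by rewrite e [RHS]addrCA [nth 0 b i + _]addrC subrK.
rewrite -(phi_relab a s); have := Ga 0 h; rewrite ph addr0.
by rewrite -{1}[G _ _]addr0 => /addrI.
Qed.

Lemma connected_surj : connected (vg a) -> phi_surj a.
Proof.
move=> conn x; have /connectP[p + e] := conn (Vtx a 0 (p0, z6)) (vx p0, x).
suff gen y p' : (exists2 h, size h = 6%N & y = Vtx a 0 (pr y, h)) -> path (@adj (vg a)) y p' ->
   exists2 h, size h = 6%N & last y p' = Vtx a 0 (pr (last y p'), h).
  move=> hp; have [|h sh] := gen _ _ _ hp; first by exists z6; rewrite ?pr_Vtx.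
  rewrite -e => /(congr1 snd); rewrite -[RHS]/(phi a h + 0) addr0 /= => ->.
  by exists h; rewrite sh !eqxx.
elim: p' y => //= t p' IH y [h sh ey] /andP[+ tp]; move: tp => /[swap].
rewrite -[vadj _ _ _]/(@adj (vg a) y t) adjE => /andP[yt /eqP et] tp.
apply: IH tp; exists (hstep (@pr _ a y) (@pr _ a t) h); first by rewrite size_hstep.
by rewrite {1}et {1}ey nb_Vtx.
Qed.

Lemma surj_connected : phi_surj a -> connected (vg a).
Proof.
move=> su; have sym : connect_sym (@adj (vg a)) by apply: sym_connect_sym; apply: adj_sym.
have prv v x : pr ((vx v, x) : vg a) = v := vxK v.
have tr x v : connect (@adj (vg a)) (vx p0, x) (vx v, x).
  move: v; apply: tree_ind => [|u v uv e h]; first exact: connect0.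
  apply: connect_trans h (connect1 _); rewrite adjE !prv uv andTb.
  by apply/eqP; rewrite -[nb _ _]/(vx v, reduced a (vx u) (vx v) + x) e add0r.
have c0 x : connect (@adj (vg a)) (vx p0, 0) (vx p0, x).
  have [h /andP[_ /eqP <-]] := su x.
  apply: (@phil_gen2 _ _ a a (fun x _ => connect (@adj (vg a)) (vx p0, 0) (vx p0, x))) => //.
    move=> i y _; rewrite size_tuple => li h0.
    have := cot_volt a li; case: (nth _ cotp i) => p q [pq ea].
    have st c : connect (@adj (vg a)) (vx p0, c) (vx p0, nth 0 a i + c).
      apply: connect_trans (tr c p) (connect_trans (connect1 _) _); last first.
        by rewrite sym; apply: (tr (nth 0 a i + c) q).
      rewrite adjE !prv pq andTb.
      by apply/eqP; rewrite -[nb _ _]/(vx q, reduced a (vx p) (vx q) + c) ea.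
    split; first by rewrite addrC; apply: connect_trans h0 _.
    by apply: connect_trans h0 _; rewrite sym; have := st (y - nth 0 a i); rewrite (addrC (nth 0 a i)) subrK.
have c1 (y : vg a) : connect (@adj (vg a)) (vx p0, 0) y.
  by have := connect_trans (c0 y.2) (tr y.2 (pr y)); rewrite /pr tpK; case: y.
by move=> y z; apply: connect_trans (c1 z); rewrite sym.
Qed.

Section Theta.
Variables (B : finZmodType) (b : 6.-tuple B).
Hypotheses (su : phi_surj a) (kab : ker_le a b).

(** The map induced between the quotients of Z^6, evaluated at a chosen preimage. *)
Definition theta (x : A) : B := phi b (xchoose (su x)).

Lemma theta_phi h : size h = 6%N -> theta (phi a h) = phi b h.
Proof.
move=> sh; rewrite /theta; have /andP[/eqP sx /eqP ex] := xchooseP (su (phi a h)).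
set h' := xchoose _ in sx ex *.
have s' : size (vsubq 1 h' h) = 6%N by rewrite size_vsubq ?sx.
have := kab s'; rewrite /phi !phil_vsubq ?sx // !mulr1z -!/(phi _ _) ex subrr.
by move=> /(_ (erefl _))/eqP; rewrite subr_eq0 => /eqP.
Qed.

Lemma thetaD x y : theta (x + y) = theta x + theta y.
Proof.
have [h /andP[/eqP sh /eqP <-]] := su x; have [k /andP[/eqP sk /eqP <-]] := su y.
rewrite -phiD ?sh ?sk // !theta_phi ?phiD ?sh ?sk //.
by rewrite size_vsubq ?sh ?sk.
Qed.

Lemma theta_nth i : (i < 6)%N -> theta (nth 0 a i) = nth 0 b i.
Proof.
move=> li; rewrite -(phi_unit a li) -(phi_unit b li).
by apply: theta_phi; rewrite size_vaddn.
Qed.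

Lemma theta_volt u v : theta (reduced a u v) = reduced b u v.
Proof.
have t0 : theta 0 = 0 by rewrite -(phi_z6 a) theta_phi // phi_z6.
have tN x : theta (- x) = - theta x.
  by apply/eqP; rewrite -addr_eq0 -thetaD addNr t0.
have tn i : theta (nth 0 a i) = nth 0 b i.
  by case: (ltnP i 6) => li; [exact: theta_nth | rewrite !nth_default ?size_tuple].
by rewrite /= /reduced_volt thetaD tN !tn.
Qed.

Hypotheses (sub : phi_surj b) (kba : ker_le b a).

Lemma theta_bij : bijective theta.
Proof.
pose th (y : B) := phi a (xchoose (sub y)).
exists th => x.
  have /andP[/eqP sx /eqP ex] := xchooseP (sub (theta x)).
  rewrite /th; have [h /andP[/eqP sh /eqP eh]] := su x; rewrite -eh theta_phi // in sx ex *.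
  set k := xchoose _ in sx ex *.
  have s' : size (vsubq 1 k h) = 6%N by rewrite size_vsubq ?sx.
  have := kba s'; rewrite /phi !phil_vsubq ?sx // !mulr1z -!/(phi _ _) ex subrr.
  by move=> /(_ (erefl _))/eqP; rewrite subr_eq0 => /eqP.
have /andP[/eqP sx /eqP ex] := xchooseP (sub x).
by rewrite /th theta_phi.
Qed.

End Theta.

Lemma aut_id (G : sgraph) : 1%g \in Defs.aut G.
Proof. by apply/aut1P=> x y; rewrite !perm1. Qed.

Lemma iso_kernel (B : finZmodType) (b : 6.-tuple B) : phi_surj a -> phi_surj b ->
  ker_le a b -> ker_le b a ->
  cov_iso (vcover (reduced a)) (vcover (reduced b)).
Proof.
move=> su sub kab kba; exists 1%g; first exact: aut_id.
have bij := theta_bij su kab sub kba.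
exists (fun y => (y.1, theta b su y.2)); split; last by move=> y; rewrite perm1.
  case: bij => t h1 h2; exists (fun y => (y.1, t y.2)) => [[u x]|[u x]] /=;
  by rewrite ?h1 ?h2.
move=> [u x] [v y] /=; rewrite /vadj /=; congr (_ && _).
by rewrite -[reduced_volt b u v]/(reduced b u v) -(theta_volt su kab) -(thetaD su kab)
  (inj_eq (bij_inj bij)).
Qed.

(** Invariance puts the kernel of [a] inside that of [relab a s]; the finite order of the matrix of
    [s] makes the two kernels equal. *)
Lemma invariant_lifts s n : isaut s -> phi_surj a -> invariant a s ->
  ordM s n -> lifts a s.
Proof.
move=> sA su inv ord; pose b := relab a s.
have kab : ker_le a b by move=> h sh ph; rewrite phi_relab inv.
have it m h : size h = 6%N -> size (iter m (mulM s) h) = 6%N.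
  by case: m => // m _; rewrite /= size_mulM.
have kba : ker_le b a.
  move=> h sh; rewrite phi_relab => ph; rewrite -(phi_iter h ord) iterSr.
  elim: (n) => [|m IH] //=; apply: inv => //.
  by apply: it; rewrite size_mulM.
have sub : phi_surj b.
  move=> x; have [h /andP[/eqP sh /eqP ph]] := su x.
  exists (iter n (mulM s) h); rewrite it // phi_relab -iterS phi_iter //.
  by rewrite ph !eqxx.
have bij := theta_bij su kab sub kba; have inj := bij_inj bij.
have tinj : injective (fun y : petersen * A => (y.1, theta b su y.2)).
  by move=> [u x] [v y] [-> /inj ->].
exists (perm tinj * psi a sA)%g; last first.
  by move=> z; rewrite permM -[pr _]/(pr (psiv sA (perm tinj z))) pr_psi permE.
apply/aut1P=> y z; rewrite !permM.
rewrite -[adj _ _]/(adj (psiv sA (perm tinj y)) (psiv sA (perm tinj z))) psi_adj !permE.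
case: y z => [u x] [v y] /=; rewrite /vadj /=; congr (_ && _).
by rewrite -[reduced_volt _ u v]/(reduced b u v) -(theta_volt su kab) -(thetaD su kab)
  (inj_eq inj).
Qed.

(** A translation of the fibres corrects the first vertex of the lifted arc; the other vertices are
    then determined by their projections. *)
Lemma sarc_transitive_lifts n :
  (forall v v' : 'I_n.+1 -> pt,
     (forall i j : 'I_n.+1, j = i.+1 :> nat -> adjp (v i) (v j)) ->
     (forall i j : 'I_n.+1, j = i.+2 :> nat -> v i <> v j) ->
     (forall i j : 'I_n.+1, j = i.+1 :> nat -> adjp (v' i) (v' j)) ->
     (forall i j : 'I_n.+1, j = i.+2 :> nat -> v' i <> v' j) ->
     exists2 s, lifts a s & forall i, s (v i) = v' i) ->
  s_arc_transitive n (vg a).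
Proof.
move=> H w w' [a1 b1] [a2 b2].
have aj (y z : vg a) : adj y z -> adjp (pr y) (pr z) by move=> h; rewrite adjE in h; case/andP: h.
have ne (y z z' : vg a) : adj y z -> adj y z' -> z <> z' -> pr z <> pr z'.
  by rewrite !adjE => /andP[_ /eqP ez] /andP[_ /eqP ez'] zz' e; apply: zz'; rewrite ez ez' e.
have nb2 (u : 'I_n.+1 -> vg a) : (forall i j : 'I_n.+1, j = i.+1 :> nat -> adj (u i) (u j)) ->
    (forall i j : 'I_n.+1, j = i.+2 :> nat -> u i <> u j) ->
    forall i j : 'I_n.+1, j = i.+2 :> nat -> pr (u i) <> pr (u j).
  move=> h1 h2 i j e; have lt : (i.+1 < n.+1)%N by rewrite (leq_trans _ (ltn_ord j)) ?e.
  apply: (ne (u (Ordinal lt))); [by rewrite adj_sym; apply: h1 | exact: h1 | exact: h2].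
have [s [k kA hk] sv] := H (fun i => pr (w i)) (fun i => pr (w' i))
  (fun i j e => aj _ _ (a1 i j e)) (nb2 w a1 b1) (fun i j e => aj _ _ (a2 i j e)) (nb2 w' a2 b2).
pose c := (w' ord0).2 - (k (w ord0)).2.
have tinj : injective (fun y : petersen * A => (y.1, c + y.2)).
  by move=> [u x] [v y] [-> /addrI ->].
have tA : perm tinj \in Defs.aut (vg a).
  apply/aut1P=> -[u x] [v y]; rewrite !permE /= /vadj /=; congr (_ && _).
  by rewrite addrCA (inj_eq (addrI c)).
exists (k * perm tinj)%g; first exact: autM.
have kt y : pr ((k * perm tinj)%g y) = s (pr y).
  by rewrite permM permE -hk.
have q0 : (k * perm tinj)%g (w ord0) = ((k (w ord0)).1, c + (k (w ord0)).2).
  by rewrite permM permE.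
move: (k * perm tinj)%g kt (autM kA tA) q0 => q qp qA q0.
have base : q (w ord0) = w' ord0.
  rewrite q0 /c subrK; have := sv ord0; rewrite -hk => /(can_inj tpK) ->.
  by case: (w' ord0).
case=> i; elim: i => [|i IH] li; first by rewrite (_ : Ordinal li = ord0) //; apply: val_inj.
have li' : (i < n.+1)%N by apply: ltnW.
have e := a1 (Ordinal li') (Ordinal li) (erefl _).
have e' := a2 (Ordinal li') (Ordinal li) (erefl _).
rewrite -(aut1P _ qA) IH !adjE in e e'; case/andP: e => _ /eqP ->.
by case/andP: e' => _ /eqP e'; rewrite qp sv; apply: esym e'.
Qed.

End Lifts.

(** * Coverings with short cycles *)

(** By girth 5 a good 4-arc lies on no 6-cycle, while the ends of a bad one have a single common
    neighbour [q]. *)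
Definition cl6 (t u x w t' : pt) : seq (seq Z) :=
  [seq hwalk t [:: u; x; w; t'; q; t] z6 | q <- allpt & adjp t' q && adjp q t].

Definition trip := [seq (q1, q2) | q1 <- allpt, q2 <- [seq (q2, q3) | q2 <- allpt, q3 <- allpt]].

(** The inequalities exclude backtracking, also where the walk closes up. *)
Definition cond8 (t u w t' : pt) (q : pt * (pt * pt)) : bool :=
  let: (q1, (q2, q3)) := q in
  if [&& adjp t' q1, adjp q1 q2 & adjp q2 q3] then
    [&& adjp q3 t, ~~ eqpt q1 w, ~~ eqpt q2 t', ~~ eqpt t q2, ~~ eqpt q3 q1 & ~~ eqpt u q3]
  else false.

Definition cl8 (t u x w t' : pt) : seq (seq Z) :=
  [seq hwalk t [:: u; x; w; t'; q.1; q.2.1; q.2.2; t] z6 | q <- trip & cond8 t u w t' q].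

Lemma mem_trip q : q \in trip.
Proof.
have al u : u \in allpt by case: u.
by case: q => q1 [q2 q3]; apply: allpairs_f => //; apply: allpairs_f.
Qed.

Section ShortCycles.
Variables (A : finZmodType) (a : 6.-tuple A).

Lemma walkv_Vtx g u p h : path adjp u p -> size h = 6%N ->
  walkv (Vtx a g (u, h)) p = Vtx a g (last u p, hwalk u p h).
Proof.
elim: p u h => //= v p IH u h /andP[uv vp] sh.
by rewrite nb_Vtx // IH // size_hstep.
Qed.

Lemma walkv_closed (y : vg a) p : path adjp (pr y) p -> last (pr y) p = pr y ->
  (walkv y p == y) = (phi a (hwalk (pr y) p z6) == 0).
Proof.
move=> yp e; have : walkv y p = Vtx a y.2 (pr y, hwalk (pr y) p z6).
  by rewrite {1}(Vtx0 y) walkv_Vtx // e.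
move=> ->; apply/eqP/eqP => [/(congr1 snd)|e0].
  by rewrite -[LHS]/(phi a (hwalk (pr y) p z6) + y.2) -{2}[y.2]add0r => /addIr.
by rewrite [RHS]Vtx0 /Vtx /= e0 phi_z6.
Qed.

Definition bit6 (T U Y W T' : vg a) : bool := [exists Q, adj T' Q && adj Q T].

Definition bit8 (T U Y W T' : vg a) : bool :=
  [exists Q1 : vg a, exists Q2 : vg a, exists Q3 : vg a,
    [&& adj T' Q1, adj Q1 Q2, adj Q2 Q3, adj Q3 T, Q1 != W &
        [&& Q2 != T', T != Q2, Q3 != Q1 & U != Q3]]].

Lemma nb_neq (Z P Q : vg a) : adj Z P -> adj Z Q -> P != Q -> ~~ eqpt (pr P) (pr Q).
Proof.
rewrite !adjE => /andP[_ /eqP eP] /andP[_ /eqP eQ]; apply: contra => /eqptP e.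
by rewrite eP eQ e.
Qed.

Lemma pr_neq (P Q : vg a) : ~~ eqpt (pr P) (pr Q) -> P != Q.
Proof. by apply: contra => /eqP->; case: (pr Q). Qed.

Section Bits.
Variables (y : vg a) (u w t t' : pt).
Hypotheses (yu : adjp (pr y) u) (yw : adjp (pr y) w) (ut : adjp u t) (wt : adjp w t').
Local Notation U := (nb y u).
Local Notation W := (nb y w).
Local Notation T := (nb U t).
Local Notation T' := (nb W t').

Lemma walkT p : walkv T ([:: u; pr y; w; t'] ++ p) = walkv T' p.
Proof.
rewrite /walkv foldl_cat /=; congr (foldl _ _ _).
by have := @nbK _ a U t; rewrite pr_nb => -> //; rewrite nbK.
Qed.

Lemma closeT p : path adjp t' p -> last t' p = t ->
  (walkv T' p == T) = (phi a (hwalk t ([:: u; pr y; w; t'] ++ p) z6) == 0).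
Proof.
move=> tp lp; rewrite -walkT walkv_closed pr_nb //=.
by rewrite adjpC ut adjpC yu yw wt.
Qed.

Lemma bit6E : bit6 T U y W T' = has (fun h => phi a h == 0) (cl6 t u (pr y) w t').
Proof.
apply/existsP/hasP=> [[Q /andP[]]|[h /mapP[q]]].
  rewrite !adjE !pr_nb => /andP[h1 /eqP eQ] /andP[h2 eT].
  exists (hwalk t [:: u; pr y; w; t'; pr Q; t] z6).
    by apply/mapP; exists (pr Q) => //; rewrite mem_filter h1 h2; case: (pr Q).
  by rewrite -(@closeT [:: pr Q; t]) //= ?h1 ?h2 // /walkv /= -eQ eq_sym.
rewrite mem_filter => /andP[/andP[h1 h2] _] ->.
rewrite -(@closeT [:: q; t]) //= ?h1 ?h2 // => /eqP e; exists (nb T' q).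
apply/andP; split; first by apply: adj_nb; rewrite pr_nb.
by rewrite -e; apply: (@adj_nb _ a (nb T' q) t); rewrite pr_nb.
Qed.

Lemma bit8E :
  bit8 T U y W T' = has (fun h => phi a h == 0) (cl8 t u (pr y) w t').
Proof.
have sy (P Q : vg a) : adj P Q -> adj Q P by rewrite adj_sym.
have an (P : vg a) v s : adjp v s -> adj (nb P v) (nb (nb P v) s).
  by move=> vs; apply: adj_nb; rewrite pr_nb.
have aTU : adj T U by apply: sy; apply: an.
have aTW : adj T' W by apply: sy; apply: an.
apply/existsP/hasP=> [[Q1 /existsP[Q2 /existsP[Q3]]]|[h /mapP[[q1 [q2 q3]]]]].
  case/and5P=> a1 a2 a3 a4 /andP[n1 /and4P[n2 n3 n4 n5]].
  have m1 := nb_neq a1 aTW n1; have m2 := nb_neq a2 (sy _ _ a1) n2.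
  have m3 := nb_neq a4 (sy _ _ a3) n3; have m4 := nb_neq a3 (sy _ _ a2) n4.
  have m5 := nb_neq aTU (sy _ _ a4) n5; rewrite !pr_nb in m1 m2 m3 m4 m5.
  move: a1 a2 a3 a4; rewrite !adjE !pr_nb => /andP[h1 /eqP e1] /andP[h2 /eqP e2].
  move=> /andP[h3 /eqP e3] /andP[h4 e4].
  exists (hwalk t [:: u; pr y; w; t'; pr Q1; pr Q2; pr Q3; t] z6).
    apply/mapP; exists (pr Q1, (pr Q2, pr Q3)) => //.
    by rewrite mem_filter mem_trip /cond8 h1 h2 h3 h4 m1 m2 m3 m4 m5.
  rewrite -(@closeT [:: pr Q1; pr Q2; pr Q3; t]) //= ?h1 ?h2 ?h3 ?h4 //.
  by rewrite /walkv /= -e1 -e2 -e3 eq_sym.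
rewrite mem_filter /cond8 => /andP[]; case: ifP => // /and3P[h1 h2 h3].
case/and5P=> h4 m1 m2 m3 /andP[m4 m5] _ -> /=.
rewrite -(@closeT [:: q1; q2; q3; t]) //= ?h1 ?h2 ?h3 ?h4 // => /eqP e.
pose Q1 := nb T' q1; pose Q2 := nb Q1 q2; pose Q3 := nb Q2 q3.
exists Q1; apply/existsP; exists Q2; apply/existsP; exists Q3.
have eT : nb Q3 t = T by rewrite -e.
apply/and5P; split; [exact: an | exact: an | exact: an | | ].
  by rewrite -eT; apply: an.
by apply/and5P; split; apply: pr_neq; rewrite !pr_nb.
Qed.

End Bits.

Lemma sum_nb (y : vg a) (F : vg a -> nat) :
  (\sum_(z | adj y z) F z = \sum_(v <- nbl (pr y)) F (nb y v))%N.
Proof.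
have inj : {in nbl (pr y) &, injective (nb y)}.
  by move=> v v' _ _ /(congr1 (@pr _ a)); rewrite !pr_nb.
rewrite -(big_map (nb y) xpredT F) -big_filter; apply: perm_big.
rewrite uniq_perm ?filter_uniq ?index_enum_uniq ?map_inj_in_uniq //.
  by case: (pr y).
move=> z; rewrite mem_filter mem_index_enum andbT; apply/idP/mapP => [|[v]].
  by rewrite adjE => /andP[h /eqP e]; exists (pr z); rewrite ?mem_nbl.
by rewrite mem_nbl => /adj_nb h ->.
Qed.

(** The number of ordered 4-arcs with centre [y] that avoid the neighbour [Z] and lie on a short
    cycle. Automorphisms preserve it, so arc-transitivity makes it the same for all arcs and gives
    linear equations between the unknowns [kk]. *)
Definition cnt (bit : vg a -> vg a -> vg a -> vg a -> vg a -> bool) (y Z : vg a) : nat :=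
  (\sum_(U | adj y U) \sum_(W | adj y W) \sum_(T | adj U T) \sum_(T' | adj W T')
   [&& U != Z, W != Z, U != W, T != y, T' != y & bit T U y W T'])%N.

Lemma cnt_aut bit (k : {perm vg a}) y Z : k \in Defs.aut (vg a) ->
  (forall T U Y W T', bit (k T) (k U) (k Y) (k W) (k T') = bit T U Y W T') ->
  cnt bit (k y) (k Z) = cnt bit y Z.
Proof.
move=> /aut1P kA kb; rewrite /cnt (reindex_inj (@perm_inj _ k)).
apply: eq_big => [U|U _]; first by rewrite kA.
rewrite (reindex_inj (@perm_inj _ k)); apply: eq_big => [W|W _]; first by rewrite kA.
rewrite (reindex_inj (@perm_inj _ k)); apply: eq_big => [T|T _]; first by rewrite kA.
rewrite (reindex_inj (@perm_inj _ k)); apply: eq_big => [T'|T' _]; first by rewrite kA.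
by rewrite !(inj_eq (@perm_inj _ k)) kb.
Qed.

Lemma bit6_aut (k : {perm vg a}) : k \in Defs.aut (vg a) -> forall T U Y W T',
  bit6 (k T) (k U) (k Y) (k W) (k T') = bit6 T U Y W T'.
Proof.
have imp (l : {perm vg a}) T U Y W T' : l \in Defs.aut (vg a) ->
    bit6 T U Y W T' -> bit6 (l T) (l U) (l Y) (l W) (l T').
  by move=> /aut1P lA /existsP[Q h]; apply/existsP; exists (l Q); rewrite !lA.
move=> kA T U Y W T'; apply/idP/idP=> h; last exact: imp.
by have := imp _ _ _ _ _ _ (autV kA) h; rewrite !permK.
Qed.

Lemma bit8_aut (k : {perm vg a}) : k \in Defs.aut (vg a) -> forall T U Y W T',
  bit8 (k T) (k U) (k Y) (k W) (k T') = bit8 T U Y W T'.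
Proof.
have imp (l : {perm vg a}) T U Y W T' : l \in Defs.aut (vg a) ->
    bit8 T U Y W T' -> bit8 (l T) (l U) (l Y) (l W) (l T').
  move=> /aut1P lA /existsP[Q1 /existsP[Q2 /existsP[Q3 h]]].
  apply/existsP; exists (l Q1); apply/existsP; exists (l Q2); apply/existsP; exists (l Q3).
  by rewrite !lA !(inj_eq (@perm_inj _ l)).
move=> kA T U Y W T'; apply/idP/idP=> h; last exact: imp.
by have := imp _ _ _ _ _ _ (autV kA) h; rewrite !permK.
Qed.

(* Indices in [shorts] of the cycles through the four 4-arcs around the 2-arc
   that avoids [z] at [x], each counted twice. *)
Definition sidx (h : seq Z) : nat :=
  find (fun k => all2 Z.eqb k h || all2 Z.eqb k (map Z.opp h)) shorts.

Definition tbl (cl : pt -> pt -> pt -> pt -> pt -> seq (seq Z)) (x z : pt) : seq nat :=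
  flatten [seq flatten [seq flatten [seq flatten [seq
    (if [&& ~~ eqpt u z, ~~ eqpt w z, ~~ eqpt u w, ~~ eqpt t x & ~~ eqpt t' x]
     then map sidx (cl t u x w t') else [::])
   | t' <- nbl w] | t <- nbl u] | w <- nbl x] | u <- nbl x].

Definition kk (i : nat) : nat := (phi a (nth z6 shorts i) == 0).

Lemma cntE cl bit (y : vg a) z : adjp (pr y) z ->
  (forall u w t t', adjp (pr y) u -> adjp (pr y) w -> adjp u t -> adjp w t' ->
    ~~ eqpt t (pr y) -> bit (nb (nb y u) t) (nb y u) y (nb y w) (nb (nb y w) t') =
     has (fun h => phi a h == 0) (cl t u (pr y) w t')) ->
  (forall u w t t', adjp (pr y) u -> adjp (pr y) w -> adjp u t -> adjp w t' ->
    ~~ eqpt u w -> ~~ eqpt t (pr y) -> ~~ eqpt t' (pr y) ->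
    (size (cl t u (pr y) w t') <= 1)%N && all (fun h => (sidx h < 25)%N) (cl t u (pr y) w t')) ->
  cnt bit y (nb y z) = (\sum_(i <- tbl cl (pr y) z) kk i)%N.
Proof.
move=> yz hb hc; rewrite /cnt /tbl sum_nb big_flatten big_map.
rewrite [LHS]big_seq [RHS]big_seq; apply: eq_bigr => u; rewrite mem_nbl => yu.
rewrite sum_nb big_flatten big_map [LHS]big_seq [RHS]big_seq.
apply: eq_bigr => w; rewrite mem_nbl => yw.
rewrite sum_nb pr_nb big_flatten big_map [LHS]big_seq [RHS]big_seq.
apply: eq_bigr => t; rewrite mem_nbl => ut.
rewrite sum_nb pr_nb big_flatten big_map [LHS]big_seq [RHS]big_seq.
apply: eq_bigr => t'; rewrite mem_nbl => wt.
have nE v : (nb y v != nb y z) = ~~ eqpt v z.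
  by congr (~~ _); apply/eqP/eqptP=> [/(congr1 (@pr _ a))|->] //; rewrite !pr_nb.
have nW : (nb y u != nb y w) = ~~ eqpt u w.
  by congr (~~ _); apply/eqP/eqptP=> [/(congr1 (@pr _ a))|->] //; rewrite !pr_nb.
have nT v s : adjp (pr y) v -> adjp v s -> (nb (nb y v) s != y) = ~~ eqpt s (pr y).
  move=> yv vs; congr (~~ _); apply/eqP/eqptP=> [<-|->]; first by rewrite pr_nb.
  exact: nbK.
rewrite !nE nW !nT //; case: ifP => [/and5P[n1 n2 n3 n4 n5]|]; last first.
  rewrite big_nil; case: (eqpt u z) => //=; case: (eqpt w z) => //=.
  by case: (eqpt u w) => //=; case: (eqpt t _) => //=; case: (eqpt t' _).
rewrite n1 n2 n3 n4 n5 !andTb hb //.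
have /andP[] := hc _ _ _ _ yu yw ut wt n3 n4 n5.
case: (cl _ _ _ _ _) => [|h [|//]] _ /=; first by rewrite big_nil.
rewrite andbT orbF big_cons big_nil addn0 /kk => lt.
have := @nth_find _ z6 (fun k => all2 Z.eqb k h || all2 Z.eqb k (map Z.opp h)) shorts.
rewrite has_find => /(_ lt); rewrite -/(sidx h).
have all2E (l l' : seq Z) : all2 Z.eqb l l' -> l = l'.
  by elim: l l' => [|i l IH] [|j l'] //= /andP[/Z.eqb_eq -> /IH ->].
case/orP=> /all2E ->; first by [].
by rewrite /phi phil_opp oppr_eq0.
Qed.

Lemma cnt_const bit (y y' Z Z' : vg a) : arc_transitive (vg a) ->
  (forall k : {perm vg a}, k \in Defs.aut (vg a) -> forall T U Y W T',
     bit (k T) (k U) (k Y) (k W) (k T') = bit T U Y W T') ->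
  adj y Z -> adj y' Z' -> cnt bit y Z = cnt bit y' Z'.
Proof.
move=> tr kb yZ yZ'; have [k kA [<- <-]] := arc_transitiveP tr yZ yZ'.
by rewrite cnt_aut //; apply: kb.
Qed.

End ShortCycles.

Definition parc := [seq (x, z) | x <- allpt, z <- nbl x].
(** The positions in [shorts] of the ten 6-cycles; [octs] has those of the fifteen 8-cycles. *)
Definition hexs : seq nat := [:: 0; 1; 3; 5; 7; 8; 13; 14; 21; 22]%N.
Definition octs : seq nat :=
  [:: 2; 4; 6; 9; 10; 11; 12; 15; 16; 17; 18; 19; 20; 23; 24]%N.

(* Generators of the lattice of all vectors with [h1 + h3 + h5] and
   [h2 + h4 + h6] even. *)
Definition h2gens : seq (seq Z) :=
  [:: [:: 1; 0; -1; 0; 0; 0]; [:: 0; 0; 1; 0; -1; 0]; [:: 2; 0; 0; 0; 0; 0];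
      [:: 0; 1; 0; -1; 0; 0]; [:: 0; 0; 0; 1; 0; -1]; [:: 0; 2; 0; 0; 0; 0]]%ZZ.

Definition small (A : finZmodType) (a : 6.-tuple A) : Prop :=
  forall h, h \in h2gens -> phi a h = 0.

Definition lgen (vs : seq (seq Z)) : lat :=
  foldl (fun L v => (ladd L v).1) (nseq 6 None) vs.

Lemma lgen_ok (A : finZmodType) (a : 6.-tuple A) vs v :
  (forall u, u \in vs -> size u = 6%N /\ phi a u = 0) -> size v = 6%N ->
  lmem (lgen vs) v -> phi a v = 0.
Proof.
move=> h sv; apply: lmem_ok; rewrite ?size_tuple // /lgen.
have : lok a (nseq 6 None) by [].
elim: vs (nseq _ _) h => //= u vs IH L h hL; apply: IH => [w wv|].
  by apply: h; rewrite inE wv orbT.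
by have [su pu] := h u (mem_head _ _); apply: ladd_ok; rewrite ?size_tuple.
Qed.

(** The values of [tbl] at the 30 arcs, written out so that equations can be selected from them. *)
Definition TBLhex : seq (seq nat) :=
  [:: [:: 22; 3; 22; 3]; [:: 8; 0; 8; 0]; [:: 1; 13; 1; 13]; [:: 5; 21; 5; 21];
      [:: 13; 0; 0; 13]; [:: 1; 8; 8; 1]; [:: 5; 7; 5; 7]; [:: 13; 3; 3; 13];
      [:: 1; 22; 22; 1]; [:: 21; 7; 21; 7]; [:: 0; 3; 3; 0]; [:: 8; 22; 22; 8];
      [:: 3; 14; 3; 14]; [:: 1; 21; 21; 1]; [:: 8; 5; 5; 8]; [:: 22; 14; 22; 14];
      [:: 13; 21; 21; 13]; [:: 0; 5; 5; 0]; [:: 0; 14; 0; 14]; [:: 1; 7; 7; 1];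
      [:: 22; 5; 5; 22]; [:: 8; 14; 8; 14]; [:: 13; 7; 7; 13]; [:: 3; 5; 5; 3];
      [:: 13; 14; 13; 14]; [:: 8; 7; 7; 8]; [:: 22; 21; 21; 22]; [:: 1; 14; 1; 14];
      [:: 0; 7; 7; 0]; [:: 3; 21; 21; 3]]%N.

Definition TBLoct : seq (seq nat) :=
  [:: [:: 12; 2; 19; 17; 12; 19; 2; 17]; [:: 24; 6; 10; 16; 24; 10; 6; 16];
      [:: 18; 9; 23; 4; 18; 23; 9; 4]; [:: 11; 19; 2; 15; 11; 2; 19; 15];
      [:: 4; 23; 10; 16; 4; 10; 23; 16]; [:: 18; 9; 6; 24; 18; 6; 9; 24];
      [:: 20; 10; 6; 15; 20; 6; 10; 15]; [:: 4; 9; 19; 17; 4; 19; 9; 17];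
      [:: 18; 23; 2; 12; 18; 2; 23; 12]; [:: 20; 23; 9; 11; 20; 9; 23; 11];
      [:: 16; 6; 2; 17; 16; 2; 6; 17]; [:: 24; 10; 19; 12; 24; 19; 10; 12];
      [:: 20; 4; 16; 12; 20; 16; 4; 12]; [:: 9; 24; 2; 15; 9; 2; 24; 15];
      [:: 6; 18; 19; 11; 6; 19; 18; 11]; [:: 20; 18; 24; 17; 20; 24; 18; 17];
      [:: 23; 16; 19; 15; 23; 19; 16; 15]; [:: 10; 4; 2; 11; 10; 2; 4; 11];
      [:: 11; 4; 17; 24; 11; 17; 4; 24]; [:: 23; 12; 6; 15; 23; 6; 12; 15];
      [:: 2; 18; 10; 20; 2; 10; 18; 20]; [:: 11; 18; 12; 16; 11; 12; 18; 16];
      [:: 9; 17; 10; 15; 9; 10; 17; 15]; [:: 19; 4; 6; 20; 19; 6; 4; 20];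
      [:: 15; 16; 17; 18; 15; 17; 16; 18]; [:: 10; 12; 9; 11; 10; 9; 12; 11];
      [:: 19; 24; 23; 20; 19; 23; 24; 20]; [:: 15; 24; 12; 4; 15; 12; 24; 4];
      [:: 6; 17; 23; 11; 6; 23; 17; 11]; [:: 2; 16; 9; 20; 2; 9; 16; 20]]%N.

Section Core.
Variables (A : finZmodType) (a : 6.-tuple A).
Hypothesis tr : arc_transitive (vg a).

Lemma tbl_const cl bit :
  (forall k : {perm vg a}, k \in Defs.aut (vg a) -> forall T U Y W T',
     bit (k T) (k U) (k Y) (k W) (k T') = bit T U Y W T') ->
  (forall (y : vg a) u w t t', adjp (pr y) u -> adjp (pr y) w -> adjp u t -> adjp w t' ->
    bit (nb (nb y u) t) (nb y u) y (nb y w) (nb (nb y w) t') =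
     has (fun h => phi a h == 0) (cl t u (pr y) w t')) ->
  all_arc3 (fun t u x w => all (fun t' => eqpt t' x ||
    (size (cl t u x w t') <= 1)%N && all (fun h => (sidx h < 25)%N) (cl t u x w t')) (nbl w)) ->
  forall x z, adjp x z ->
  (\sum_(i <- tbl cl x z) kk a i = \sum_(i <- tbl cl p0 p1) kk a i)%N.
Proof.
move=> kb hb /all_arc3P hc.
have E x z : adjp x z ->
   cnt bit (vx x, 0) (nb ((vx x, 0) : vg a) z) = (\sum_(i <- tbl cl x z) kk a i)%N.
  have xE : pr ((vx x, 0) : vg a) = x by apply: vxK.
  move=> xz; rewrite (@cntE _ a cl) ?xE // => u w t t'.
    by have := hb (vx x, 0) u w t t'; rewrite xE => h *; apply: h.
  move=> xu xw ut wt uw tx t'x; have ar : arcp t u x w.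
    by rewrite /arcp adjpC ut adjpC xu xw tx uw.
  by have /allP/(_ t') := hc _ _ _ _ ar; rewrite mem_nbl (negbTE t'x) => /(_ wt).
move=> x z xz; rewrite -!E //; apply: cnt_const => //; apply: adj_nb.
  by rewrite /pr vxK.
by rewrite /pr vxK.
Qed.

Lemma kk_le1 i : (kk a i <= 1)%N. Proof. by rewrite /kk; case: eqP. Qed.

Lemma hex_all i : i \in hexs -> phi a (nth z6 shorts i) = 0 ->
  forall j, j \in hexs -> phi a (nth z6 shorts j) = 0.
Proof.
have E : all (fun l => \sum_(i <- l) kk a i == \sum_(i <- tbl cl6 p0 p1) kk a i)%N
    [seq tbl cl6 q.1 q.2 | q <- parc].
  rewrite all_map; apply/allP=> -[x z] /allpairsPdep[x' [z' [_ + [-> ->]]]].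
  rewrite mem_nbl => xz; apply/eqP; apply: (tbl_const (bit := @bit6 _ a)).
  - exact: bit6_aut.
  - by move=> *; apply: bit6E.
  - by vm_cast_no_check (erefl true).
  - exact: xz.
have kj j : j \in hexs -> kk a j = kk a 0.
  move: E kk_le1; move: (kk a) => k; move: (\sum_(_ <- tbl _ _ _) _)%N => c.
  have -> : [seq tbl cl6 q.1 q.2 | q <- parc] = TBLhex by vm_cast_no_check (erefl TBLhex).
  move=> /allP E _.
  have e l : l \in TBLhex -> (\sum_(i <- l) k i = c)%N by move/E/eqP.
  (* The rows on 0, 3 and 13 make the three pairwise sums equal, so these unknowns agree; each
     further row then fixes one more. *)
  have := e [:: 13; 0; 0; 13]%N isT; have := e [:: 0; 3; 3; 0]%N isT.
  have := e [:: 13; 3; 3; 13]%N isT; have := e [:: 22; 3; 22; 3]%N isT.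
  have := e [:: 8; 0; 8; 0]%N isT; have := e [:: 1; 13; 1; 13]%N isT.
  have := e [:: 0; 5; 5; 0]%N isT; have := e [:: 3; 14; 3; 14]%N isT.
  have := e [:: 0; 7; 7; 0]%N isT; have := e [:: 3; 21; 21; 3]%N isT.
  rewrite !big_cons !big_nil; clear E e => e1 e2 e3 e4 e5 e6 e7 e8 e9 e10 jh.
  by move: jh; rewrite !inE => /or4P[|||/or4P[|||/or4P[|||]]] /eqP->; lia.
move=> ih pi j jh; suff : kk a j = 1%N by rewrite /kk; case: eqP.
by rewrite kj // -(kj i) // /kk pi eqxx.
Qed.

Lemma oct_all i : i \in octs -> phi a (nth z6 shorts i) = 0 ->
  forall j, j \in octs -> phi a (nth z6 shorts j) = 0.
Proof.
have E : all (fun l => \sum_(i <- l) kk a i == \sum_(i <- tbl cl8 p0 p1) kk a i)%N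
    [seq tbl cl8 q.1 q.2 | q <- parc].
  rewrite all_map; apply/allP=> -[x z] /allpairsPdep[x' [z' [_ + [-> ->]]]].
  rewrite mem_nbl => xz; apply/eqP; apply: (tbl_const (bit := @bit8 _ a)).
  - exact: bit8_aut.
  - by move=> *; apply: bit8E.
  - by vm_cast_no_check (erefl true).
  - exact: xz.
have kj j : j \in octs -> kk a j = kk a 2.
  move: E kk_le1; move: (kk a) => k; move: (\sum_(_ <- tbl _ _ _) _)%N => c.
  have -> : [seq tbl cl8 q.1 q.2 | q <- parc] = TBLoct by vm_cast_no_check (erefl TBLoct).
  move=> /allP E le1 jh.
  (* Each index occurs 16 times in the 30 rows of 8, so 8 times the sum is 15 times [c]. Hence 15
     divides a sum of fifteen bits, and the bits are all equal. *)
  have n15 : ((\sum_(i <- octs) k i) * 16 = c * 30)%N.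
    have <- : (\sum_(l <- TBLoct) \sum_(i <- l) k i = c * 30)%N.
      rewrite big_seq (eq_bigr (fun=> c)) => [|l /E/eqP //].
      by rewrite -big_seq big_const_seq count_predT iter_addn_0.
    have <- n : (\sum_(i <- flatten (nseq n octs)) k i = (\sum_(i <- octs) k i) * n)%N.
      elim: n => [|n IH]; first by rewrite big_nil muln0.
      by rewrite -[flatten _]/(octs ++ flatten (nseq n octs)) big_cat IH mulnS.
    by rewrite -big_flatten; apply: perm_big; vm_cast_no_check (erefl true).
  rewrite /octs !big_cons big_nil in n15.
  have le15 : [&& k 2 <= 1, k 4 <= 1, k 6 <= 1, k 9 <= 1, k 10 <= 1, k 11 <= 1, k 12 <= 1, k 15 <= 1, k 16 <= 1, k 17 <= 1, k 18 <= 1, k 19 <= 1, k 20 <= 1, k 23 <= 1 & k 24 <= 1]%N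
    by rewrite !le1.
  clear E le1; move: jh; rewrite !inE.
  by move=> /or4P[|||/or4P[|||/or4P[|||/or4P[|||/or3P[||]]]]] /eqP->; lia.
move=> ih pi j jh; suff : kk a j = 1%N by rewrite /kk; case: eqP.
by rewrite kj // -(kj i) // /kk pi eqxx.
Qed.

(** The classes of the 6-cycles generate a lattice containing [h2gens], and so do those of the
    8-cycles. *)
Lemma small_or_noshort : small a \/ noshort a.
Proof.
case: (boolP (has (fun h => phi a h == 0) shorts)) => [/(has_nthP z6)[i li /eqP pi]|ns].
  left=> h hh; have sh : size h = 6%N.
    by have /allP/(_ h hh)/eqP := isT : all (fun h => size h == 6%N) h2gens.
  have ss l v : all (fun i => size (nth z6 shorts i) == 6%N) l ->
      (forall j, j \in l -> phi a (nth z6 shorts j) = 0) ->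
      v \in [seq nth z6 shorts j | j <- l] -> size v = 6%N /\ phi a v = 0.
    by move=> /allP s6 p6 /mapP[j jl ->]; split; [apply/eqP/s6 | apply: p6].
  have : i \in hexs ++ octs.
    by have /allP := isT : all (mem (hexs ++ octs)) (iota 0 25); apply; rewrite mem_iota.
  rewrite mem_cat => /orP[ih|io].
    apply: (@lgen_ok _ a [seq nth z6 shorts j | j <- hexs]) => //.
      by move=> u; apply: ss => //; apply: hex_all pi.
    by move: {sh}h hh; apply/allP; vm_cast_no_check (erefl true).
  apply: (@lgen_ok _ a [seq nth z6 shorts j | j <- octs]) => //.
    by move=> u; apply: ss => //; apply: oct_all pi.
  by move: {sh}h hh; apply/allP; vm_cast_no_check (erefl true).
by right=> h hs e; case/hasP: ns; exists h => //; apply/eqP.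
Qed.

End Core.

(** * Generators of A5 and their lifts *)

(* The automorphisms induced by (c d e), (a b c) and (d e). *)
Definition rho1 (u : pt) : pt :=
  match u with p0 => p0 | p1 => p3 | p2 => p1 | p3 => p2 | p4 => p8
             | p5 => p9 | p6 => p4 | p7 => p5 | p8 => p6 | p9 => p7 end.
Definition rho2 (u : pt) : pt :=
  match u with p0 => p9 | p1 => p6 | p2 => p4 | p3 => p3 | p4 => p5
             | p5 => p2 | p6 => p7 | p7 => p1 | p8 => p0 | p9 => p8 end.
Definition tau (u : pt) : pt :=
  match u with p0 => p0 | p1 => p2 | p2 => p1 | p3 => p3 | p4 => p6
             | p5 => p7 | p6 => p4 | p7 => p5 | p8 => p8 | p9 => p9 end.

Lemma isautP s : all2pt (fun u v => adjp (s u) (s v) == adjp u v) -> isaut s.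
Proof. by move/all2ptP=> h u v; apply/eqP. Qed.

Lemma rho1_aut : isaut rho1. Proof. exact: isautP. Qed.
Lemma rho2_aut : isaut rho2. Proof. exact: isautP. Qed.
Lemma tau_aut : isaut tau. Proof. exact: isautP. Qed.

Lemma ordM_rho1 : ordM rho1 2. Proof. by vm_compute. Qed.
Lemma ordM_rho2 : ordM rho2 2. Proof. by vm_compute. Qed.
Lemma ordM_tau : ordM tau 1. Proof. by vm_compute. Qed.

(** For the vertices in question, an automorphism of order 3 that fixes [u] and moves its neighbours
    is [r] or its inverse; in the second case its square is [r]. *)
Definition rotchk (u : pt) (r s : pt -> pt) : bool :=
  if [&& eqpt (s u) u, all (fun v => ~~ eqpt (s v) v) (nbl u) &
         all (fun v => eqpt (s (s (s v))) v) allpt]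
  then all (fun v => eqpt (s v) (r v)) allpt || all (fun v => eqpt (s (s v)) (r v)) allpt
  else true.

Definition rotof (u : pt) (r : pt -> pt) : bool :=
  all_arc3 (fun x y z w => rotchk u r (ext x y z w)).

Section Generators.
Variables (A : finZmodType) (a : 6.-tuple A).

Lemma noshort_lifts u r : connected (vg a) -> arc_transitive (vg a) -> noshort a ->
  rotof u r -> lifts a r.
Proof.
move=> conn tr ns /all_arc3P chk; pose y : vg a := (vx u, 0).
have yE : pr y = u by apply: vxK.
have [v [w [uv uw vw]]] : exists v w, [/\ adjp u v, adjp u w & ~~ eqpt v w].
  by exists (nth p0 (nbl u) 0), (nth p0 (nbl u) 1); case: (u).
have UW : nb y v <> nb y w.
  by move/(congr1 (@pr _ a)); rewrite !pr_nb => e; rewrite e in vw; move: vw; case: (w).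
have yv : adjp (pr y) v by rewrite yE.
have yw : adjp (pr y) w by rewrite yE.
have [k [kA ky nk k3 k33] _] := rotation_exists tr (adj_nb yv) (adj_nb yw) UW.
pose y0 : vg a := (vx p0, 0); have y0E : pr y0 = p0 by [].
have [sA ks] := aut_induced ns tr conn kA y0E.
have ar : arcp (pr (k (nb (nb y0 p1) p4))) (pr (k (nb y0 p1))) (pr (k y0)) (pr (k (nb y0 p2))).
  by have [] := @aut_arcp _ a k kA y0 p1 p2 p4 p6.
have {chk} := chk _ _ _ _ ar; move: sA ks; set s := ext _ _ _ _ => sA ks.
clearbody s; rewrite /rotchk ifT.
  have lk : lifts a s by exists k.
  case/orP=> /allptP h; first by apply: eq_lifts lk => z; apply/eqptP/h.
  by apply: eq_lifts (lifts_comp lk lk) => z; apply/eqptP; apply: (h z).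
have near z : [\/ z = u, adjp u z | exists2 t, adjp u t & adjp t z].
  have : [|| eqpt z u, adjp u z | has (adjp^~ z) (nbl u)] by case: (u); case: z.
  case/or3P=> [/eqptP|h|/hasP[t]]; [by constructor 1 | by constructor 2 |].
  by rewrite mem_nbl; constructor 3; exists t.
apply/and3P; split; last 1 first.
- apply/allP=> z _; apply/eqptP.
  have tri (Q : vg a) : k (k (k Q)) = Q -> s (s (s (pr Q))) = pr Q.
    by move=> e; rewrite -!ks e.
  case: (near z) => [->|h|[t ht tz]]; first by rewrite -yE; apply: tri; rewrite !ky.
    by rewrite -(pr_nb y z); apply: tri; apply: k3; rewrite adj_nb ?yE.
  rewrite -(pr_nb (nb y t) z); apply: tri; apply: (k33 (nb y t)); rewrite adj_nb ?yE ?pr_nb //.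
- by apply/eqptP; rewrite -{1}yE -ks ky.
apply/allP=> z; rewrite mem_nbl => uz; apply/negP=> /eqptP e.
have yz : adjp (pr y) z by rewrite yE.
apply: (nk _ (adj_nb yz)); have [_] := aut_nb kA yz.
by rewrite ks pr_nb e ky.
Qed.

(** If [s] acts trivially modulo the lattice of [h2gens], relabelling by it changes no voltage. The
    generators of A5 act trivially; [tau] does not, as it exchanges the two parities. *)
Lemma small_invariant s : small a -> 
  all (fun i => lmem (lgen h2gens) (vsubq 1 (nth z6 (Mat s) i) (vaddn i 1 z6))) (iota 0 6) ->
  invariant a s.
Proof.
move=> sm /allP c h _; rewrite -phi_relab; suff -> : relab a s = a by [].
apply: val_inj; apply: (@eq_from_nth _ 0) => [|i]; first by rewrite !size_tuple.
rewrite size_tuple => li; rewrite (nth_map z6) ?size_tuple // -(phi_unit a li).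
have sM : size (nth z6 (Mat s) i) = 6%N.
  by apply: (@size_Mat s); apply: mem_nth; rewrite size_tuple.
have s6 : size (vaddn i 1 z6) = 6%N by rewrite size_vaddn.
apply/eqP; rewrite -subr_eq0 -[phi a (vaddn i 1 z6)]mulr1z.
rewrite -[X in _ *~ X]/(iz 1) -phil_vsubq ?sM ?s6 //.
apply/eqP; apply: (@lgen_ok _ a h2gens); rewrite ?size_vsubq ?sM ?s6 //.
  move=> u uh; split; last exact: sm.
  by have /allP/(_ u uh)/eqP := isT : all (fun h => size h == 6%N) h2gens.
by apply: c; rewrite mem_iota.
Qed.

(** The 3-cycles (c d e) and (a b c) generate A5, so all of A5 lifts. *)
Lemma arc_transitive_lifts : connected (vg a) -> arc_transitive (vg a) ->
  lifts a rho1 /\ lifts a rho2.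
Proof.
move=> conn tr; have su := connected_surj conn.
case: (small_or_noshort tr) => [sm|ns].
  split.
    apply: (invariant_lifts rho1_aut su _ ordM_rho1); apply: (small_invariant sm).
    by vm_cast_no_check (erefl true).
  apply: (invariant_lifts rho2_aut su _ ordM_rho2); apply: (small_invariant sm).
  by vm_cast_no_check (erefl true).
split; [apply: (@noshort_lifts p0 rho1 conn tr ns) | apply: (@noshort_lifts p3 rho2 conn tr ns)];
  by vm_cast_no_check (erefl true).
Qed.

End Generators.

(** * Transitivity on arcs *)

(* The words in [rho1] and [rho2] that represent the 60 elements of A5, as
   binary numbers with a leading 1; the last digit acts first. *)
Definition words : seq positive := [:: 
  1; 2; 3; 4; 6; 5; 7; 12; 10; 14; 9; 13; 11; 20; 28; 18; 26; 22; 25; 21; 29; 19; 27; 36; 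
  52; 44; 50; 42; 58; 38; 54; 41; 57; 37; 45; 51; 43; 59; 100; 84; 116; 76; 108; 114; 74; 
  102; 118; 73; 89; 77; 83; 115; 75; 91; 178; 166; 182; 217; 205; 434]%positive.

Fixpoint wact (w : positive) (u : pt) : pt :=
  match w with
  | xH => u
  | xO w' => wact w' (rho1 u)
  | xI w' => wact w' (rho2 u)
  end.

Definition wmap (w : positive) (s : bool) (u : pt) : pt := wact w (if s then tau u else u).

Section Transitivity.
Variables (A : finZmodType) (a : 6.-tuple A).

Lemma lifts_id : lifts a id.
Proof. by exists 1%g; [exact: aut_id | move=> z; rewrite perm1]. Qed.

Lemma lifts_wact w : lifts a rho1 -> lifts a rho2 -> lifts a (wact w).
Proof.
move=> h1 h2; elim: w => [w IH|w IH|]; last exact: lifts_id.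
  exact: (lifts_comp IH h2).
exact: (lifts_comp IH h1).
Qed.

Lemma lifts_wmap w (s : bool) : lifts a rho1 -> lifts a rho2 -> (s -> lifts a tau) ->
  lifts a (wmap w s).
Proof.
move=> h1 h2 h3; case: s h3 => [/(_ isT) h3|_]; last exact: lifts_wact.
exact: (lifts_comp (lifts_wact w h1 h2) h3).
Qed.

(** One word leading to the standard 3-arc (p4, p1, p0, p2) and one leading back are sought, so that
    words are never inverted. Without [tau] only 2-arcs are matched: A5 acts regularly on the 60 of
    them, as S5 does on the 120 3-arcs. *)
Definition to_std (s : bool) (x y z w : pt) : bool :=
  has (fun v => has (fun b => let g := wmap v b in
    [&& eqpt (g x) p4, eqpt (g y) p1, eqpt (g z) p0 & ~~ s || eqpt (g w) p2])
    (if s then [:: false; true] else [:: false])) words &&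
  has (fun v => has (fun b => let g := wmap v b in
    [&& eqpt (g p4) x, eqpt (g p1) y, eqpt (g p0) z & ~~ s || eqpt (g p2) w])
    (if s then [:: false; true] else [:: false])) words.

Lemma has_ex (T : Type) (P : pred T) (l : seq T) : has P l -> exists x, P x.
Proof. by elim: l => //= x l IH /orP[h|/IH //]; exists x. Qed.

Lemma arc_lifts (s : bool) x y z w x' y' z' w' : lifts a rho1 -> lifts a rho2 ->
  (s -> lifts a tau) -> arcp x y z w -> arcp x' y' z' w' ->
  exists2 g, lifts a g & [/\ g x = x', g y = y', g z = z' & s -> g w = w'].
Proof.
move=> h1 h2 h3; have /all_arc3P chk : all_arc3 (to_std s).
  by case: (s); vm_cast_no_check (erefl true).
move=> /chk; rewrite {1}/to_std => /andP[/has_ex[v /hasP[b bs /and4P[/eqptP e1 /eqptP e2 /eqptP e3 e4]]] _].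
move=> /chk; rewrite {1}/to_std => /andP[_ /has_ex[v' /hasP[b' bs' /and4P[/eqptP f1 /eqptP f2 /eqptP f3 f4]]]].
have L u c : c \in (if s then [:: false; true] else [:: false]) -> lifts a (wmap u c).
  by move=> cs; apply: lifts_wmap => // ct; apply: h3; case: (s) cs ct; case: c.
exists (wmap v' b' \o wmap v b); first exact: lifts_comp (L _ _ bs') (L _ _ bs).
split; rewrite /= ?e1 ?e2 ?e3 // => st.
by move: e4 f4; rewrite st => /eqptP -> /eqptP.
Qed.

Lemma lifts_trans3 : lifts a rho1 -> lifts a rho2 -> lifts a tau ->
  s_arc_transitive 3 (vg a).
Proof.
move=> h1 h2 h3; apply: sarc_transitive_lifts => v v' v1 v2 v1' v2'.
pose i1 : 'I_4 := Ordinal (isT : 1 < 4)%N; pose i2 : 'I_4 := Ordinal (isT : 2 < 4)%N.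
pose i3 : 'I_4 := Ordinal (isT : 3 < 4)%N.
have mk (u : 'I_4 -> pt) : (forall i j : 'I_4, j = i.+1 :> nat -> adjp (u i) (u j)) ->
    (forall i j : 'I_4, j = i.+2 :> nat -> u i <> u j) ->
    arcp (u ord0) (u i1) (u i2) (u i3).
  move=> u1 u2; apply/and5P; split; rewrite ?u1 //; apply/negP=> /eqptP; exact: u2.
have [g lg [g0 g1 g2 g3]] := @arc_lifts true _ _ _ _ _ _ _ _ h1 h2 (fun _ => h3) (mk v v1 v2) (mk v' v1' v2').
exists g => // -[i li]; case: i li => [|[|[|[|//]]]] li.
- by rewrite (_ : Ordinal li = ord0) //; apply: val_inj.
- by rewrite (_ : Ordinal li = i1) //; apply: val_inj.
- by rewrite (_ : Ordinal li = i2) //; apply: val_inj.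
by rewrite (_ : Ordinal li = i3) ?g3 //; apply: val_inj.
Qed.

Lemma arcp_oth x y z : adjp x y -> adjp y z -> x <> z -> arcp x y z (oth z y).1.
Proof.
move=> xy yz xz; have [h1 h2 _ _ _] := oth_ok (etrans (adjpC _ _) yz).
have eqC p q : eqpt p q = eqpt q p by case: p; case: q.
by apply/and5P; split=> //; rewrite 1?eqC //; apply/negP=> /eqptP e; apply: xz.
Qed.

Lemma lifts_trans2 : lifts a rho1 -> lifts a rho2 -> s_arc_transitive 2 (vg a).
Proof.
move=> h1 h2; apply: sarc_transitive_lifts => v v' v1 v2 v1' v2'.
pose i1 : 'I_3 := Ordinal (isT : 1 < 3)%N; pose i2 : 'I_3 := Ordinal (isT : 2 < 3)%N.
have mk (u : 'I_3 -> pt) : (forall i j : 'I_3, j = i.+1 :> nat -> adjp (u i) (u j)) ->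
    (forall i j : 'I_3, j = i.+2 :> nat -> u i <> u j) ->
    arcp (u ord0) (u i1) (u i2) (oth (u i2) (u i1)).1.
  by move=> u1 u2; apply: arcp_oth; [exact: u1 | exact: u1 | exact: u2].
have [//|g lg [g0 g1 g2 _]] := @arc_lifts false _ _ _ _ _ _ _ _ h1 h2 _ (mk v v1 v2) (mk v' v1' v2').
exists g => // -[i li]; case: i li => [|[|[|//]]] li.
- by rewrite (_ : Ordinal li = ord0) //; apply: val_inj.
- by rewrite (_ : Ordinal li = i1) //; apply: val_inj.
by rewrite (_ : Ordinal li = i2) //; apply: val_inj.
Qed.

Lemma lifts_trans1 : lifts a rho1 -> lifts a rho2 -> arc_transitive (vg a).
Proof.
move=> h1 h2; apply: sarc_transitive_lifts => v v' v1 _ v1' _.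
pose i1 : 'I_2 := Ordinal (isT : 1 < 2)%N.
have mk (u : 'I_2 -> pt) : (forall i j : 'I_2, j = i.+1 :> nat -> adjp (u i) (u j)) ->
    arcp (u ord0) (u i1) (oth (u i1) (u ord0)).1
      (oth (oth (u i1) (u ord0)).1 (u i1)).1.
  move=> u1; have e := u1 ord0 i1 (erefl _).
  have [k1 k2 _ _ _] := oth_ok (etrans (adjpC _ _) e).
  by apply: arcp_oth => // e'; move: k2; rewrite -e'; case: (u ord0).
have [//|g lg [g0 g1 _ _]] := @arc_lifts false _ _ _ _ _ _ _ _ h1 h2 _ (mk v v1) (mk v' v1').
exists g => // -[i li]; case: i li => [|[|//]] li.
- by rewrite (_ : Ordinal li = ord0) //; apply: val_inj.
by rewrite (_ : Ordinal li = i1) //; apply: val_inj.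
Qed.

Lemma sarc3P (x0 x1 x2 x3 y0 y1 y2 y3 : vg a) : s_arc_transitive 3 (vg a) ->
  [/\ adj x0 x1, adj x1 x2, adj x2 x3, x0 <> x2 & x1 <> x3] ->
  [/\ adj y0 y1, adj y1 y2, adj y2 y3, y0 <> y2 & y1 <> y3] ->
  exists2 k : {perm vg a}, k \in Defs.aut (vg a) &
    [/\ k x0 = y0, k x1 = y1, k x2 = y2 & k x3 = y3].
Proof.
move=> tr hx hy.
pose w (t0 t1 t2 t3 : vg a) (i : 'I_4) := nth t0 [:: t0; t1; t2; t3] i.
have mk (t0 t1 t2 t3 : vg a) : [/\ adj t0 t1, adj t1 t2, adj t2 t3, t0 <> t2 & t1 <> t3] ->
    is_sarc (w t0 t1 t2 t3).
  case=> a1 a2 a3 n1 n2; split=> -[i li] [j lj] /= e; rewrite /w /= e.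
    by case: i li e => [|[|[|i]]] li e //; rewrite e in lj.
  by case: i li e => [|[|i]] li e //; rewrite e in lj.
have [k kA h] := tr _ _ (mk _ _ _ _ hx) (mk _ _ _ _ hy).
exists k => //; split; first exact: (h ord0).
- exact: (h (Ordinal (isT : 1 < 4)%N)).
- exact: (h (Ordinal (isT : 2 < 4)%N)).
exact: (h (Ordinal (isT : 3 < 4)%N)).
Qed.

Lemma trans3_arc : s_arc_transitive 3 (vg a) -> arc_transitive (vg a).
Proof.
move=> tr; have mk (x y : vg a) : adj x y ->
    exists z w, [/\ adj x y, adj y z, adj z w, x <> z & y <> w].
  rewrite adjE => /andP[xy /eqP ey].
  have [k1 k2 _ _ _] := oth_ok (etrans (adjpC _ _) xy).
  set v := (oth _ _).1 in k1 k2.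
  have [l1 l2 _ _ _] := oth_ok (etrans (adjpC _ _) k1).
  set v' := (oth _ _).1 in l1 l2.
  exists (nb y v), (nb (nb y v) v'); split.
  - by rewrite xy -ey eqxx.
  - by apply: adj_nb.
  - by apply: adj_nb; rewrite pr_nb.
  - by move/(congr1 (@pr _ a)); rewrite pr_nb => e; move: k2; rewrite e; case: (v).
  by move/(congr1 (@pr _ a)); rewrite !pr_nb => e; move: l2; rewrite e; case: (v').
move=> w w' [a1 _] [a2 _]; pose i1 : 'I_2 := Ordinal (isT : 1 < 2)%N.
have [z [t h]] := mk _ _ (a1 ord0 i1 (erefl _)).
have [z' [t' h']] := mk _ _ (a2 ord0 i1 (erefl _)).
have [k kA [k0 k1 _ _]] := sarc3P tr h h'; exists k => // -[i li].
case: i li => [|[|//]] li; first by rewrite (_ : Ordinal li = ord0) //; apply: val_inj.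
by rewrite (_ : Ordinal li = i1) //; apply: val_inj.
Qed.

(** [tau] takes the 3-arc (p4, p1, p0, p2) to (p6, p2, p0, p1), and an automorphism of the base is
    determined by the image of one 3-arc. *)
Lemma trans3_tau : connected (vg a) -> s_arc_transitive 3 (vg a) ->
  small a \/ lifts a tau.
Proof.
move=> conn tr; have tr1 := trans3_arc tr.
case: (small_or_noshort tr1) => [|ns]; [by left | right].
pose y : vg a := (vx p0, 0).
have mk u v w : adjp p0 u -> adjp p0 v -> adjp u w -> ~~ eqpt u v -> ~~ eqpt w p0 ->
    [/\ adj (nb (nb y u) w) (nb y u), adj (nb y u) y, adj y (nb y v),
        nb (nb y u) w <> y & nb y u <> nb y v].
  move=> u0 v0 uw uv w0; split.
  - by rewrite adj_sym adj_nb ?pr_nb.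
  - by rewrite adj_sym adj_nb.
  - by rewrite adj_nb.
  - by move/(congr1 (@pr _ a)); rewrite pr_nb /y /pr vxK => e; rewrite e in w0.
  by move/(congr1 (@pr _ a)); rewrite !pr_nb => e; rewrite e in uv; move: uv; case: (v).
have [//|//|//|//|//|k kA [k4 k1 k0 k2]] := sarc3P tr (mk p1 p2 p4 _ _ _ _ _) (mk p2 p1 p6 isT isT isT isT isT).
have y0 : pr y = p0 by [].
have [_ ks] := aut_induced ns tr1 conn kA y0; exists k => // z.
rewrite ks k4 k1 k0 k2 !pr_nb y0.
by case: (pr z).
Qed.

End Transitivity.

(** * Invariant sublattices of the homology *)

Arguments Z.mul : simpl never.
Arguments Z.add : simpl never.
Arguments Z.sub : simpl never.
Arguments Z.opp : simpl never.

Lemma vsubqE q x v y w : vsubq q (x :: v) (y :: w) = (x - q * y)%ZZ :: vsubq q v w.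
Proof. by rewrite /=; congr (_ :: _); case: y => //; lia. Qed.

Lemma vscale_map q v : vscale q v = [seq (q * y)%ZZ | y <- v].
Proof.
rewrite /vscale; elim: v => // x v IH.
by rewrite -[nseq _ _]/(0%ZZ :: nseq (size v) 0%ZZ) vsubqE IH /=; congr (_ :: _); lia.
Qed.

Lemma vaddlE x v y w : vaddl (x :: v) (y :: w) = (x + y)%ZZ :: vaddl v w.
Proof. by rewrite /vaddl vsubqE; congr (_ :: _); lia. Qed.

Lemma lcomb_cons z h r m : lcomb (z :: h) (r :: m) = vaddl (vscale z r) (lcomb h m).
Proof. by []. Qed.

Definition V6 (h1 h2 h3 h4 h5 h6 : Z) : seq Z := [:: h1; h2; h3; h4; h5; h6].

Lemma V6_eq h1 h2 h3 h4 h5 h6 k1 k2 k3 k4 k5 k6 : h1 = k1 -> h2 = k2 -> h3 = k3 ->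
  h4 = k4 -> h5 = k5 -> h6 = k6 -> V6 h1 h2 h3 h4 h5 h6 = V6 k1 k2 k3 k4 k5 k6.
Proof. by move=> -> -> -> -> -> ->. Qed.

Lemma V6P h : size h = 6%N -> exists h1 h2 h3 h4 h5 h6, h = V6 h1 h2 h3 h4 h5 h6.
Proof.
case: h => [|h1 [|h2 [|h3 [|h4 [|h5 [|h6 [|//]]]]]]] // _.
by exists h1, h2, h3, h4, h5, h6.
Qed.

Lemma lcombE (m : seq (seq Z)) h1 h2 h3 h4 h5 h6 r1 r2 r3 r4 r5 r6 :
  m = [:: r1; r2; r3; r4; r5; r6] ->
  lcomb (V6 h1 h2 h3 h4 h5 h6) m =
  vaddl [seq (h1 * y)%ZZ | y <- r1] (vaddl [seq (h2 * y)%ZZ | y <- r2]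
  (vaddl [seq (h3 * y)%ZZ | y <- r3] (vaddl [seq (h4 * y)%ZZ | y <- r4]
  (vaddl [seq (h5 * y)%ZZ | y <- r5] (vaddl [seq (h6 * y)%ZZ | y <- r6] z6))))).
Proof. by move=> ->; rewrite !lcomb_cons !vscale_map. Qed.

Lemma mulM_rho1 h1 h2 h3 h4 h5 h6 :
  mulM rho1 (V6 h1 h2 h3 h4 h5 h6) = V6 (- h3) (- h4) h5 (- h6) (- h1) h2.
Proof.
rewrite /mulM (@lcombE _ _ _ _ _ _ _ [:: 0; 0; 0; 0; -1; 0]%ZZ [:: 0; 0; 0; 0; 0; 1]%ZZ
  [:: -1; 0; 0; 0; 0; 0]%ZZ [:: 0; -1; 0; 0; 0; 0]%ZZ [:: 0; 0; 1; 0; 0; 0]%ZZ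
  [:: 0; 0; 0; -1; 0; 0]%ZZ); last by vm_compute.
by rewrite /z6 /= !vaddlE; apply: V6_eq; lia.
Qed.

Lemma mulM_rho2 h1 h2 h3 h4 h5 h6 :
  mulM rho2 (V6 h1 h2 h3 h4 h5 h6) =
  V6 h4 h5 (h5 - h6) (- h2 + h3 - h5 + h6) (- h1 - h3 - h4 - h6) (- h3 - h4).
Proof.
rewrite /mulM (@lcombE _ _ _ _ _ _ _ [:: 0; 0; 0; 0; -1; 0]%ZZ [:: 0; 0; 0; -1; 0; 0]%ZZ
  [:: 0; 0; 0; 1; -1; -1]%ZZ [:: 1; 0; 0; 0; -1; -1]%ZZ [:: 0; 1; 1; -1; 0; 0]%ZZ
  [:: 0; 0; -1; 1; -1; 0]%ZZ); last by vm_compute.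
by rewrite /z6 /= !vaddlE; apply: V6_eq; lia.
Qed.

Lemma mulM_tau h1 h2 h3 h4 h5 h6 :
  mulM tau (V6 h1 h2 h3 h4 h5 h6) = V6 h2 h1 (- h6) h5 h4 (- h3).
Proof.
rewrite /mulM (@lcombE _ _ _ _ _ _ _ [:: 0; 1; 0; 0; 0; 0]%ZZ [:: 1; 0; 0; 0; 0; 0]%ZZ
  [:: 0; 0; 0; 0; 0; -1]%ZZ [:: 0; 0; 0; 0; 1; 0]%ZZ [:: 0; 0; 0; 1; 0; 0]%ZZ
  [:: 0; 0; -1; 0; 0; 0]%ZZ); last by vm_compute.
by rewrite /z6 /= !vaddlE; apply: V6_eq; lia.
Qed.

Lemma phi_comb (A : finZmodType) (a : 6.-tuple A) x y u1 u2 u3 u4 u5 u6 v1 v2 v3 v4 v5 v6 :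
  phi a (V6 (x * u1 + y * v1) (x * u2 + y * v2) (x * u3 + y * v3)
            (x * u4 + y * v4) (x * u5 + y * v5) (x * u6 + y * v6)) =
  phi a (V6 u1 u2 u3 u4 u5 u6) *~ iz x + phi a (V6 v1 v2 v3 v4 v5 v6) *~ iz y.
Proof.
rewrite -!phil_vscale -phil_vaddl; last by rewrite !vscale_map !size_map.
by rewrite !vscale_map /V6 /= !vaddlE.
Qed.

Definition zpow (p n : nat) : Z := Z.of_nat (p ^ n).

Lemma zpow_gt0 p n : prime p -> (0 < zpow p n)%ZZ.
Proof.
move=> pp; have : (0 < p ^ n)%N by rewrite expn_gt0 prime_gt0.
by rewrite /zpow; lia.
Qed.

Lemma zpowD p m n : zpow p (m + n) = (zpow p m * zpow p n)%ZZ.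
Proof. by rewrite /zpow expnD; lia. Qed.

Lemma zpowS p n : zpow p n.+1 = (zpow p n * Z.of_nat p)%ZZ.
Proof. by rewrite -addn1 zpowD /zpow expn1. Qed.

Lemma zpow_dvd p n (g : Z) : prime p -> (0 < g)%ZZ -> Z.divide g (zpow p n) ->
  exists2 j, (j <= n)%N & g = zpow p j.
Proof.
move=> pp g0 [q e]; have p0 := zpow_gt0 n pp.
have : (Z.to_nat g %| p ^ n)%N.
  apply/dvdnP; exists (Z.to_nat q); rewrite /zpow in e p0; nia.
by case/(dvdn_pfactor _ _ pp) => j jn ej; exists j => //; rewrite /zpow -ej; lia.
Qed.

Lemma zpow_coprime p n y : prime p -> ~ Z.divide (Z.of_nat p) y ->
  exists u w, (u * y + w * zpow p n = 1)%ZZ.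
Proof.
move=> pp ny; have p0 := zpow_gt0 n pp.
have [u [w e]] := Z.gcd_bezout y (zpow p n) _ (erefl _).
have g0 : (0 < Z.gcd y (zpow p n))%ZZ.
  have := Z.gcd_nonneg y (zpow p n).
  have : Z.gcd y (zpow p n) <> 0%ZZ by move/Z.gcd_eq_0_r; lia.
  lia.
have [j jn ej] := zpow_dvd pp g0 (Z.gcd_divide_r y (zpow p n)).
case: j jn ej => [|j] jn ej; first by exists u, w; rewrite e ej.
case: ny; apply: (Z.divide_trans _ _ _ _ (Z.gcd_divide_l y (zpow p n))).
by rewrite ej /zpow expnS Nat2Z.inj_mul; apply: Z.divide_factor_l.
Qed.

Lemma odd_gauss p n x : odd p -> Z.divide (zpow p n) (2 * x) -> Z.divide (zpow p n) x.
Proof.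
move=> op d; apply: (Z.gauss _ 2 _ d).
have : odd (p ^ n) by rewrite oddX op orbT.
rewrite /zpow => o; have [k ->] : exists k, (p ^ n = k.*2.+1)%N.
  by exists (p ^ n)./2; have := odd_double_half (p ^ n); rewrite o; lia.
have -> : Z.of_nat k.*2.+1 = (2 * Z.of_nat k + 1)%ZZ by lia.
have := Z.gcd_divide_l (2 * Z.of_nat k + 1) 2; have := Z.gcd_divide_r (2 * Z.of_nat k + 1) 2.
have := Z.gcd_nonneg (2 * Z.of_nat k + 1) 2; set g := Z.gcd _ _ => g0 [q e] [q' e'].
have : Z.divide g 1.
  exists (q' - q * Z.of_nat k)%ZZ; rewrite Z.mul_sub_distr_r -e'.
  by have -> : (q * Z.of_nat k * g = Z.of_nat k * 2)%ZZ; [rewrite e; ring | lia].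
by move/Z.divide_1_r_nonneg; apply.
Qed.

Lemma divide_lin M x y z w k1 k2 k3 k4 : Z.divide M k1 -> Z.divide M k2 ->
  Z.divide M k3 -> Z.divide M k4 -> Z.divide M (x * k1 + y * k2 + z * k3 + w * k4).
Proof.
by move=> h1 h2 h3 h4; do ?apply: Z.divide_add_r; apply: Z.divide_mul_r.
Qed.

(* The forms whose vanishing modulo [M] describes the kernels for [l] a root of
   [x ^ 2 - x - 1]. *)
Definition F1 (l h1 h2 h3 h4 h5 h6 : Z) := (h3 + l * h4 - (1 - l) * h5 + h6)%ZZ.
Definition F2 (l h1 h2 h3 h4 h5 h6 : Z) := (h2 - (1 - l) * h3 + l * h4 + h5)%ZZ.
Definition F3 (l h1 h2 h3 h4 h5 h6 : Z) := (h1 - l * h3 - l * h4 - l * h5)%ZZ.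

Definition PL (M l h1 h2 h3 h4 h5 h6 : Z) : Prop :=
  [/\ Z.divide M (F1 l h1 h2 h3 h4 h5 h6), Z.divide M (F2 l h1 h2 h3 h4 h5 h6) &
      Z.divide M (F3 l h1 h2 h3 h4 h5 h6)].

Section Lattice.
Variables (A : finZmodType) (a : 6.-tuple A).

Definition Kx h1 h2 h3 h4 h5 h6 : Prop := phi a (V6 h1 h2 h3 h4 h5 h6) = 0.

Lemma Kx_eq h1 h2 h3 h4 h5 h6 k1 k2 k3 k4 k5 k6 : Kx h1 h2 h3 h4 h5 h6 ->
  h1 = k1 -> h2 = k2 -> h3 = k3 -> h4 = k4 -> h5 = k5 -> h6 = k6 ->
  Kx k1 k2 k3 k4 k5 k6.
Proof. by move=> + <- <- <- <- <- <-. Qed.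

Lemma Kx_comb x y u1 u2 u3 u4 u5 u6 v1 v2 v3 v4 v5 v6 :
  Kx u1 u2 u3 u4 u5 u6 -> Kx v1 v2 v3 v4 v5 v6 ->
  Kx (x * u1 + y * v1) (x * u2 + y * v2) (x * u3 + y * v3)
     (x * u4 + y * v4) (x * u5 + y * v5) (x * u6 + y * v6).
Proof. by rewrite /Kx phi_comb => -> ->; rewrite !mul0rz addr0. Qed.

Hypotheses (inv1 : invariant a rho1) (inv2 : invariant a rho2).

Lemma Kx_rho1 h1 h2 h3 h4 h5 h6 : Kx h1 h2 h3 h4 h5 h6 ->
  Kx (- h3) (- h4) h5 (- h6) (- h1) h2.
Proof. by rewrite /Kx -mulM_rho1; apply: inv1. Qed.

Lemma Kx_rho2 h1 h2 h3 h4 h5 h6 : Kx h1 h2 h3 h4 h5 h6 ->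
  Kx h4 h5 (h5 - h6) (- h2 + h3 - h5 + h6) (- h1 - h3 - h4 - h6) (- h3 - h4).
Proof. by rewrite /Kx -mulM_rho2; apply: inv2. Qed.

(* The homology is a module over [Z[t]], [t ^ 2 = t + 1], with [t] commuting with
   A5. This says that [(x + y t) v] lies in the kernel, where [v] spans
   the image of [1 + g] for the involution [g = rho2 rho1 rho2 rho1 rho1]. *)
Definition inI x y : Prop := Kx (- y) (2 * y) y (- x - y) 0 (x + y).

Lemma inI_eq x y x' y' : inI x y -> x = x' -> y = y' -> inI x' y'.
Proof. by move=> + <- <-. Qed.

Lemma inI_comb u w x y x' y' : inI x y -> inI x' y' ->
  inI (u * x + w * x') (u * y + w * y').
Proof. by move=> h h'; apply: Kx_eq (Kx_comb u w h h') _ _ _ _ _ _; lia. Qed.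

(** (1 + g) h equals (x + y t) v for these x and y. *)
Lemma inI_form h1 h2 h3 h4 h5 h6 : Kx h1 h2 h3 h4 h5 h6 -> inI (- h2 - h4 - h5 + h6) h2.
Proof.
move=> k; have := Kx_rho2 (Kx_rho1 (Kx_rho2 (Kx_rho1 (Kx_rho1 k)))).
by move/(Kx_comb 1 1 k) => k'; apply: Kx_eq k' _ _ _ _ _ _; lia.
Qed.

(** On the multiples of v, multiplication by t is (1 + g) [rho1]; so [inI] describes an ideal of
    Z[t]. *)
Lemma inI_t x y : inI x y -> inI y (x + y).
Proof. by move/Kx_rho1/inI_form=> k; apply: inI_eq k _ _; lia. Qed.

(** The conjugates of g = (a c)(b d) under [rho2] = (a b c) are the involutions of a Klein
    four-group without invariants in homology. So they add up to -1, and the three conjugates of 1 +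
    g add up to 2. The hypotheses are the pairs of [inI_form] for h and its images under the powers
    of [rho2]. *)
Lemma Kx_double h1 h2 h3 h4 h5 h6 : inI (- h2 - h4 - h5 + h6) h2 ->
  inI (h1 + h2 - h3) h5 -> inI (h4 + h6) (- h1 - h3 - h4 - h6) ->
  Kx (2 * h1) (2 * h2) (2 * h3) (2 * h4) (2 * h5) (2 * h6).
Proof.
move=> k1 /Kx_rho2/Kx_rho2 k2 /Kx_rho2 k3.
have k := Kx_comb 1 1 (Kx_comb 1 1 k1 k2) k3.
by apply: Kx_eq k _ _ _ _ _ _; lia.
Qed.

Variables (p e : nat).
Hypotheses (pp : prime p) (kill : forall h1 h2 h3 h4 h5 h6,
  Kx (zpow p e * h1) (zpow p e * h2) (zpow p e * h3)
     (zpow p e * h4) (zpow p e * h5) (zpow p e * h6)).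
Hypothesis prim : exists h1 h2 h3 h4 h5 h6, Kx h1 h2 h3 h4 h5 h6 /\
  ~ [/\ Z.divide (Z.of_nat p) h1, Z.divide (Z.of_nat p) h2, Z.divide (Z.of_nat p) h3 &
      [/\ Z.divide (Z.of_nat p) h4, Z.divide (Z.of_nat p) h5 & Z.divide (Z.of_nat p) h6]].

(** The ideal meets Z in the multiples of its smallest power of p, since a gcd with a power of p is
    again one. *)
Lemma inI_dvd m : inI (zpow p m) 0 -> (forall n, inI (zpow p n) 0 -> (m <= n)%N) ->
  forall n, inI n 0 -> Z.divide (zpow p m) n.
Proof.
move=> pm mn n kn; have p0 := zpow_gt0 m pp.
have [u [w ew]] := Z.gcd_bezout n (zpow p m) _ (erefl _).
have g0 : (0 < Z.gcd n (zpow p m))%ZZ.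
  have := Z.gcd_nonneg n (zpow p m).
  have : Z.gcd n (zpow p m) <> 0%ZZ by move/Z.gcd_eq_0_r; lia.
  lia.
have [j jn ej] := zpow_dvd pp g0 (Z.gcd_divide_r n (zpow p m)).
have : inI (zpow p j) 0.
  by apply: inI_eq (inI_comb u w kn pm) _ _; rewrite -?ej; lia.
move/mn=> mj; have jm : j = m by lia.
by rewrite -jm -ej; apply: Z.gcd_divide_l.
Qed.

Lemma inI_kill x y : inI (zpow p e * x) (zpow p e * y).
Proof.
by have k := kill (- y) (2 * y) y (- x - y) 0 (x + y); apply: Kx_eq k _ _ _ _ _ _; lia.
Qed.

(** The ideal contains some x + y t with y prime to p, so it is generated by a power of p and t - (1
    - l): on the quotient t acts as 1 - l, the other root. The three forms are the membership
    conditions for h and its images under [rho2], solved for the coordinates. *)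
Lemma odd_kernel : odd p -> exists m l, Z.divide (zpow p m) (l * l - l - 1) /\
  forall h1 h2 h3 h4 h5 h6, Kx h1 h2 h3 h4 h5 h6 <-> PL (zpow p m) l h1 h2 h3 h4 h5 h6.
Proof.
move=> op; have ex : exists m, phi a (V6 (- 0) (2 * 0) 0 (- zpow p m - 0) 0 (zpow p m + 0)) == 0.
  exists e; apply/eqP; have k := inI_kill 1 0.
  by apply: Kx_eq k _ _ _ _ _ _; lia.
case: (ex_minnP ex) => m /eqP pm min {ex}.
have mn n : inI (zpow p n) 0 -> (m <= n)%N by move=> k; apply: min; apply/eqP.
have dv := inI_dvd pm mn; exists m.
have k0 : inI 0 (zpow p m) by have := inI_t pm; move=> k; apply: inI_eq k _ _; lia.
have [x [y [kxy ny]]] : exists x y, inI x y /\ ~ Z.divide (Z.of_nat p) y.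
  have [h1 [h2 [h3 [h4 [h5 [h6 [k nd]]]]]]] := prim.
  (* If p divides y but not x, multiplication by t moves x to the second place: t (x + y t) = y + (x
     + y) t. *)
  have gen x y : inI x y -> ~ (Z.divide (Z.of_nat p) x /\ Z.divide (Z.of_nat p) y) ->
      exists x y, inI x y /\ ~ Z.divide (Z.of_nat p) y.
    move=> kxy nxy; have [dy|ny] := Znumtheory.Zdivide_dec (Z.of_nat p) y; last by exists x, y.
    exists y, (x + y)%ZZ; split; first exact: inI_t.
    move=> dxy; apply: nxy; split=> //; have := Z.divide_sub_r _ _ _ dxy dy.
    by have -> : (x + y - y = x)%ZZ by lia.
  have k1 := inI_form k.
  have k2 : inI (h1 + h2 - h3) h5 by apply: inI_eq (inI_form (Kx_rho2 k)) _ _; lia.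
  have k3 : inI (h4 + h6) (- h1 - h3 - h4 - h6).
    by apply: inI_eq (inI_form (Kx_rho2 (Kx_rho2 k))) _ _; lia.
  have dec x y : (Z.divide (Z.of_nat p) x /\ Z.divide (Z.of_nat p) y) \/
     ~ (Z.divide (Z.of_nat p) x /\ Z.divide (Z.of_nat p) y).
    have [dx|nx] := Znumtheory.Zdivide_dec (Z.of_nat p) x; last by right=> -[].
    by have [dy|ny] := Znumtheory.Zdivide_dec (Z.of_nat p) y; [left | right=> -[]].
  have [[a1 b1]|n1] := dec (- h2 - h4 - h5 + h6)%ZZ h2; last exact: gen k1 n1.
  have [[a2 b2]|n2] := dec (h1 + h2 - h3)%ZZ h5; last exact: gen k2 n2.
  have [[a3 b3]|n3] := dec (h4 + h6)%ZZ (- h1 - h3 - h4 - h6)%ZZ; last exact: gen k3 n3.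
  case: nd; have od x : Z.divide (Z.of_nat p) (2 * x) -> Z.divide (Z.of_nat p) x.
    by have := @odd_gauss p 1 x op; rewrite /zpow expn1.
  case: a1 => A1 e1; case: b1 => B1 e2; case: a2 => A2 e3; case: b2 => B2 e4.
  case: a3 => A3 e5; case: b3 => B3 e6.
  split; last split; apply: od.
  - by exists (- B3 - A3 + A2 - B1)%ZZ; lia.
  - by exists (2 * B1)%ZZ; lia.
  - by exists (- B3 - A3 - A2 + B1)%ZZ; lia.
  - by exists (A3 - A1 - B1 - B2)%ZZ; lia.
  - by exists (2 * B2)%ZZ; lia.
  - by exists (A3 + A1 + B1 + B2)%ZZ; lia.
have [u [w ew]] := zpow_coprime m pp ny.
have kl : inI (u * x) 1 by apply: inI_eq (inI_comb u w kxy k0) _ _; lia.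
pose l := (1 + u * x)%ZZ; exists l.
have char x1 y1 : inI x1 y1 <-> Z.divide (zpow p m) (x1 + (1 - l) * y1).
  split=> [k|[q eq]].
    by apply: dv; apply: inI_eq (inI_comb 1 (- y1) k kl) _ _; rewrite /l; lia.
  by apply: inI_eq (inI_comb q y1 pm kl) _ _; rewrite /l in eq; lia.
have rt : Z.divide (zpow p m) (l * l - l - 1).
  have := inI_t kl; move/char => h; apply/Z.divide_opp_r; move: h.
  by congr (Z.divide _ _); rewrite /l; ring.
split=> // h1 h2 h3 h4 h5 h6; split=> [k|[d1 d2 d3]].
  have /char c1 := inI_form k; have /char c2 := inI_form (Kx_rho2 k).
  have /char c3 := inI_form (Kx_rho2 (Kx_rho2 k)).
  split; apply: odd_gauss => //.
  - have := divide_lin (1 - l) (-1) l (- h2 - h1 - h3 - h4 - h6) c1 c2 c3 rt.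
    by congr (Z.divide _ _); rewrite /F1; ring.
  - have := divide_lin (- l) (1 - l) 1 (- h2 - h5) c1 c2 c3 rt.
    by congr (Z.divide _ _); rewrite /F2; ring.
  have := divide_lin l (1 + l) (-1) (h2 + h5) c1 c2 c3 rt.
  by congr (Z.divide _ _); rewrite /F3; ring.
(* Only 2 h is obtained here; since p ^ e is odd and p ^ e h lies in the kernel, h follows below. *)
have k2 : Kx (2 * h1) (2 * h2) (2 * h3) (2 * h4) (2 * h5) (2 * h6).
  apply: Kx_double; apply/char.
  - have := divide_lin 1 (- l) 0 (h3 + h4) d1 d2 d3 rt.
    by congr (Z.divide _ _); rewrite /F1 /F2 /F3; ring.
  - have := divide_lin 0 1 1 0 d1 d2 d3 rt.
    by congr (Z.divide _ _); rewrite /F1 /F2 /F3; ring.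
  have := divide_lin l 0 (l - 1) h3 d1 d2 d3 rt.
  by congr (Z.divide _ _); rewrite /F1 /F2 /F3; ring.
have [r er] : exists r, (zpow p e = 2 * r + 1)%ZZ.
  have o : odd (p ^ e) by rewrite oddX op orbT.
  exists (Z.of_nat (p ^ e)./2); have := odd_double_half (p ^ e); rewrite o /zpow; lia.
have k3 := Kx_comb 1 (- r) (kill h1 h2 h3 h4 h5 h6) k2.
by apply: Kx_eq k3 _ _ _ _ _ _; rewrite er; ring.
Qed.

Fixpoint wM (w : positive) (h : seq Z) : seq Z :=
  match w with
  | xH => h
  | xO w' => wM w' (mulM rho1 h)
  | xI w' => wM w' (mulM rho2 h)
  end.

(** 2 is inert in Z[t]: the norm x^2 + x y - y^2 is odd unless x and y are both even. So the ideal
    contains an odd integer and a power of 2, hence 1, and the A5-images of v and t v generate a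
    lattice containing [h2gens]. *)
Lemma two_kernel : p = 2%N -> small a.
Proof.
move=> p2; have [x [y [kxy nxy]]] : exists x y, inI x y /\ ~ (Z.divide 2 x /\ Z.divide 2 y).
  have [h1 [h2 [h3 [h4 [h5 [h6 [k nd]]]]]]] := prim; rewrite p2 in nd.
  have k1 := inI_form k.
  (* The pairs belong to h, [rho1] h and [rho2] h: their six entries are unimodular in h, while
     those used in [Kx_double] lose a factor 2. *)
  have k2 : inI (h1 + h2 + h4 + h6) (- h4) by apply: inI_eq (inI_form (Kx_rho1 k)) _ _; lia.
  have k3 : inI (h1 + h2 - h3) h5 by apply: inI_eq (inI_form (Kx_rho2 k)) _ _; lia.
  have dec x y : (Z.divide 2 x /\ Z.divide 2 y) \/ ~ (Z.divide 2 x /\ Z.divide 2 y).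
    have [dx|nx] := Znumtheory.Zdivide_dec 2 x; last by right=> -[].
    by have [dy|ny] := Znumtheory.Zdivide_dec 2 y; [left | right=> -[]].
  have [[a1 b1]|n1] := dec (- h2 - h4 - h5 + h6)%ZZ h2; last by exists (- h2 - h4 - h5 + h6)%ZZ, h2.
  have [[a2 b2]|n2] := dec (h1 + h2 + h4 + h6)%ZZ (- h4)%ZZ.
    have [[a3 b3]|n3] := dec (h1 + h2 - h3)%ZZ h5; last by exists (h1 + h2 - h3)%ZZ, h5.
    case: nd; case: a1 => A1 e1; case: b1 => B1 e2; case: a2 => A2 e3; case: b2 => B2 e4.
    case: a3 => A3 e5; case: b3 => B3 e6.
    split; last split.
    - by exists (A2 - 2 * B1 + 2 * B2 - A1 - B3)%ZZ; lia.
    - by exists B1.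
    - by exists (A2 - B1 + 2 * B2 - A1 - B3 - A3)%ZZ; lia.
    - by exists (- B2)%ZZ; lia.
    - by exists B3.
    - by exists (A1 + B1 - B2 + B3)%ZZ; lia.
  by exists (h1 + h2 + h4 + h6)%ZZ, (- h4)%ZZ.
have kN : inI (x * x + x * y - y * y) 0.
  by apply: inI_eq (inI_comb (x + y) (- y) kxy (inI_t kxy)) _ _; ring.
have nN : ~ Z.divide (Z.of_nat p) (x * x + x * y - y * y).
  rewrite p2 => -[q eq]; apply: nxy.
  have [X [rx [eX hX]]] : exists X r, x = (2 * X + r)%ZZ /\ (r = 0 \/ r = 1)%ZZ.
    have b := Z.mod_pos_bound x 2; have d := Z.div_mod x 2.
    by exists (x / 2)%ZZ, (x mod 2)%ZZ; lia.
  have [Y [ry [eY hY]]] : exists Y r, y = (2 * Y + r)%ZZ /\ (r = 0 \/ r = 1)%ZZ.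
    have b := Z.mod_pos_bound y 2; have d := Z.div_mod y 2.
    by exists (y / 2)%ZZ, (y mod 2)%ZZ; lia.
  case: hX => hX; case: hY => hY; rewrite hX in eX; rewrite hY in eY;
    try (by exfalso; nia); split; by [exists X; lia | exists Y; lia].
have [u [w ew]] := zpow_coprime e pp nN.
have ke := inI_kill 1 0.
have k1 : inI 1 0 by apply: inI_eq (inI_comb u w kN ke) _ _; lia.
have k2 : inI 0 1 by apply: inI_eq (inI_t k1) _ _; lia.
have kw v r : size r = 6%N -> phi a r = 0 -> size (wM v r) = 6%N /\ phi a (wM v r) = 0.
  elim: v r => [v IH|v IH|] r sr pr //=; apply: IH; rewrite ?size_mulM //.
    exact: inv2.
  exact: inv1.
have kv1 : Kx 0 0 0 (-1) 0 1 by apply: Kx_eq k1 _ _ _ _ _ _; lia.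
have kv2 : Kx (-1) 2 1 (-1) 0 1 by apply: Kx_eq k2 _ _ _ _ _ _; lia.
pose vs := [seq wM v (V6 0 0 0 (-1) 0 1) | v <- words] ++
           [seq wM v (V6 (-1) 2 1 (-1) 0 1) | v <- words].
have memE (F : positive -> seq Z) l r : r \in map F l -> exists v, r = F v.
  by elim: l => //= v l IH; rewrite inE => /orP[/eqP->|/IH //]; exists v.
move=> h hh; apply: (@lgen_ok _ a vs).
- move=> r; rewrite mem_cat => /orP[] /memE[v ->].
    exact: (kw v (V6 0 0 0 (-1) 0 1)).
  exact: (kw v (V6 (-1) 2 1 (-1) 0 1)).
- by have /allP/(_ h hh)/eqP := isT : all (fun h => size h == 6%N) h2gens.
by move: h hh; apply/allP; vm_cast_no_check (erefl true).
Qed.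

End Lattice.

(** Its kernel consists of the h whose n-fold lies in the kernel of [a]; this serves to divide a
    kernel by its content. *)
Definition scale6 (A : finZmodType) (a : 6.-tuple A) (n : nat) : 6.-tuple A :=
  map_tuple (fun x => x *+ n) a.

Definition Peven (x y : Z) (h1 h2 h3 h4 h5 h6 : Z) : Prop :=
  Z.divide 2 (x * (h1 + h3 + h5) + y * (h2 + h4 + h6)).
Definition Pall (h1 h2 h3 h4 h5 h6 : Z) : Prop := True.
Definition Pboth (h1 h2 h3 h4 h5 h6 : Z) : Prop :=
  Z.divide 2 (h1 + h3 + h5) /\ Z.divide 2 (h2 + h4 + h6).

Section Structure.
Variables (A : finZmodType) (a : 6.-tuple A).

Definition Kform (d : Z) (P : Z -> Z -> Z -> Z -> Z -> Z -> Prop) : Prop :=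
  forall h1 h2 h3 h4 h5 h6, Kx a h1 h2 h3 h4 h5 h6 <->
  exists k1 k2 k3 k4 k5 k6,
    ([/\ h1 = d * k1, h2 = d * k2, h3 = d * k3 & [/\ h4 = d * k4, h5 = d * k5 & h6 = d * k6]])%ZZ
    /\ P k1 k2 k3 k4 k5 k6.

Lemma izn n : iz (Z.of_nat n) = n%:Z.
Proof. by rewrite /iz; lia. Qed.

Lemma phi_scale n h : phi (scale6 a n) h = phi a h *+ n.
Proof.
rewrite /phi /=; elim: (tval a) h => [|x s IH] [|z h] /=; rewrite ?mul0rn //.
by rewrite IH mulrnDl !pmulrn -!mulrzA mulrC.
Qed.

Lemma Kx_scale n h1 h2 h3 h4 h5 h6 : Kx (scale6 a n) h1 h2 h3 h4 h5 h6 <->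
  Kx a (Z.of_nat n * h1) (Z.of_nat n * h2) (Z.of_nat n * h3)
       (Z.of_nat n * h4) (Z.of_nat n * h5) (Z.of_nat n * h6).
Proof.
rewrite /Kx phi_scale -[V6 (_ * _) _ _ _ _ _]/([seq (Z.of_nat n * y)%ZZ | y <- V6 h1 h2 h3 h4 h5 h6]).
by rewrite -vscale_map /phi phil_vscale izn pmulrn.
Qed.

Lemma invariant_scale s n : invariant a s -> invariant (scale6 a n) s.
Proof.
move=> inv h sh; rewrite !phi_scale !pmulrn -izn -!phiZ => k.
have := inv _ _ k; rewrite vscale_map size_map => /(_ sh).
by rewrite -!phi_relab -vscale_map phiZ phi_relab -phiZ.
Qed.

Lemma small_parity : small a -> forall h1 h2 h3 h4 h5 h6,
  Kx a h1 h2 h3 h4 h5 h6 <->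
  phi a (V6 1 0 0 0 0 0) *~ iz ((h1 + h3 + h5) mod 2) +
  phi a (V6 0 1 0 0 0 0) *~ iz ((h2 + h4 + h6) mod 2) = 0.
Proof.
move=> sm h1 h2 h3 h4 h5 h6; rewrite -phi_comb.
have g1 : Kx a 1 0 (-1) 0 0 0 by apply: sm.
have g2 : Kx a 0 0 1 0 (-1) 0 by apply: sm.
have g3 : Kx a 2 0 0 0 0 0 by apply: sm.
have g4 : Kx a 0 1 0 (-1) 0 0 by apply: sm.
have g5 : Kx a 0 0 0 1 0 (-1) by apply: sm.
have g6 : Kx a 0 2 0 0 0 0 by apply: sm.
set s1 := (h1 + h3 + h5)%ZZ; set s2 := (h2 + h4 + h6)%ZZ.
have k1 := Kx_comb (h3 + h5) h5 g1 g2; have k2 := Kx_comb (h4 + h6) h6 g4 g5.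
have k3 := Kx_comb (s1 / 2) (s2 / 2) g3 g6.
have k := Kx_comb 1 (-1) (Kx_comb 1 1 k1 k2) k3.
have e1 := Z.div_mod s1 2; have e2 := Z.div_mod s2 2.
split=> [kh|kh].
  by apply: Kx_eq (Kx_comb 1 1 kh k) _ _ _ _ _ _; rewrite /s1 /s2 in e1 e2 *; lia.
by apply: Kx_eq (Kx_comb 1 (-1) kh k) _ _ _ _ _ _; rewrite /s1 /s2 in e1 e2 *; lia.
Qed.

Lemma mod2P x : (Z.divide 2 x /\ (x mod 2 = 0)%ZZ) \/ (~ Z.divide 2 x /\ (x mod 2 = 1)%ZZ).
Proof.
have e := Z.div_mod x 2; have b := Z.mod_pos_bound x 2.
have [z|z] : (x mod 2 = 0 \/ x mod 2 = 1)%ZZ by lia.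
  by left; split=> //; exists (x / 2)%ZZ; lia.
by right; split=> // -[q eq]; lia.
Qed.

(** The lattice of [h2gens] has a Klein four-group as quotient. The cases are the five subgroups,
    told apart by the voltages of the first two basis vectors. *)
Lemma small_kernel : small a ->
  [\/ forall h1 h2 h3 h4 h5 h6, Kx a h1 h2 h3 h4 h5 h6 <-> Pall h1 h2 h3 h4 h5 h6,
      exists x y, [/\ (x, y) \in [:: (1, 0); (0, 1); (1, 1)]%ZZ &
        forall h1 h2 h3 h4 h5 h6, Kx a h1 h2 h3 h4 h5 h6 <-> Peven x y h1 h2 h3 h4 h5 h6] |
      forall h1 h2 h3 h4 h5 h6, Kx a h1 h2 h3 h4 h5 h6 <-> Pboth h1 h2 h3 h4 h5 h6].
Proof.
move=> sm; have par := small_parity sm.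
have two : phi a (V6 1 0 0 0 0 0) + phi a (V6 1 0 0 0 0 0) = 0.
  have k : Kx a 2 0 0 0 0 0 by apply: sm.
  have e1 (x : A) : x *~ iz 1 = x := mulr1z x.
  have := phi_comb a 1 1 1 0 0 0 0 0 1 0 0 0 0 0; rewrite !e1.
  by move=> <-; apply: Kx_eq k _ _ _ _ _ _.
move: (phi a (V6 1 0 0 0 0 0)) (phi a (V6 0 1 0 0 0 0)) par two => u v par two.
have e0 (x : A) : x *~ iz 0 = 0 := mulr0z x.
have e1 (x : A) : x *~ iz 1 = x := mulr1z x.
have ev x y h1 h2 h3 h4 h5 h6 : Peven x y h1 h2 h3 h4 h5 h6 <->
    Z.divide 2 (x * ((h1 + h3 + h5) mod 2) + y * ((h2 + h4 + h6) mod 2)).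
  have f1 := Z.div_mod (h1 + h3 + h5) 2; have f2 := Z.div_mod (h2 + h4 + h6) 2.
  rewrite /Peven; split=> -[q eq].
    exists (q - x * ((h1 + h3 + h5) / 2) - y * ((h2 + h4 + h6) / 2))%ZZ; nia.
  exists (q + x * ((h1 + h3 + h5) / 2) + y * ((h2 + h4 + h6) / 2))%ZZ; nia.
have n1 : ~ Z.divide 2 1 by move=> [q eq]; lia.
have d2 : Z.divide 2 2 by exists 1%ZZ.
have d0 : Z.divide 2 0 by exists 0%ZZ.
have [u0|u0] := eqVneq u 0; have [v0|v0] := eqVneq v 0.
- by constructor 1 => *; split=> // _; apply/par; rewrite u0 v0 !mul0rz addr0.
- constructor 2; exists 0%ZZ, 1%ZZ; split=> // h1 h2 h3 h4 h5 h6; rewrite ev par u0 mul0rz.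
  case: (mod2P (h2 + h4 + h6)) => -[_ ->]; rewrite ?e0 ?e1 ?addr0 ?add0r ?two; split; first [by [] | by move=> _; exists 0%ZZ; lia |
    by move=> _; exists 1%ZZ; lia | by move=> /eqP; rewrite (negbTE v0) | by move=> [q eq]; lia].
- constructor 2; exists 1%ZZ, 0%ZZ; split=> // h1 h2 h3 h4 h5 h6; rewrite ev par v0 mul0rz.
  case: (mod2P (h1 + h3 + h5)) => -[_ ->]; rewrite ?e0 ?e1 ?addr0 ?add0r ?two; split; first [by [] | by move=> _; exists 0%ZZ; lia |
    by move=> _; exists 1%ZZ; lia | by move=> /eqP; rewrite (negbTE u0) | by move=> [q eq]; lia].
have [uv|uv] := eqVneq u v.
  constructor 2; exists 1%ZZ, 1%ZZ; split=> // h1 h2 h3 h4 h5 h6; rewrite ev par -uv.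
  case: (mod2P (h1 + h3 + h5)) => -[_ ->]; case: (mod2P (h2 + h4 + h6)) => -[_ ->]; rewrite ?e0 ?e1 ?addr0 ?add0r ?two; split; first [by [] | by move=> _; exists 0%ZZ; lia |
    by move=> _; exists 1%ZZ; lia | by move=> /eqP; rewrite (negbTE u0) | by move=> [q eq]; lia].
constructor 3 => h1 h2 h3 h4 h5 h6; rewrite par /Pboth.
have vu : u + v <> 0.
  move=> uv0; move/eqP: uv; apply; apply: (addrI u); by rewrite two uv0.
case: (mod2P (h1 + h3 + h5)) => -[? ->]; case: (mod2P (h2 + h4 + h6)) => -[? ->];
  rewrite ?e0 ?e1 ?addr0 ?add0r; split=> //; try (by case);
  by move=> /eqP; rewrite ?(negbTE u0) ?(negbTE v0).
Qed.

End Structure.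

(** [c] is the largest exponent for which p ^ c divides all of the kernel; it exists because the
    kernel contains p ^ e Z^6. Dividing by p ^ c leaves a kernel with a vector not divisible by
    p. *)
Lemma kernel_structure (A : finZmodType) (a : 6.-tuple A) (p e : nat) : prime p -> (forall x : A, x *+ p ^ e = 0) ->
  invariant a rho1 -> invariant a rho2 ->
  exists c, (odd p /\ exists m l, Z.divide (zpow p m) (l * l - l - 1) /\
               Kform a (zpow p c) (PL (zpow p m) l)) \/
    (p = 2%N /\ [\/ Kform a (zpow 2 c) Pall,
       exists x y, [/\ (x, y) \in [:: (1, 0); (0, 1); (1, 1)]%ZZ &
         Kform a (zpow 2 c) (Peven x y)] | Kform a (zpow 2 c) Pboth]).
Proof.
move=> pp kill inv1 inv2.
pose dv n (h1 h2 h3 h4 h5 h6 : Z) := [/\ Z.divide n h1, Z.divide n h2, Z.divide n h3 &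
   [/\ Z.divide n h4, Z.divide n h5 & Z.divide n h6]].
pose Q c := forall h1 h2 h3 h4 h5 h6, Kx a h1 h2 h3 h4 h5 h6 -> dv (zpow p c) h1 h2 h3 h4 h5 h6.
have Kkill h1 h2 h3 h4 h5 h6 : Kx a (zpow p e * h1) (zpow p e * h2) (zpow p e * h3)
     (zpow p e * h4) (zpow p e * h5) (zpow p e * h6).
  by apply/Kx_scale; rewrite /Kx phi_scale kill.
have d1 x : Z.divide (zpow p 0) x := Z.divide_1_l x.
have Q0 : Q 0%N by move=> *; split; last split; apply: d1.
have nQ : ~ Q e.+1.
  move=> q; have [[r er] _ _ _] := q _ _ _ _ _ _ (Kkill 1 0 0 0 0 0)%ZZ.
  have p0 := zpow_gt0 e pp; have := prime_gt1 pp.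
  move=> p1; have er' : (r * Z.of_nat p = 1)%ZZ.
    by apply: (Z.mul_reg_l _ _ (zpow p e)); rewrite zpowS in er; lia.
  have /Z.divide_1_r : Z.divide (Z.of_nat p) 1 by exists r.
  by lia.
have [c [Qc nQc]] : exists c, Q c /\ ~ Q c.+1.
  elim: e.+1 nQ => [|n IH] nQ; first by case: nQ.
  by have [q|/IH //] := Classical_Prop.classic (Q n); exists n.
pose b := scale6 a (p ^ c).
have ab h1 h2 h3 h4 h5 h6 : Kx a h1 h2 h3 h4 h5 h6 <-> exists k1 k2 k3 k4 k5 k6,
    ([/\ h1 = zpow p c * k1, h2 = zpow p c * k2, h3 = zpow p c * k3 &
     [/\ h4 = zpow p c * k4, h5 = zpow p c * k5 & h6 = zpow p c * k6]])%ZZ /\ Kx b k1 k2 k3 k4 k5 k6.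
  split=> [k|[k1 [k2 [k3 [k4 [k5 [k6 [[-> -> -> [-> -> ->]]]]]]]]]]; last by move/Kx_scale.
  have [[k1 e1] [k2 e2] [k3 e3] [[k4 e4] [k5 e5] [k6 e6]]] := Qc _ _ _ _ _ _ k.
  exists k1, k2, k3, k4, k5, k6; split; first by split; last split; rewrite Z.mul_comm.
  by apply/Kx_scale; apply: Kx_eq k _ _ _ _ _ _; rewrite Z.mul_comm.
have [h1 [h2 [h3 [h4 [h5 [h6 [kh nd]]]]]]] : exists h1 h2 h3 h4 h5 h6,
    Kx a h1 h2 h3 h4 h5 h6 /\ ~ dv (zpow p c.+1) h1 h2 h3 h4 h5 h6.
  apply: Classical_Prop.NNPP => n; apply: nQc => h1 h2 h3 h4 h5 h6 k.
  by apply: Classical_Prop.NNPP => nd; apply: n; exists h1, h2, h3, h4, h5, h6.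
have /ab[k1 [k2 [k3 [k4 [k5 [k6 [[E1 E2 E3 [E4 E5 E6]] kb]]]]]]] := kh.
have prim : exists h1 h2 h3 h4 h5 h6, Kx b h1 h2 h3 h4 h5 h6 /\ ~ dv (Z.of_nat p) h1 h2 h3 h4 h5 h6.
  exists k1, k2, k3, k4, k5, k6; split=> // -[c1 c2 c3 [c4 c5 c6]]; apply: nd.
  have D k : Z.divide (Z.of_nat p) k -> Z.divide (zpow p c.+1) (zpow p c * k).
    move=> dk; rewrite zpowS; exact: Z.mul_divide_mono_l.
  by rewrite E1 E2 E3 E4 E5 E6; split; last split; apply: D.
have bkill h1' h2' h3' h4' h5' h6' : Kx b (zpow p e * h1') (zpow p e * h2') (zpow p e * h3')
     (zpow p e * h4') (zpow p e * h5') (zpow p e * h6').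
  by rewrite /Kx phi_scale [phi a _]Kkill mul0rn.
have i1 : invariant b rho1 := invariant_scale inv1.
have i2 : invariant b rho2 := invariant_scale inv2.
have tr P : (forall h1 h2 h3 h4 h5 h6, Kx b h1 h2 h3 h4 h5 h6 <-> P h1 h2 h3 h4 h5 h6) ->
    Kform a (zpow p c) P.
  move=> bP x1 x2 x3 x4 x5 x6; rewrite ab.
  by split=> -[y1 [y2 [y3 [y4 [y5 [y6 [? /bP ?]]]]]]]; exists y1, y2, y3, y4, y5, y6.
exists c; have [op|ep] := boolP (odd p).
  left; split=> //; have [m [l [rt bP]]] := odd_kernel i1 i2 pp bkill prim op.
  by exists m, l; split=> //; apply: tr.
have p2 : p = 2%N by case/even_prime: pp => // o; rewrite o in ep.
right; split=> //; rewrite p2 in tr *.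
case: (small_kernel (two_kernel i1 i2 pp bkill prim p2)) => [h|[x [y [xy h]]]|h].
- by constructor 1; apply: tr.
- by constructor 2; exists x, y; split=> //; apply: tr.
by constructor 3; apply: tr.
Qed.

(** * The coverings of the list *)

Section Components.
Variables (I : finType) (B : I -> finZmodType).

Lemma dprodzM (f : dprodz B) z i : (f *~ z) i = f i *~ z.
Proof.
have en n : (f *+ n) i = f i *+ n.
  elim: n => [|n IH]; first by rewrite !mulr0n ffunE.
  by rewrite !mulrS [LHS]ffunE IH.
by case: z => n; rewrite ?NegzE ?mulrNz -!pmulrn ?[LHS]ffunE en.
Qed.

End Components.

(** A component of the voltage before its reduction modulo the corresponding factor; [icz] is the
    same over [Z]. *)
Fixpoint icomp (s : seq (seq int)) (h : seq Z) (i : nat) : int :=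
  match s, h with x :: s', z :: h' => nth 0 x i * iz z + icomp s' h' i | _, _ => 0 end.

Fixpoint icz (s : seq (seq Z)) (h : seq Z) (i : nat) : Z :=
  match s, h with
  | x :: s', z :: h' => (nth 0%ZZ x i * z + icz s' h' i)%ZZ
  | _, _ => 0%ZZ
  end.

Lemma phil_vec (m : seq nat) (s : seq (seq int)) h (i : 'I_(size m)) :
  (phil [seq vec m x | x <- s] h) i = (icomp s h i)%:~R.
Proof.
elim: s h => [|x s IH] [|z h] /=; rewrite ?ffunE //.
by rewrite dprodzM IH ffunE -mulrzr -intrM intrD.
Qed.

Lemma ziD x y : Z_of_int (x + y) = (Z_of_int x + Z_of_int y)%ZZ.
Proof. exact: (rmorphD Z_of_int). Qed.

Lemma ziM x y : Z_of_int (x * y) = (Z_of_int x * Z_of_int y)%ZZ.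
Proof. exact: (rmorphM Z_of_int). Qed.

Lemma ziN x : Z_of_int (- x) = (- Z_of_int x)%ZZ.
Proof. exact: (rmorphN Z_of_int). Qed.

Lemma zi_icomp s h i : Z_of_int (icomp s h i) = icz [seq map Z_of_int x | x <- s] h i.
Proof.
elim: s h => [|x s IH] [|z h] //=.
rewrite ziD ziM IH /iz int_of_ZK; congr (_ * _ + _)%ZZ.
have [li|li] := ltnP i (size x); first by rewrite (nth_map 0).
by rewrite !nth_default ?size_map.
Qed.

Lemma dvdn_Z n k : (n %| k)%N <-> Z.divide (Z.of_nat n) (Z.of_nat k).
Proof.
split=> [/dvdnP[q ->]|[q e]]; first by exists (Z.of_nat q); lia.
case: n e => [|n] e; first by rewrite (_ : k = 0%N) //; lia.
by apply/dvdnP; exists (Z.to_nat q); nia.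
Qed.

Lemma Zp_int_eq0 n (z : int) : (1 < n)%N ->
  (z%:~R = 0 :> 'Z_n) <-> Z.divide (Z.of_nat n) (Z_of_int z).
Proof.
move=> n1; have nat0 k : (k%:R = 0 :> 'Z_n) <-> Z.divide (Z.of_nat n) (Z.of_nat k).
  rewrite -dvdn_Z; split=> [/(congr1 val)|/eqP k0].
    by rewrite /= val_Zp_nat // => /eqP.
  by apply: val_inj; rewrite /= val_Zp_nat // k0.
case: z => k; first by rewrite -pmulrn; apply: nat0.
rewrite NegzE mulrNz -pmulrn ziN; split.
  by move/eqP; rewrite oppr_eq0 => /eqP/nat0 h; apply/Z.divide_opp_r.
by move/Z.divide_opp_r/nat0 => ->; rewrite oppr0.
Qed.

Section Xkernel.
Variables (m : seq nat) (t : 6.-tuple (seq int)) (r : seq (seq Z)).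
Hypotheses (m1 : all (leq 2) m) (tr : [seq map Z_of_int x | x <- t] = r).
Local Notation xt := (map_tuple (vec m) t).

Lemma m1i (i : 'I_(size m)) : (1 < nth 0%N m i)%N.
Proof. by have /allP := m1; apply; apply: mem_nth. Qed.

Lemma phi_X h (i : 'I_(size m)) : phi xt h i = (icomp t h i)%:~R.
Proof. exact: phil_vec. Qed.

Lemma phi_X0 h : phi xt h = 0 <->
  forall i, (i < size m)%N -> Z.divide (Z.of_nat (nth 0%N m i)) (icz r h i).
Proof.
rewrite -tr; split=> [e i li|e].
  have := congr1 (fun f : Zprod m => f (Ordinal li)) e; rewrite phi_X ffunE.
  by move/(Zp_int_eq0 _ (m1i (Ordinal li))); rewrite zi_icomp.
apply/ffunP=> i; rewrite phi_X ffunE; apply/(Zp_int_eq0 _ (m1i i)).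
by rewrite zi_icomp; apply: e.
Qed.

(** [T] stands for integer representatives of the components of the element to be reached. *)
Lemma phi_X_surj : (forall T : nat -> Z, exists h1 h2 h3 h4 h5 h6, forall i, (i < size m)%N ->
    Z.divide (Z.of_nat (nth 0%N m i)) (icz r (V6 h1 h2 h3 h4 h5 h6) i - T i)) -> phi_surj xt.
Proof.
move=> H y; pose T i := if (insub i : option 'I_(size m)) is Some j
  then Z.of_nat (y j : 'Z_(nth 0%N m j)) else 0%ZZ.
have [h1 [h2 [h3 [h4 [h5 [h6 e]]]]]] := H T; exists (V6 h1 h2 h3 h4 h5 h6).
apply/andP; split=> //; apply/eqP/ffunP=> i; rewrite phi_X.
have := e i (ltn_ord i); rewrite /T valK -tr -zi_icomp.
rewrite -[Z.of_nat (nat_of_ord (y i))]/(Z_of_int (Posz (y i))) -[(_ - _)%ZZ]/(_ + _)%ZZ.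
rewrite -ziN -ziD.
move/(Zp_int_eq0 _ (m1i i)); rewrite intrD mulrNz.
by rewrite -pmulrn natr_Zp => /eqP; rewrite subr_eq0 => /eqP.
Qed.

End Xkernel.

Lemma card_Zprod (m : seq nat) : all (leq 2) m -> #|Zprod m| = (\prod_(i <- m) i)%N.
Proof.
move=> /allP m1; rewrite card_dep_ffun foldrE big_map big_enum /=.
rewrite (big_nth 0%N) big_mkord; apply: eq_bigr => i _.
by rewrite card_ord Zp_cast // m1 // mem_nth.
Qed.

(** [X] returns a covering, which no longer shows its moduli and voltages; [Xm] and [Xs] keep them
    accessible for uniform arguments. *)
Definition Xm (n : Xname) : seq nat :=
  match n with
  | X_2_1 | X'_2_1 => [:: 2]
  | X_2_2 => nseq 2 2
  | X_5_3 => nseq 3 5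
  | X_p_3 p _ _ => nseq 3 p
  | X_p_6 p => nseq 6 p
  | Xk1_2_6 k | X'k1_2_6 k => (2 ^ k) :: nseq 5 (2 ^ k.-1)
  | Xk2_2_6 k => nseq 2 (2 ^ k) ++ nseq 4 (2 ^ k.-1)
  | Xk3_p_3 k p _ _ => nseq 3 (p ^ k)
  | Xk3_5_6 k => nseq 3 (5 ^ k) ++ nseq 3 (5 ^ k.-1)
  | Xkc3_p_6 k c p _ _ => nseq 3 (p ^ k) ++ nseq 3 (p ^ c)
  | Xk6_p_6 k p => nseq 6 (p ^ k)
  end%N.

Definition Xs (n : Xname) : 6.-tuple (seq int) :=
  match n with
  | X_2_1 => [tuple [:: 1]; [:: 1]; [:: 1]; [:: 1]; [:: 1]; [:: 1]]
  | X'_2_1 => [tuple [:: 1]; [:: 0]; [:: 1]; [:: 0]; [:: 1]; [:: 0]]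
  | X_2_2 => [tuple [:: 1; 0]; [:: 0; 1]; [:: 1; 0]; [:: 0; 1]; [:: 1; 0]; [:: 0; 1]]
  | X_5_3 => [tuple [:: 1; 0; 0]; [:: 1; 3; 4]; [:: 0; 0; 1];
             [:: 3; 1; 1]; [:: 0; 1; 0]; [:: 1; 4; 3]]
  | X_p_3 p l l' => [tuple [:: 1; 0; 0]; [:: 1; l%:Z; -1]; [:: 0; 0; 1];
             [:: l%:Z; 1; 1]; [:: 0; 1; 0]; [:: 1; -1; l%:Z]]
  | X_p_6 p => [tuple [:: 1; 0; 0; 0; 0; 0]; [:: 0; 0; 0; 0; 0; 1];
             [:: 0; 0; 0; 0; 1; 0]; [:: 0; 0; 0; 1; 0; 0];
             [:: 0; 0; 1; 0; 0; 0]; [:: 0; 1; 0; 0; 0; 0]]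
  | Xk1_2_6 k => [tuple [:: -1; 0; 0; 0; 0; 1]; [:: -1; 0; 0; 0; 1; 0];
             [:: -1; 0; 0; 1; 0; 0]; [:: -1; 0; 1; 1; 0; 0];
             [:: -1; 1; 0; 0; 0; 0]; [:: 1; 0; 0; 0; 0; 0]]
  | X'k1_2_6 k => [tuple [:: 0; 0; 0; 0; 0; 1]; [:: -1; 0; 0; 0; 1; 0];
             [:: 0; 0; 0; 1; 0; 0]; [:: -1; 0; 1; 0; 0; 0];
             [:: 0; 1; 0; 0; 0; 0]; [:: 1; 0; 0; 0; 0; 0]]
  | Xk2_2_6 k => [tuple [:: 0; 1; 0; 0; 0; 1]; [:: 1; 0; 0; 0; 1; 0];
             [:: 0; 1; 0; 1; 0; 0]; [:: 1; 0; 1; 0; 0; 0];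
             [:: 0; 1; 0; 0; 0; 0]; [:: 1; 0; 0; 0; 0; 0]]
  | Xk3_p_3 k p l l' => [tuple [:: 0; 0; 1]; [:: 0; 1; 0];
             [:: 1; - l'%:Z; - l%:Z]; [:: l%:Z; l%:Z; - l%:Z];
             [:: - l'%:Z; 1; - l%:Z]; [:: 1; 0; 0]]
  | Xk3_5_6 k => [tuple [:: 0; 0; 1; 0; 0; 0]; [:: 0; 1; 0; 0; 0; 0];
             [:: 1; 2; 2; 0; 0; 1]; [:: 3; 3; 2; 0; 1; 0];
             [:: 2; 1; 2; 1; 0; 0]; [:: 1; 0; 0; 0; 0; 0]]
  | Xkc3_p_6 k c p l l' => [tuple [:: 0; 0; 1; 0; 0; 0]; [:: 0; 1; 0; 0; 0; 0];
             [:: 1; - l'%:Z; - l%:Z; 0; 0; 1];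
             [:: l%:Z; l%:Z; - l%:Z; 0; 1; 0];
             [:: - l'%:Z; 1; - l%:Z; 1; 0; 0]; [:: 1; 0; 0; 0; 0; 0]]
  | Xk6_p_6 k p => [tuple [:: 1; 0; 0; 0; 0; 0]; [:: 0; 1; 0; 0; 0; 0];
             [:: 0; 0; 1; 0; 0; 0]; [:: 0; 0; 0; 1; 0; 0];
             [:: 0; 0; 0; 0; 1; 0]; [:: 0; 0; 0; 0; 0; 1]]
  end.

Definition Xt (n : Xname) : 6.-tuple (Zprod (Xm n)) := map_tuple (vec (Xm n)) (Xs n).

Lemma XE n : X n = vcover (reduced (Xt n)).
Proof. by case: n. Qed.

Lemma listed_Xm n : listed n -> all (leq 2) (Xm n).
Proof.
have pw q j : (1 < q)%N -> (0 < j)%N -> (1 < q ^ j)%N.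
  by move=> q1 j0; rewrite -[1%N](exp1n j) ltn_exp2r.
case: n => [||||p l l'|p|k|k|k|k p l l'|k|k c p l l'|k p] //=.
- by case/andP=> /andP[/prime_gt1 -> _].
- by move/prime_gt1=> ->.
- by move=> k1; rewrite !pw //; lia.
- by move=> k1; rewrite !pw //; lia.
- by move=> k1; rewrite !pw //; lia.
- by case/and3P=> k1 /andP[/prime_gt1 p1 _] _; rewrite !pw //; lia.
- by move=> k1; rewrite !pw //; lia.
- by case/and4P=> k1 /andP[c1 ck] /andP[/prime_gt1 p1 _] _; rewrite !pw //; lia.
by case/andP=> k1 /prime_gt1 p1; rewrite !pw //; lia.
Qed.

Definition Xr (n : Xname) : seq (seq Z) := [seq map Z_of_int x | x <- Xs n].

Lemma zi_opp n : Z_of_int (- n%:Z) = (- Z.of_nat n)%ZZ.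
Proof. exact: (rmorphN Z_of_int). Qed.

Lemma X_surj n : listed n -> phi_surj (Xt n).
Proof.
move=> ln; apply: (phi_X_surj (listed_Xm ln) (erefl (Xr n))) => T.
have fin (d x y : Z) : x = y -> Z.divide d (x - y) by move=> ->; exists 0%ZZ; lia.
case: n ln => [||||p l l'|p|k|k|k|k p l l'|k|k c p l l'|k p] _; rewrite /Xr /= ?zi_opp.
- exists (T 0%N), 0, 0, 0, 0, 0%ZZ; case=> [|i] //= _; apply: fin; lia.
- exists (T 0%N), 0, 0, 0, 0, 0%ZZ; case=> [|i] //= _; apply: fin; lia.
- exists (T 0%N), (T 1%N), 0, 0, 0, 0%ZZ; case=> [|[|i]] //= _; apply: fin; lia.
- exists (T 0%N), 0, (T 2%N), 0, (T 1%N), 0%ZZ; case=> [|[|[|i]]] //= _; apply: fin; lia.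
- exists (T 0%N), 0, (T 2%N), 0, (T 1%N), 0%ZZ; case=> [|[|[|i]]] //= _; apply: fin; lia.
- exists (T 0%N), (T 5%N), (T 4%N), (T 3%N), (T 2%N), (T 1%N).
  by case=> [|[|[|[|[|[|i]]]]]] //= _; apply: fin; lia.
- exists (T 5%N), (T 4%N), (T 3%N - T 2%N)%ZZ, (T 2%N), (T 1%N),
    (T 0%N + T 5%N + T 4%N + T 3%N + T 1%N)%ZZ.
  by case=> [|[|[|[|[|[|i]]]]]] //= _; apply: fin; lia.
- exists (T 5%N), (T 4%N), (T 3%N), (T 2%N), (T 1%N), (T 0%N + T 4%N + T 2%N)%ZZ.
  by case=> [|[|[|[|[|[|i]]]]]] //= _; apply: fin; lia.
- exists (T 5%N), (T 4%N), (T 3%N), (T 2%N), (T 1%N - T 5%N - T 3%N)%ZZ, (T 0%N - T 4%N - T 2%N)%ZZ.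
  by case=> [|[|[|[|[|[|i]]]]]] //= _; apply: fin; lia.
- exists (T 2%N), (T 1%N), 0, 0, 0%ZZ, (T 0%N); case=> [|[|[|i]]] //= _; apply: fin; lia.
- exists (T 2%N - 2 * T 5%N - 2 * T 4%N - 2 * T 3%N)%ZZ,
    (T 1%N - 2 * T 5%N - 3 * T 4%N - T 3%N)%ZZ, (T 5%N), (T 4%N), (T 3%N),
    (T 0%N - T 5%N - 3 * T 4%N - 2 * T 3%N)%ZZ.
  by case=> [|[|[|[|[|[|i]]]]]] //= _; apply: fin; lia.
- exists (T 2%N + Z.of_nat l * (T 5%N + T 4%N + T 3%N))%ZZ,
    (T 1%N + Z.of_nat l' * T 5%N - Z.of_nat l * T 4%N - T 3%N)%ZZ, (T 5%N), (T 4%N), (T 3%N),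
    (T 0%N - T 5%N - Z.of_nat l * T 4%N + Z.of_nat l' * T 3%N)%ZZ.
  by case=> [|[|[|[|[|[|i]]]]]] //= _; apply: fin; lia.
exists (T 0%N), (T 1%N), (T 2%N), (T 3%N), (T 4%N), (T 5%N).
by case=> [|[|[|[|[|[|i]]]]]] //= _; apply: fin; lia.
Qed.

(** [X_Kform] shows that the kernel of [X n] is [Xd n] times the lattice [XP n]. The list uses one
    parity for [X'_2_1] and the other for [X'k1_2_6]; [tau] exchanges them. *)
Definition Xd (n : Xname) : Z :=
  match n with
  | X_2_1 | X'_2_1 | X_2_2 => zpow 2 0
  | X_5_3 => zpow 5 0
  | X_p_3 p _ _ | Xk3_p_3 _ p _ _ => zpow p 0
  | X_p_6 p => zpow p 1
  | Xk1_2_6 k | X'k1_2_6 k | Xk2_2_6 k => zpow 2 k.-1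
  | Xk3_5_6 k => zpow 5 k.-1
  | Xkc3_p_6 k c p _ _ => zpow p c
  | Xk6_p_6 k p => zpow p k
  end.

Definition XP (n : Xname) : Z -> Z -> Z -> Z -> Z -> Z -> Prop :=
  match n with
  | X_2_1 | Xk1_2_6 _ => Peven 1 1
  | X'_2_1 => Peven 1 0
  | X'k1_2_6 _ => Peven 0 1
  | X_2_2 | Xk2_2_6 _ => Pboth
  | X_5_3 | Xk3_5_6 _ => PL (zpow 5 1) 3
  | X_p_3 p l _ => PL (zpow p 1) (Z.of_nat l)
  | X_p_6 _ | Xk6_p_6 _ _ => Pall
  | Xk3_p_3 k p l _ => PL (zpow p k) (Z.of_nat l)
  | Xkc3_p_6 k c p l _ => PL (zpow p (k - c)) (Z.of_nat l)
  end.

Lemma not5 p : pm1_prime p -> p <> 5%N /\ odd p.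
Proof.
case/andP=> pp; rewrite !inE => /orP[] /eqP e; split.
- by move=> p5; rewrite p5 in e.
- by rewrite -(odd_mod p (erefl false : odd 10 = false)) e.
- by move=> p5; rewrite p5 in e.
by rewrite -(odd_mod p (erefl false : odd 10 = false)) e.
Qed.

(** p ^ m divides (x - y)(x + y - 1). If p divided both factors it would divide the discriminant
    5. *)
Lemma root_or (p m : nat) (x y : Z) : prime p -> p <> 5%N ->
  Z.divide (zpow p m) (x * x - x - 1) -> Z.divide (zpow p m) (y * y - y - 1) ->
  Z.divide (zpow p m) (x - y) \/ Z.divide (zpow p m) (x + y - 1).
Proof.
case: m => [|m] pp p5 rx ry; first by left; apply: Z.divide_1_l.
have pr : Z.divide (zpow p m.+1) ((x - y) * (x + y - 1)).
  have := Z.divide_sub_r _ _ _ rx ry; congr (Z.divide _ _); ring.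
have pm : Z.divide (Z.of_nat p) (zpow p m.+1) by rewrite zpowS; apply: Z.divide_factor_r.
have [d1|n1] := Znumtheory.Zdivide_dec (Z.of_nat p) (x - y); last first.
  right; have [u [w e]] := zpow_coprime m.+1 pp n1; case: pr => q eq.
  exists (u * q + w * (x + y - 1))%ZZ.
  have t : ((u * (x - y) + w * zpow p m.+1) * (x + y - 1) =
    u * ((x - y) * (x + y - 1)) + w * zpow p m.+1 * (x + y - 1))%ZZ by ring.
  by rewrite e eq in t; lia.
have [d2|n2] := Znumtheory.Zdivide_dec (Z.of_nat p) (x + y - 1); last first.
  left; have [u [w e]] := zpow_coprime m.+1 pp n2; case: pr => q eq.
  exists (u * q + w * (x - y))%ZZ.
  have t : ((u * (x + y - 1) + w * zpow p m.+1) * (x - y) =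
    u * ((x - y) * (x + y - 1)) + w * zpow p m.+1 * (x - y))%ZZ by ring.
  by rewrite e eq in t; lia.
have d5 : Z.divide (Z.of_nat p) 5.
  have d3 := Z.divide_add_r _ _ _ d1 d2.
  have := divide_lin (x - y + (x + y - 1)) (-4) 0 0 d3 (Z.divide_trans _ _ _ pm rx) d3 d3.
  by congr (Z.divide _ _); ring.
case: p5; apply/eqP; rewrite -dvdn_prime2 //; apply/dvdn_Z; exact: d5.
Qed.

Lemma two_rootsP N l l' : (1 < N)%N -> two_roots N l l' ->
  [/\ (l < N)%N, (l' < N)%N, l <> l',
      Z.divide (Z.of_nat N) (Z.of_nat l * Z.of_nat l - Z.of_nat l - 1) &
      Z.divide (Z.of_nat N) (Z.of_nat l' * Z.of_nat l' - Z.of_nat l' - 1)].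
Proof.
move=> N1 /and5P[h1 h2 /eqP h3 h4 h5].
have rt k : (k%:R ^+ 2 - k%:R - 1 == 0 :> 'Z_N) ->
    Z.divide (Z.of_nat N) (Z.of_nat k * Z.of_nat k - Z.of_nat k - 1).
  move=> /eqP e; have : (k%:Z * k%:Z - k%:Z - 1)%:~R = 0 :> 'Z_N.
    by rewrite !intrD !mulrNz intrM -!pmulrn -expr2 -[RHS]e.
  by move/(Zp_int_eq0 _ N1); rewrite !ziD ziM !ziN.
by split=> //; apply: rt.
Qed.

(** Distinct roots below the modulus are not congruent, so [root_or] leaves only their sum. *)
Lemma two_roots_sum p m l l' : pm1_prime p -> (0 < m)%N -> two_roots (p ^ m) l l' ->
  Z.divide (zpow p m) (Z.of_nat l + Z.of_nat l' - 1).
Proof.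
move=> pm m0; have [p5 _] := not5 pm; case/andP: pm => pp _.
have N1 : (1 < p ^ m)%N by rewrite -[1%N](exp1n m) ltn_exp2r // prime_gt1.
case/(two_rootsP N1) => h1 h2 h3 r1 r2.
case: (root_or pp p5 r1 r2) => // -[q eq]; case: h3.
rewrite /zpow in eq; have q0 : q = 0%ZZ by nia.
by rewrite q0 in eq; lia.
Qed.

(* The [h_i] with [i = 3, 4, 5] are divisible by [D], and hence all are. *)
Lemma PL_form (D M l l' h1 h2 h3 h4 h5 h6 : Z) : (0 < D)%ZZ -> Z.divide M (l + l' - 1) ->
  ([/\ Z.divide (D * M) (h3 + l * h4 - l' * h5 + h6),
       Z.divide (D * M) (h2 - l' * h3 + l * h4 + h5),
       Z.divide (D * M) (h1 - l * h3 - l * h4 - l * h5) &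
       [/\ Z.divide D h5, Z.divide D h4 & Z.divide D h3]]) <->
  exists k1 k2 k3 k4 k5 k6,
    ([/\ h1 = D * k1, h2 = D * k2, h3 = D * k3 & [/\ h4 = D * k4, h5 = D * k5 & h6 = D * k6]])%ZZ
    /\ PL M l k1 k2 k3 k4 k5 k6.
Proof.
move=> D0 [s es]; split.
  case=> -[q1 e1] [q2 e2] [q3 e3] [[k5 e5] [k4 e4] [k3 e3']].
  exists (q3 * M + l * k3 + l * k4 + l * k5)%ZZ, (q2 * M + l' * k3 - l * k4 - k5)%ZZ, k3, k4, k5,
    (q1 * M - k3 - l * k4 + l' * k5)%ZZ.
  split; first by split; last split; rewrite e3' e4 e5 in e1 e2 e3 *; lia.
  rewrite /PL /F1 /F2 /F3; split.
  - by exists (q1 + s * k5)%ZZ; have := f_equal (Z.mul k5) es; lia.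
  - by exists (q2 + s * k3)%ZZ; have := f_equal (Z.mul k3) es; lia.
  by exists q3; lia.
move=> [k1 [k2 [k3 [k4 [k5 [k6 [[-> -> -> [-> -> ->]]]]]]]]].
rewrite /PL /F1 /F2 /F3 => -[[q1 e1] [q2 e2] [q3 e3]]; split.
- exists (q1 - s * k5)%ZZ; have f := f_equal (Z.mul (D * k5)) es.
  by have g := f_equal (Z.mul D) e1; lia.
- exists (q2 - s * k3)%ZZ; have f := f_equal (Z.mul (D * k3)) es.
  by have g := f_equal (Z.mul D) e2; lia.
- by exists q3; have g := f_equal (Z.mul D) e3; lia.
by split; [exists k5 | exists k4 | exists k3]; lia.
Qed.

(** X(p,3) and X(5,3) are listed with other voltages than the families with k > 1; by the equation
    of l, each triple of forms is a combination of the other. *)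
Lemma PL_form' (M l h1 h2 h3 h4 h5 h6 : Z) : Z.divide M (l * l - l - 1) ->
  ([/\ Z.divide M (h1 + h2 + l * h4 + h6), Z.divide M (l * h2 + h4 + h5 - h6) &
       Z.divide M (- h2 + h3 + h4 + l * h6)]) <-> PL M l h1 h2 h3 h4 h5 h6.
Proof.
move=> rt; rewrite /PL /F1 /F2 /F3; split=> -[d1 d2 d3]; split.
- have := divide_lin (l - 1) 1 0 (- h2) d2 d3 d1 rt; congr (Z.divide _ _); ring.
- have := divide_lin 1 (l - 1) 0 (- h6) d2 d3 d1 rt; congr (Z.divide _ _); ring.
- have := divide_lin 1 (- l) (- l) (h2 + h6) d1 d2 d3 rt; congr (Z.divide _ _); ring.
- have := divide_lin 1 1 1 0 d1 d2 d3 rt; congr (Z.divide _ _); ring.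
- have := divide_lin (-1) l 0 (- (h3 + h4)) d1 d2 d3 rt; congr (Z.divide _ _); ring.
- have := divide_lin l (-1) 0 (- (h4 + h5)) d1 d2 d3 rt; congr (Z.divide _ _); ring.
Qed.

Lemma forall_lt (n : nat) (P : nat -> Prop) :
  (forall i, (i < n.+1)%N -> P i) <-> P 0%N /\ (forall i, (i < n)%N -> P i.+1).
Proof.
split=> [h|[h0 h] [|i] li]; [by split=> [|i li]; apply: h | by [] | exact: h].
Qed.

Lemma forall_lt0 (P : nat -> Prop) : (forall i, (i < 0)%N -> P i) <-> True.
Proof. by split. Qed.

Lemma X_Kform n : listed n -> Kform (Xt n) (Xd n) (XP n).
Proof.
move=> ln h1 h2 h3 h4 h5 h6; rewrite /Kx (phi_X0 (listed_Xm ln) (erefl (Xr n))).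
have z1 p : zpow p 0 = 1%ZZ by [].
have un P : (exists k1 k2 k3 k4 k5 k6, ([/\ h1 = 1 * k1, h2 = 1 * k2, h3 = 1 * k3 &
    [/\ h4 = 1 * k4, h5 = 1 * k5 & h6 = 1 * k6]])%ZZ /\ P k1 k2 k3 k4 k5 k6) <-> P h1 h2 h3 h4 h5 h6.
  split=> [[k1 [k2 [k3 [k4 [k5 [k6 [[-> -> -> [-> -> ->]]]]]]]]]|k].
    by rewrite !Z.mul_1_l.
  by exists h1, h2, h3, h4, h5, h6; split=> //; split; last split; rewrite Z.mul_1_l.
have eqd (d x y : Z) : Z.divide d x -> x = y -> Z.divide d y by move=> + <-.
have p2 k : (1 < k)%N -> zpow 2 k = (zpow 2 k.-1 * 2)%ZZ.
  by move=> k1; rewrite -{1}(prednK (ltnW k1)) zpowS.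
have p5 k : (1 < k)%N -> zpow 5 k = (zpow 5 k.-1 * 5)%ZZ.
  by move=> k1; rewrite -{1}(prednK (ltnW k1)) zpowS.
case: n ln => [||||p l l'|p|k|k|k|k p l l'|k|k c p l l'|k p] ln;
  rewrite /Xr /= ?zi_opp !forall_lt forall_lt0 /= -?/(zpow _ _).
- rewrite z1 un /Peven; split=> [[[q e] _]|[q e]]; last (split=> //); exists q; lia.
- rewrite z1 un /Peven; split=> [[[q e] _]|[q e]]; last (split=> //); exists q; lia.
- rewrite z1 un /Pboth; split=> [[[q e] [[r e'] _]]|[[q e] [r e']]].
    by split; [exists q | exists r]; lia.
  by split; [exists q; lia | split=> //; exists r; lia].
- rewrite z1 un -PL_form'; last by exists 1%ZZ.
  (* The listed entry 4 stands for -1 modulo 5, whence the corrections by [h6] and [h2]. *)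
  split=> [[[q e] [[r e'] [[s e''] _]]]|[[q e] [r e'] [s e'']]].
    by split; [exists q | exists (r - h6)%ZZ | exists (s - h2)%ZZ]; rewrite /zpow /=; lia.
  rewrite /zpow /= in e e' e''.
  by split; [exists q; lia | split; [exists (r + h6)%ZZ; lia | split=> //; exists (s + h2)%ZZ; lia]].
- case/andP: ln => pm rt; case/andP: (pm) => pp _.
  have [_ _ _ r1 _] := two_rootsP (prime_gt1 pp) rt.
  rewrite z1 un -PL_form' /zpow expn1 //.
  split=> [[[q e] [[r e'] [[s e''] _]]]|[[q e] [r e'] [s e'']]].
    by split; [exists q | exists r | exists s]; lia.
  by split; [exists q; lia | split; [exists r; lia | split=> //; exists s; lia]].
- rewrite /zpow expn1; split=> [[[q1 e1] [[q2 e2] [[q3 e3] [[q4 e4] [[q5 e5] [[q6 e6] _]]]]]]|].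
    by exists q1, q6, q5, q4, q3, q2; split=> //; split; last split; lia.
  case=> k1 [k2 [k3 [k4 [k5 [k6 [[-> -> -> [-> -> ->]] _]]]]]].
  by do !split; [exists k1|exists k6|exists k5|exists k4|exists k3|exists k2]; lia.
- rewrite p2 //; have := zpow_gt0 k.-1 (isT : prime 2); move: (zpow 2 k.-1) => D D0; split.
    case=> -[q1 e1] [[q2 e2] [[q3 e3] [[q4 e4] [[q5 e5] [[q6 e6] _]]]]].
    exists q6, q5, (q4 - q3)%ZZ, q3, q2, (2 * q1 + q6 + q5 + q4 + q2)%ZZ.
    split; first by split; last split; lia.
    by rewrite /Peven; exists (q1 + q6 + q5 + q4 + q2)%ZZ; lia.
  case=> k1 [k2 [k3 [k4 [k5 [k6 [[-> -> -> [-> -> ->]] [q e]]]]]]].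
  have f := f_equal (Z.mul D) e.
  split; first by exists (q - k1 - k2 - k3 - k4 - k5)%ZZ; lia.
  by do !split; [exists k5|exists k4|exists (k3 + k4)%ZZ|exists k2|exists k1]; lia.
- rewrite p2 //; have := zpow_gt0 k.-1 (isT : prime 2); move: (zpow 2 k.-1) => D D0; split.
    case=> -[q1 e1] [[q2 e2] [[q3 e3] [[q4 e4] [[q5 e5] [[q6 e6] _]]]]].
    exists q6, q5, q4, q3, q2, (2 * q1 + q5 + q3)%ZZ.
    split; first by split; last split; lia.
    by rewrite /Peven; exists (q1 + q5 + q3)%ZZ; lia.
  case=> k1 [k2 [k3 [k4 [k5 [k6 [[-> -> -> [-> -> ->]] [q e]]]]]]].
  have f := f_equal (Z.mul D) e.
  split; first by exists (q - k2 - k4)%ZZ; lia.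
  by do !split; [exists k5|exists k4|exists k3|exists k2|exists k1]; lia.
- rewrite p2 //; have := zpow_gt0 k.-1 (isT : prime 2); move: (zpow 2 k.-1) => D D0; split.
    case=> -[q1 e1] [[q2 e2] [[q3 e3] [[q4 e4] [[q5 e5] [[q6 e6] _]]]]].
    exists q6, q5, q4, q3, (2 * q2 - q6 - q4)%ZZ, (2 * q1 - q5 - q3)%ZZ.
    split; first by split; last split; lia.
    by split; [exists q2 | exists q1]; lia.
  case=> k1 [k2 [k3 [k4 [k5 [k6 [[-> -> -> [-> -> ->]] [[q e] [q' e']]]]]]]].
  have f := f_equal (Z.mul D) e; have f' := f_equal (Z.mul D) e'.
  split; first by exists q'; lia.
  by do !split; [exists q|exists k4|exists k3|exists k2|exists k1]; lia.
- case/and3P: ln => k1 pm rt; have k0 : (0 < k)%N by lia.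
  have sm := two_roots_sum pm k0 rt.
  rewrite -(PL_form _ _ _ _ _ _ (zpow_gt0 0 (proj1 (andP pm))) sm) z1 !Z.mul_1_l.
  split=> [[d1 [d2 [d3 _]]]|[d1 d2 d3 _]]; last first.
    split; first by apply: eqd d1 _; lia.
    split; first by apply: eqd d2 _; lia.
    by split=> //; apply: eqd d3 _; lia.
  split; last by split; apply: Z.divide_1_l.
  - by apply: eqd d1 _; lia.
  - by apply: eqd d2 _; lia.
  by apply: eqd d3 _; lia.
(* At 5 both roots are 3, and the listed entry 2 stands for -3. *)
- have sm : Z.divide (zpow 5 1) (3 + 3 - 1) by exists 1%ZZ.
  rewrite -(PL_form _ _ _ _ _ _ (zpow_gt0 k.-1 (isT : prime 5)) sm) p5 //.
  have := zpow_gt0 k.-1 (isT : prime 5); rewrite /zpow expn1 -/(zpow _ _).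
  move: (zpow 5 k.-1) => D D0; split.
    case=> -[q1 e1] [[q2 e2] [[q3 e3] [[q4 e4] [[q5 e5] [[q6 e6] _]]]]].
    split; last by split; [exists q4|exists q5|exists q6]; lia.
    - by exists (q1 - q4)%ZZ; lia.
    - by exists (q2 - q6)%ZZ; lia.
    by exists (q3 - q6 - q5 - q4)%ZZ; lia.
  case=> -[q1 e1] [q2 e2] [q3 e3] [[q4 e4] [q5 e5] [q6 e6]].
  split; first by exists (q1 + q4)%ZZ; lia.
  split; first by exists (q2 + q6)%ZZ; lia.
  split; first by exists (q3 + q6 + q5 + q4)%ZZ; lia.
  by do !split; [exists q4|exists q5|exists q6]; lia.
- case/and4P: ln => k1 /andP[c1 ck] pm rt; have k0 : (0 < k - c)%N by lia.
  have sm := two_roots_sum pm k0 rt.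
  rewrite -(PL_form _ _ _ _ _ _ (zpow_gt0 c (proj1 (andP pm))) sm) -zpowD subnKC; last by lia.
  split=> [[d1 [d2 [d3 [d4 [d5 [d6 _]]]]]]|[d1 d2 d3 [d4 d5 d6]]].
    split; last by split; [apply: eqd d4 _|apply: eqd d5 _|apply: eqd d6 _]; lia.
    - by apply: eqd d1 _; lia.
    - by apply: eqd d2 _; lia.
    by apply: eqd d3 _; lia.
  split; first by apply: eqd d1 _; lia.
  split; first by apply: eqd d2 _; lia.
  split; first by apply: eqd d3 _; lia.
  split; first by apply: eqd d4 _; lia.
  split; first by apply: eqd d5 _; lia.
  by split=> //; apply: eqd d6 _; lia.
split=> [[[q1 e1] [[q2 e2] [[q3 e3] [[q4 e4] [[q5 e5] [[q6 e6] _]]]]]]|].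
  by exists q1, q2, q3, q4, q5, q6; split=> //; split; last split; lia.
case=> k1 [k2 [k3 [k4 [k5 [k6 [[-> -> -> [-> -> ->]] _]]]]]].
by do !split; [exists k1|exists k2|exists k3|exists k4|exists k5|exists k6]; lia.
Qed.

(** * Abelian regular coverings are voltage coverings *)

Section Transport.

Lemma cov_iso_sym (G : sgraph) (C D : covering G) : cov_iso C D -> cov_iso D C.
Proof.
move=> [al alA [f [[g fK gK] fadj fc]]]; exists al^-1%g; first exact: autV.
exists g; split; first by exists f.
  by move=> x y; rewrite -fadj !gK.
by move=> x; rewrite -{1}(gK x) -fc permK.
Qed.

Lemma cov_iso_trans (G : sgraph) (C D E : covering G) :
  cov_iso C D -> cov_iso D E -> cov_iso C E.
Proof.
move=> [al alA [f [fb fadj fc]]] [be beA [g [gb gadj gc]]].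
exists (al * be)%g; first exact: autM.
exists (g \o f); split; first exact: bij_comp.
  by move=> x y; rewrite /= gadj fadj.
by move=> x; rewrite permM fc gc.
Qed.

Variables (G H : sgraph) (f : G -> H).
Hypotheses (fb : bijective f) (fadj : forall x y, adj (f x) (f y) = adj x y).

Lemma iso_connected : connected G -> connected H.
Proof.
case: fb => g fK gK conn x y; have /connectP[p + e] := conn (g x) (g y).
move=> hp; apply/connectP; exists (map f p); last by rewrite -{1}(gK x) last_map -e gK.
rewrite -{1}(gK x) path_map; apply: sub_path hp => u v; by rewrite /= fadj.
Qed.

Lemma iso_sarc_transitive n : s_arc_transitive n G -> s_arc_transitive n H.
Proof.
case: fb => g fK gK tr w w' [a1 b1] [a2 b2].
have gadj x y : adj (g x) (g y) = adj x y by rewrite -fadj !gK.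
have ginj : injective g by apply: can_inj gK.
have mk (u : 'I_n.+1 -> H) : is_sarc u -> is_sarc (g \o u).
  by case=> h1 h2; split=> i j e /=; rewrite ?gadj; [exact: h1 | move/ginj; exact: h2].
have [k kA hk] := tr _ _ (mk w (conj a1 b1)) (mk w' (conj a2 b2)).
have qinj : injective (fun x => f (k (g x))).
  by move=> x y /(can_inj fK)/perm_inj/ginj.
exists (perm qinj).
  by apply/aut1P=> x y; rewrite !permE fadj (aut1P _ kA) gadj.
by move=> i; rewrite permE; have /= -> := hk i; rewrite gK.
Qed.

End Transport.

(** The proof of commutativity is a parameter of the type, so that an additive structure can be
    attached to it. *)
Definition zsub (gT : finGroupType) (G : {group gT}) (cG : abelian G) : Type := [subg G].

Section Zsub.
Variables (gT : finGroupType) (G : {group gT}) (cG : abelian G).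
Local Notation T := (zsub cG).

HB.instance Definition _ := Finite.on T.

Definition zsub_add (x y : T) : T := ((x : [subg G]) * (y : [subg G]))%g.
Definition zsub_zero : T := (1 : [subg G])%g.
Definition zsub_opp (x : T) : T := ((x : [subg G])^-1)%g.

Fact zsub_addA : associative zsub_add. Proof. exact: mulgA. Qed.
Fact zsub_add0 : left_id zsub_zero zsub_add. Proof. exact: mul1g. Qed.
Fact zsub_addN : left_inverse zsub_zero zsub_opp zsub_add. Proof. exact: mulVg. Qed.
Fact zsub_addC : commutative zsub_add.
Proof.
move=> x y; apply: val_inj; rewrite /=.
by have /centsP h := cG; apply: h; apply: subgP.
Qed.

HB.instance Definition _ := GRing.isZmodule.Build T zsub_addA zsub_addC zsub_add0 zsub_addN.

End Zsub.

Section Regular.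
Variable C : covering petersen.
Hypothesis reg : abelian_regular C.

Lemma cov_transP (s : {perm C}) : reflect
  (s \in Defs.aut C /\ forall x, cmap C (s x) = cmap C x) (s \in cov_trans C).
Proof.
apply: (iffP setIdP) => -[h1 h2]; split=> //.
  by move=> x; apply/eqP/(forallP h2).
by apply/forallP=> x; apply/eqP.
Qed.

Lemma cov_trans_group : group_set (cov_trans C).
Proof.
apply/group_setP; split.
  by apply/cov_transP; split=> [|x]; [exact: aut_id | rewrite perm1].
move=> s t /cov_transP[sA sc] /cov_transP[tA tc]; apply/cov_transP; split.
  exact: autM.
by move=> x; rewrite permM tc sc.
Qed.

Definition ctg : {group {perm C}} := Group cov_trans_group.

Lemma ctg_abelian : abelian ctg. Proof. by case: reg. Qed.

Definition CA : finZmodType := zsub ctg_abelian.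

Definition cact (g : CA) (x : C) : C := (sgval (g : [subg ctg]) : {perm C}) x.

Lemma cactP (g : CA) : sgval (g : [subg ctg]) \in cov_trans C.
Proof. exact: subgP. Qed.

Lemma cactD (g h : CA) x : cact (g + h) x = cact h (cact g x).
Proof. by rewrite /cact -permM. Qed.

Lemma cact0 x : cact 0 x = x.
Proof. by rewrite /cact /= perm1. Qed.

Lemma cactNK (g : CA) x : cact (- g) (cact g x) = x.
Proof. by rewrite -cactD subrr cact0. Qed.

Lemma cact_adj (g : CA) x y : adj (cact g x) (cact g y) = adj x y.
Proof. by have /cov_transP[/aut1P h _] := cactP g; apply: h. Qed.

Lemma cact_map (g : CA) x : cmap C (cact g x) = cmap C x.
Proof. by have /cov_transP[_ h] := cactP g; apply: h. Qed.

Lemma cact_ex x y : cmap C x = cmap C y -> exists g, cact g x == y.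
Proof.
case: reg => rg _ /rg[s [[sc sxy] _]]; exists (subg ctg s : CA).
by rewrite /cact subgK // sxy.
Qed.

Lemma cact_inj g h x : cact g x = cact h x -> g = h.
Proof.
move=> e; case: reg => rg _.
have [s [_ u]] := rg x (cact g x) (esym (cact_map g x)).
apply: val_inj; rewrite -[val g]u; last by split=> //; exact: cactP.
by apply: u; split; [exact: cactP | rewrite e].
Qed.

Definition lft (x : C) (v : pt) : C :=
  odflt x [pick y | adj x y && (cmap C y == vx v)].

Lemma lftP x v : adj (cmap C x) (vx v) -> adj x (lft x v) /\ cmap C (lft x v) = vx v.
Proof.
move=> xv; rewrite /lft; case: pickP => [y /andP[h /eqP //]|n].
by have [y [[h1 h2] _]] := cmap_lift xv; have := n y; rewrite h1 h2 eqxx.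
Qed.

Lemma lft_uniq x y y' : adj x y -> adj x y' -> cmap C y = cmap C y' -> y = y'.
Proof.
move=> xy xy' e; have [z [_ u]] := cmap_lift (cmap_hom xy).
by rewrite -(u y) // (u y').
Qed.

Variable x0 : C.
Hypothesis x0E : cmap C x0 = vx p0.

(** The lift of the spanning tree through [x0]; it chooses the origin of each fibre, which makes the
    voltages T-reduced. *)
Definition sec (v : pt) : C := foldl lft x0 (tpath v).

Lemma sec_tree u v : adjp u v -> (forall w, sec w = foldl lft x0 (tpath w)) ->
  tpath v = rcons (tpath u) v -> cmap C (sec u) = vx u ->
  adj (sec u) (sec v) /\ cmap C (sec v) = vx v.
Proof.
move=> uv sE tv cu; rewrite (sE v) tv -cats1 foldl_cat /= -sE.
by apply: lftP; rewrite cu adj_vx.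
Qed.

Lemma sec_map v : cmap C (sec v) = vx v.
Proof.
have h0 : cmap C (sec p0) = vx p0 by exact: x0E.
have st u w : adjp u w -> tpath w = rcons (tpath u) w -> cmap C (sec u) = vx u ->
    cmap C (sec w) = vx w by move=> uw tw cu; have [] := sec_tree uw (fun w => erefl _) tw cu.
have h1 : cmap C (sec p1) = vx p1 by apply: (st p0).
have h2 : cmap C (sec p2) = vx p2 by apply: (st p0).
have h3 : cmap C (sec p3) = vx p3 by apply: (st p0).
by case: v => //; [apply: (st p1)|apply: (st p1)|apply: (st p2)|apply: (st p2)|
  apply: (st p3)|apply: (st p3)].
Qed.

Lemma cot_ex (u v : pt) : exists g, (cact g (sec v) == lft (sec u) v) || ~~ adjp u v.
Proof.
have [uv|_] := boolP (adjp u v); last by exists 0; rewrite orbT.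
have [_ e] := @lftP (sec u) v (etrans (congr1 (adj^~ _) (sec_map u)) (etrans (adj_vx _ _) uv)).
by have [|g ge] := @cact_ex (sec v) (lft (sec u) v); [rewrite e sec_map | exists g; rewrite ge].
Qed.

Definition ca (u v : pt) : CA := xchoose (cot_ex u v).

Lemma ca_adj u v : adjp u v -> adj (sec u) (cact (ca u v) (sec v)).
Proof.
move=> uv; rewrite /ca; have /orP[/eqP->|] := xchooseP (cot_ex u v); last by move/negP/(_ uv).
by have [] := @lftP (sec u) v (etrans (congr1 (adj^~ _) (sec_map u)) (etrans (adj_vx _ _) uv)).
Qed.

Definition creg : 6.-tuple CA :=
  [tuple ca p5 p8; ca p7 p8; ca p4 p7; ca p4 p9; ca p6 p9; ca p5 p6].

Lemma creg_adj u v : adjp u v -> adj (sec u) (cact (reduced creg (vx u) (vx v)) (sec v)).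
Proof.
pose l := [:: (p0, p1); (p0, p2); (p0, p3); (p1, p4); (p1, p5); (p2, p6);
  (p2, p7); (p3, p8); (p3, p9); (p5, p8); (p7, p8); (p4, p7); (p4, p9); (p6, p9); (p5, p6)].
have half u' v' : adjp u' v' -> (u', v') \in l ->
    adj (sec u') (cact (reduced creg (vx u') (vx v')) (sec v')).
  have tre w : adjp u' v' -> tpath v' = rcons (tpath u') v' -> w = 0 ->
      adj (sec u') (cact w (sec v')).
    by move=> uv tw ->; rewrite cact0; have [] := sec_tree uv (fun w => erefl _) tw (sec_map u').
  have cot w : adjp u' v' -> w = ca u' v' -> adj (sec u') (cact w (sec v')).
    by move=> uv ->; apply: ca_adj.
  move=> uv ul; case: u' uv ul tre cot; case: v' => // uv _ tre cot;
    by [apply: tre => //; rewrite /= /reduced_volt /= subrr | apply: cot => //;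
        rewrite /= /reduced_volt /= subr0].
move=> uv; have [h|h] : (u, v) \in l \/ (v, u) \in l.
- by move: uv; case: u; case: v => // _; (by left) || (by right).
- exact: half uv h.
have vu : adjp v u by rewrite adjpC.
rewrite adj_sym; set r := reduced creg _ _; rewrite -(cact_adj (- r)) cactNK.
by rewrite -(volt_anti (reduced creg)) ?adj_vx //; apply: half vu h.
Qed.

Lemma creg_iso : cov_iso C (vcover (reduced creg)).
Proof.
apply: cov_iso_sym; exists 1%g; first exact: aut_id.
exists (fun y : petersen * CA => cact y.2 (sec (tp y.1))); split; last first.
- by move=> y; rewrite perm1 cact_map sec_map tpK.
- move=> [u g] [v h] /=; rewrite /vadj /=; case uv: (padj u v) => /=; last first.
    apply: contraFF uv => /cmap_hom; by rewrite !cact_map !sec_map !tpK.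
  have uv' : adjp (tp u) (tp v) by rewrite -adj_vx !tpK.
  have := creg_adj uv'; rewrite !tpK -(cact_adj g) -cactD => k.
  apply/idP/eqP=> [k'|->]; last exact: k.
  apply: (@cact_inj _ _ (sec (tp v))); apply: (lft_uniq k' k).
  by rewrite !cact_map.
have inj : injective (fun y : petersen * CA => cact y.2 (sec (tp y.1))).
  move=> [u g] [v h] /= e; have := congr1 (cmap C) e.
  by rewrite !cact_map !sec_map !tpK => uv; rewrite uv in e *; rewrite (cact_inj e).
have sur x : exists y : petersen * CA, cact y.2 (sec (tp y.1)) == x.
  have [g ge] := @cact_ex (sec (tp (cmap C x))) x (etrans (sec_map _) (tpK _)).
  by exists (cmap C x, g).
exists (fun x => xchoose (sur x)) => [y|x]; last exact: (eqP (xchooseP (sur x))).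
by apply: inj; apply: (eqP (xchooseP (sur _))).
Qed.

Lemma card_CA : #|CA| = #|cov_trans C|.
Proof.
have <- : [set sgval x | x in [set: [subg ctg]]] = cov_trans C.
  apply/setP=> s; apply/imsetP/idP=> [[x _ ->]|h]; first exact: subgP.
  by exists (subg ctg s); rewrite ?inE ?subgK.
by rewrite card_imset; [rewrite cardsT | exact: val_inj].
Qed.

End Regular.

Lemma regular_voltage (C : covering petersen) : abelian_regular C ->
  exists (A : finZmodType) (a : 6.-tuple A),
    cov_iso C (vcover (reduced a)) /\ #|A| = #|cov_trans C|.
Proof.
move=> reg; have [x0 x0E] := cmap_surj C (vx p0).
by exists (CA reg), (creg reg x0E); split; [exact: creg_iso | exact: card_CA].
Qed.

(** * Isomorphisms of coverings and uniqueness *)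

Section IsoKernel.
Variables (A B : finZmodType) (a : 6.-tuple A) (b : 6.-tuple B).
Variables (f : vg a -> vg b) (s : pt -> pt).
Hypotheses (sA : isaut s) (fadj : forall x y, adj (f x) (f y) = adj x y)
  (fs : forall z, pr (f z) = s (pr z)).

(** The argument of [lifts_invariant], now between two coverings. *)
Lemma iso_ker h : phi a h = 0 -> phi b (mulM s h) = 0.
Proof.
move=> ph; pose c := relab b s.
pose G v x := (f (vx v, x)).2 - phi b (csum s v).
have kst u v x : adjp u v ->
    G v (reduced a (vx u) (vx v) + x) = reduced c (vx u) (vx v) + G u x.
  move=> uv; have e : f (nb (vx u, x) v) = nb (f (vx u, x)) (s v).
    have : adj (f (vx u, x)) (f (nb (vx u, x) v)).
      by rewrite fadj; apply: adj_nb; rewrite /pr vxK.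
    by rewrite adjE => /andP[_ /eqP]; rewrite fs -[pr (nb _ v)]/(tp (vx v)) vxK.
  have E : (f (vx v, reduced a (vx u) (vx v) + x)).2 =
      reduced b (vx (s u)) (vx (s v)) + (f (vx u, x)).2.
    have := congr1 snd e; rewrite [in RHS]nbE fs.
    by rewrite -[pr (vx u, x)]/(tp (vx u)) vxK.
  rewrite /G E; have := relab_volt b sA uv; move/(canRL (addrK _)) => ->.
  have zid (t y d l : B) : t + y - d + l - y = t + (l - d).
    by rewrite [t + y]addrC -!addrA [LHS]addrC -!addrA addNr addr0 [- d + l]addrC.
  exact: zid.
have Gt v x : G v x = G p0 x.
  move: v; apply: tree_ind => // u v uv e <-; have := kst u v x uv.
  by rewrite !e !add0r.
have Ga x h' : G p0 (x + phi a h') = G p0 x + phi c h'.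
  apply: (@phil_gen2 _ _ a c (fun y z => G p0 (x + y) = G p0 x + z)); rewrite ?size_tuple ?addr0 //.
  move=> i y z li; have := cot_volt a li; have := cot_volt c li.
  case: (nth _ cotp i) => p q [pq eb] [_ ea].
  have st d : G p0 (nth 0 a i + d) = nth 0 c i + G p0 d.
    by rewrite -ea -eb -(Gt q) -(Gt p) kst.
  move=> e; split.
    have -> : x + (y + nth 0 a i) = nth 0 a i + (x + y) by rewrite addrA addrC.
    by rewrite st e [RHS]addrA [RHS]addrC.
  apply: (addrI (nth 0 c i)); rewrite -st.
  have -> : nth 0 a i + (x + (y - nth 0 a i)) = x + y.
    by rewrite addrCA [nth 0 a i + _]addrC subrK.
  by rewrite e [RHS]addrCA [nth 0 c i + _]addrC subrK.
rewrite -phi_relab; have := Ga 0 h; rewrite ph addr0.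
by rewrite -{1}[G _ _]addr0 => /addrI.
Qed.

End IsoKernel.

Lemma iso_relab (A : finZmodType) (b : 6.-tuple A) s (sA : isaut s) :
  cov_iso (vcover (reduced (relab b s))) (vcover (reduced b)).
Proof.
have inj : injective (fun v : petersen => vx (s (tp v))).
  by move=> u v /(can_inj vxK)/(isaut_inj sA)/(can_inj tpK).
exists (perm inj).
  by apply/aut1P=> u v; rewrite !permE adj_vx sA -adj_vx !tpK.
exists (@psiv _ b s sA); split.
- exists ((psi b sA)^-1%g) => y; [exact: permK | exact: permKV].
- exact: psi_adj.
by move=> y; rewrite permE /= /psiv permE.
Qed.

Lemma relab_surj (A : finZmodType) (a : 6.-tuple A) s : isaut s -> phi_surj a ->
  phi_surj (relab a s).
Proof.
move=> sA su; apply: connected_surj.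
have [_ _ [g [gb gadj _]]] := cov_iso_sym (iso_relab a sA).
exact: (iso_connected gb gadj (surj_connected su)).
Qed.

(** Each vertex off the 3-arc is a good or bad continuation or a third neighbour, and automorphisms
    preserve these. *)
Lemma isaut_ext s : isaut s -> arcp (s p4) (s p1) (s p0) (s p2) /\
  s =1 ext (s p4) (s p1) (s p0) (s p2).
Proof.
move=> sA; have sI := isaut_inj sA.
have eqs u v : eqpt (s u) (s v) = eqpt u v by apply/eqptP/eqptP=> [/sI|->].
have ar : arcp (s p4) (s p1) (s p0) (s p2) by rewrite /arcp !sA !eqs.
split=> //; have cA a b c d l : arcp a b c d -> s (cont a c d l) = cont (s a) (s c) (s d) l.
  by move=> h; rewrite (cont_aut l sA h).
have s7 := cA p4 p1 p0 p2 false isT; have s6 := cA p4 p1 p0 p2 true isT.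
have s5 := cA p6 p2 p0 p1 false isT.
have s3 : s p3 = if eqpt (oth (s p0) (s p1)).1 (s p2) then (oth (s p0) (s p1)).2
                 else (oth (s p0) (s p1)).1.
  have := sA p0 p3; have := sA p0 p1; have := sA p0 p2; have := eqs p1 p3.
  have := eqs p2 p3; have := eqs p1 p2.
  case: (s p0); case: (s p1) => //; case: (s p2) => //; by case: (s p3).
have s9 := cA p4 p1 p0 p3 false isT; have s8 := cA p4 p1 p0 p3 true isT.
by case; rewrite /ext //= ?[LHS]s3 ?[LHS]s7 ?[LHS]s6 ?[LHS]s5 ?[LHS]s9 ?[LHS]s8 -?s3 -?s6.
Qed.

Section CovIso.
Variables (A B : finZmodType) (a : 6.-tuple A) (b : 6.-tuple B).
Hypothesis iso : cov_iso (vcover (reduced a)) (vcover (reduced b)).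

Lemma cov_iso_ker : exists s, isaut s /\ forall h, phi a h = 0 -> phi b (mulM s h) = 0.
Proof.
case: iso => al alA [f [_ fadj fc]].
exists (fun u => tp (al (vx u))); have sA : isaut (fun u => tp (al (vx u))).
  by move=> u v; rewrite -!adj_vx !tpK (aut1P _ alA).
by split=> // h; apply: (@iso_ker _ _ a b f _ sA fadj) => z; rewrite /pr tpK; congr tp; apply: esym; apply: fc.
Qed.

Lemma cov_iso_card : #|A| = #|B|.
Proof.
case: iso => _ _ [f [fb _ _]]; have := bij_eq_card fb.
by rewrite !card_prod !card_ord => /eqP; rewrite eqn_pmul2l // => /eqP.
Qed.

Lemma cov_iso_kill n : phi_surj b -> (forall x : A, x *+ n = 0) -> forall y : B, y *+ n = 0.
Proof.
move=> su kA y; have [s [sA hs]] := cov_iso_ker.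
have [h /andP[_ /eqP <-]] := relab_surj sA su y.
have : phi (relab b s) (vscale (Z.of_nat n) h) = 0.
  by rewrite phi_relab; apply: hs; rewrite phiZ izn -pmulrn kA.
by rewrite phiZ izn -pmulrn.
Qed.

End CovIso.

Lemma Zprod_kill m n : all (leq 2) m -> (forall x : Zprod m, x *+ n = 0) ->
  forall i, (i < size m)%N -> (nth 0%N m i %| n)%N.
Proof.
move=> m1 kill i li; have n1 : (1 < nth 0%N m i)%N by have /allP := m1; apply; apply: mem_nth.
pose x : Zprod m := [ffun j => 1]; have := congr1 (fun f : Zprod m => f (Ordinal li)) (kill x).
have -> : (x *+ n) (Ordinal li) = x (Ordinal li) *~ n by rewrite pmulrn dprodzM.
rewrite /x !ffunE -pmulrn => /(congr1 val); rewrite /= val_Zp_nat // => /eqP.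
by [].
Qed.

Lemma Zprod_killed m n : all (leq 2) m -> all (fun k => k %| n)%N m ->
  forall x : Zprod m, x *+ n = 0.
Proof.
move=> /allP m1 /allP dv x; apply/ffunP=> i.
have mi : nth 0%N m i \in m by apply: mem_nth.
have -> : (x *+ n) i = x i *~ n by rewrite pmulrn dprodzM.
rewrite ffunE -pmulrn -mulr_natr; apply: val_inj.
have -> : (n%:R : 'Z_(nth 0%N m i)) = 0.
  by apply: val_inj; rewrite /= val_Zp_nat ?m1 //; apply/eqP/dv.
by rewrite mulr0.
Qed.

Definition Xprime (n : Xname) : nat :=
  match n with
  | X_5_3 | Xk3_5_6 _ => 5 | X_p_3 p _ _ | X_p_6 p | Xk3_p_3 _ p _ _
  | Xkc3_p_6 _ _ p _ _ | Xk6_p_6 _ p => p | _ => 2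
  end.

Definition Xlog (n : Xname) : nat :=
  match n with
  | X_2_1 | X'_2_1 => 1 | X_2_2 => 2 | X_5_3 | X_p_3 _ _ _ => 3 | X_p_6 _ => 6
  | Xk1_2_6 k | X'k1_2_6 k => k + 5 * k.-1 | Xk2_2_6 k => 2 * k + 4 * k.-1
  | Xk3_p_3 k _ _ _ => 3 * k | Xk3_5_6 k => 3 * k + 3 * k.-1
  | Xkc3_p_6 k c _ _ _ => 3 * k + 3 * c | Xk6_p_6 k _ => 6 * k
  end.

Definition Xexp (n : Xname) : nat :=
  match n with
  | Xk1_2_6 k | X'k1_2_6 k | Xk2_2_6 k | Xk3_p_3 k _ _ _ | Xk3_5_6 k
  | Xkc3_p_6 k _ _ _ _ | Xk6_p_6 k _ => k
  | _ => 1
  end.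

Lemma Xprime_prime n : listed n -> prime (Xprime n).
Proof.
case: n => [||||p l l'|p|k|k|k|k p l l'|k|k c p l l'|k p] //=.
- by case/andP=> /andP[].
- by case/and3P=> _ /andP[].
- by case/and4P=> _ _ /andP[].
by case/andP.
Qed.

Lemma X_card n : listed n -> #|Zprod (Xm n)| = (Xprime n ^ Xlog n)%N.
Proof.
move=> ln; rewrite card_Zprod ?listed_Xm //.
case: n {ln} => [||||p l l'|p|k|k|k|k p l l'|k|k c p l l'|k p];
  rewrite /= ?big_cons ?big_nil ?muln1 -?expnD //; try (by rewrite -?expnS -?expnD; congr (_ ^ _)%N; lia).
Qed.

Lemma X_exp n : listed n -> (forall x : Zprod (Xm n), x *+ Xprime n ^ Xexp n = 0) /\
  nth 0%N (Xm n) 0 = (Xprime n ^ Xexp n)%N /\ (0 < size (Xm n))%N.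
Proof.
move=> ln; split; last first.
  by case: n ln => [||||p l l'|p|k|k|k|k p l l'|k|k c p l l'|k p].
apply: Zprod_killed; first exact: listed_Xm.
have pk (p k j : nat) : (j <= k)%N -> (p ^ j %| p ^ k)%N by move=> h; apply: dvdn_exp2l.
case: n ln => [||||p l l'|p|k|k|k|k p l l'|k|k c p l l'|k p] //= ln; rewrite ?dvdnn ?expn1 ?dvdnn //=.
- by rewrite !pk //; lia.
- by rewrite !pk //; lia.
- by rewrite !pk //; lia.
- by rewrite !pk //; lia.
by case/and4P: ln => _ /andP[_ ck] _ _; rewrite !pk //; lia.
Qed.

Lemma two_roots_uniq p m l l' k k' : pm1_prime p -> (0 < m)%N ->
  two_roots (p ^ m) l l' -> two_roots (p ^ m) k k' ->
  (k = l /\ k' = l') \/ (k = l' /\ k' = l).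
Proof.
move=> pm m0 rl rk; have [p5 _] := not5 pm; have pp := proj1 (andP pm).
have N1 : (1 < p ^ m)%N by rewrite -[1%N](exp1n m) ltn_exp2r // prime_gt1.
have [l1 l2 ll' r1 r2] := two_rootsP N1 rl; have [k1 k2 kk' s1 s2] := two_rootsP N1 rk.
have [q eq] := two_roots_sum pm m0 rl; have [q' eq'] := two_roots_sum pm m0 rk.
have small x y : (x < p ^ m)%N -> (y < p ^ m)%N ->
    Z.divide (zpow p m) (Z.of_nat x - Z.of_nat y) -> x = y.
  by rewrite /zpow => hx hy [t et]; have t0 : t = 0%ZZ by [nia]; rewrite t0 in et; lia.
have sum x y z : (y < p ^ m)%N -> (z < p ^ m)%N -> Z.divide (zpow p m) (Z.of_nat x + Z.of_nat y - 1) ->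
    Z.divide (zpow p m) (Z.of_nat x + Z.of_nat z - 1) -> y = z.
  move=> hy hz d1 d2; apply: small => //; have := Z.divide_sub_r _ _ _ d1 d2.
  by congr (Z.divide _ _); ring.
have sl : Z.divide (zpow p m) (Z.of_nat l + Z.of_nat l' - 1) by exists q.
have sk : Z.divide (zpow p m) (Z.of_nat k + Z.of_nat k' - 1) by exists q'.
case: (root_or pp p5 s1 r1) => d.
  by left; have e := small _ _ k1 l1 d; split=> //; apply: (sum l); rewrite -?e //; rewrite e.
right; have e : k = l'.
  by apply: (sum l) => //; move: d; congr (Z.divide _ _); ring.
split=> //; apply: (sum l') => //; first by rewrite -e.
by move: sl; congr (Z.divide _ _); ring.
Qed.

(** * Primes modulo which 5 is a square *)

Section Golden.
Variable F : finFieldType.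

Definition mk2 (x y z w : F) : 'M[F]_2 :=
  \matrix_(i < 2, j < 2) (if i == 0 then (if j == 0 then x else y)
                          else (if j == 0 then z else w)).

Lemma mk2M x y z w x' y' z' w' : mk2 x y z w *m mk2 x' y' z' w' =
  mk2 (x * x' + y * z') (x * y' + y * w') (z * x' + w * z') (z * y' + w * w').
Proof.
apply/matrixP=> i j; rewrite !mxE !big_ord_recl big_ord0 !mxE addr0 /=.
by case: (i == 0); case: (j == 0).
Qed.

Lemma mk2_1 : mk2 1 0 0 1 = 1%:M.
Proof.
apply/matrixP=> i j; rewrite !mxE.
by case: i => -[|[|//]] hi; case: j => -[|[|//]] hj.
Qed.

(* The companion matrix of [x ^ 2 - t x + 1] has order 5. *)
Lemma golden_card (t : F) : t * t = 1 - t -> (5%:R : F) != 0 ->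
  (5 %| #|F| * #|F|.-1 ^ 2 * #|F|.+1)%N.
Proof.
move=> tt n5; pose B := mk2 0 (-1) 1 t; pose B' := mk2 t 1 (-1) 0.
have e2 : B *m B = mk2 (-1) (- t) t (- t).
  by rewrite mk2M; congr mk2; rewrite ?tt; ring.
have e4 : B *m B *m (B *m B) = B'.
  by rewrite e2 mk2M; congr mk2; rewrite ?mulrN ?mulNr ?opprK ?tt; ring.
have e5 : B' *m B = 1%:M.
  rewrite mk2M -mk2_1; congr mk2; ring.
have BB' : B *m B' = 1%:M := mulmx1C e5.
have uB : B \is a GRing.unit.
  by apply/unitrP; exists B'.
pose g : {'GL_2[F]} := FinRing.Unit uB.
have g5 : (g ^+ 5 = 1)%g.
  have b5 : B *m (B *m (B *m (B *m B))) = 1%:M by rewrite -e5 -e4 !mulmxA.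
  by apply: val_inj; rewrite FinRing.val_unitX; exact: b5.
have g1 : g != 1%g.
  apply/eqP=> /(congr1 val) /= e; have := congr1 (fun M : 'M[F]_2 => M 0 0) e.
  by rewrite !mxE /= => /eqP; rewrite eq_sym oner_eq0.
have o5 : #[g]%g = 5%N.
  have : (#[g]%g %| 5)%N by rewrite order_dvdn g5.
  by rewrite dvdn_divisors // !inE => /orP[/eqP o1|/eqP //]; case/eqP: g1; apply/eqP; rewrite -order_eq1 o1.
by rewrite -card_GL_2 -o5; apply: order_dvdG; rewrite inE.
Qed.

End Golden.

(** l - 1 plays the role of the sum of a primitive fifth root of unity and its inverse. The order of
    GL_2 then makes 5 divide p (p - 1)^2 (p + 1), so p is 1 or -1 modulo 5; this replaces an appeal
    to quadratic reciprocity. *)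
Lemma golden_prime p (l : Z) : prime p -> odd p -> p <> 5%N ->
  Z.divide (Z.of_nat p) (l * l - l - 1) -> pm1_prime p.
Proof.
move=> pp op p5 rt; have p1 := prime_gt1 pp.
have inF (z : int) : (z%:~R = 0 :> 'F_p) <-> Z.divide (Z.of_nat p) (Z_of_int z).
  have h w : Z.divide (Z.of_nat (pdiv p)) w <-> Z.divide (Z.of_nat p) w by rewrite pdiv_id.
  by apply: iff_trans (h _); apply: Zp_int_eq0; rewrite pdiv_id.
pose t : 'F_p := (iz l - 1)%:~R.
have tt : t * t = 1 - t.
  apply/eqP; rewrite -subr_eq0; apply/eqP; rewrite /t -intrM -[1 : 'F_p]/(1%:~R) -!rmorphB.
  apply/inF; move: rt; congr (Z.divide _ _).
  by rewrite !(ziD, ziM, ziN) /iz int_of_ZK -[Z_of_int 1]/1%ZZ; ring.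
have n5 : (5%:R : 'F_p) != 0.
  apply/eqP=> e; have : (5%:Z%:~R = 0 :> 'F_p) by rewrite -pmulrn.
  move/inF => /(@dvdn_Z p 5); rewrite dvdn_prime2 // => /eqP; exact: p5.
have o2 := modn2 p; rewrite op in o2; rewrite /pm1_prime pp !inE.
have := golden_card tt n5; rewrite card_Fp // Euclid_dvdM // Euclid_dvdM // Euclid_dvdX //.
case/orP=> [/orP[|/andP[h _]]|h]; last 2 first.
- by have := prime_gt0 pp; lia.
- by lia.
by rewrite dvdn_prime2 // => /eqP e; case: p5.
Qed.

(** * The classification *)

Lemma iso_of_Kform (A : finZmodType) (a : 6.-tuple A) n : phi_surj a -> listed n ->
  Kform a (Xd n) (XP n) -> cov_iso (vcover (reduced a)) (X n).
Proof.
move=> su ln ka; rewrite XE; have kx := X_Kform ln.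
apply: iso_kernel => //; first exact: X_surj.
  by move=> h /V6P[h1 [h2 [h3 [h4 [h5 [h6 ->]]]]]] /ka/kx.
by move=> h /V6P[h1 [h2 [h3 [h4 [h5 [h6 ->]]]]]] /kx/ka.
Qed.

Lemma Kform_ext (A : finZmodType) (a : 6.-tuple A) d P Q :
  (forall h1 h2 h3 h4 h5 h6, P h1 h2 h3 h4 h5 h6 <-> Q h1 h2 h3 h4 h5 h6) ->
  Kform a d P -> Kform a d Q.
Proof.
move=> PQ ka h1 h2 h3 h4 h5 h6; rewrite ka.
by split=> -[k1 [k2 [k3 [k4 [k5 [k6 [? /PQ ?]]]]]]]; exists k1, k2, k3, k4, k5, k6.
Qed.

Lemma PL_congr M l l' : Z.divide M (l - l') -> forall h1 h2 h3 h4 h5 h6,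
  PL M l h1 h2 h3 h4 h5 h6 <-> PL M l' h1 h2 h3 h4 h5 h6.
Proof.
move=> [q e] h1 h2 h3 h4 h5 h6; have -> : l = (l' + q * M)%ZZ by lia.
rewrite /PL /F1 /F2 /F3; split=> -[[q1 e1] [q2 e2] [q3 e3]]; split.
- by exists (q1 - q * (h4 + h5))%ZZ; lia.
- by exists (q2 - q * (h3 + h4))%ZZ; lia.
- by exists (q3 + q * (h3 + h4 + h5))%ZZ; lia.
- by exists (q1 + q * (h4 + h5))%ZZ; lia.
- by exists (q2 + q * (h3 + h4))%ZZ; lia.
by exists (q3 - q * (h3 + h4 + h5))%ZZ; lia.
Qed.

(** The second root is the residue of 1 - l. Equality would make 2 l - 1 vanish, whose square is
    congruent to 5. *)
Lemma two_roots_exist p m (l : Z) : pm1_prime p -> (0 < m)%N ->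
  Z.divide (zpow p m) (l * l - l - 1) ->
  exists k k', two_roots (p ^ m) k k' /\ Z.divide (zpow p m) (l - Z.of_nat k).
Proof.
move=> pm m0 rt; have [p5 _] := not5 pm; have pp := proj1 (andP pm).
have p0 := zpow_gt0 m pp; pose N := zpow p m.
have N1 : (1 < p ^ m)%N by rewrite -[1%N](exp1n m) ltn_exp2r // prime_gt1.
have b1 := Z.mod_pos_bound l N p0; have b2 := Z.mod_pos_bound (1 - l) N p0.
have d1 := Z.div_mod l N; have d2 := Z.div_mod (1 - l) N.
pose k := Z.to_nat (l mod N); pose k' := Z.to_nat ((1 - l) mod N).
have ek : Z.of_nat k = (l - N * (l / N))%ZZ by rewrite /k; lia.
have ek' : Z.of_nat k' = (1 - l - N * ((1 - l) / N))%ZZ by rewrite /k'; lia.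
have rr x : Z.divide N (Z.of_nat x * Z.of_nat x - Z.of_nat x - 1) ->
    (x%:R ^+ 2 - x%:R - 1 == 0 :> 'Z_(p ^ m)).
  move=> d; apply/eqP; rewrite expr2 [RHS](_ : _ = (x%:Z * x%:Z - x%:Z - 1)%:~R); last first.
    by apply/esym/(Zp_int_eq0 _ N1); rewrite !(ziD, ziM, ziN).
  by rewrite !intrD !mulrNz intrM -!pmulrn.
exists k, k'; split; last by exists (l / N)%ZZ; lia.
apply/and5P; split; [by rewrite /k /N /zpow in b1 *; lia | by rewrite /k' /N /zpow in b2 *; lia | | |].
- apply/eqP=> e; have e2 : Z.divide N (2 * l - 1).
    by exists (l / N - (1 - l) / N)%ZZ; rewrite e in ek; lia.
  have pN : Z.divide (Z.of_nat p) N.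
    by rewrite /N -(prednK m0) zpowS; apply: Z.divide_factor_r.
  have := divide_lin (2 * l - 1) (-4) 0 0 e2 rt rt rt.
  have -> : ((2 * l - 1) * (2 * l - 1) + -4 * (l * l - l - 1) + 0 * (l * l - l - 1) +
    0 * (l * l - l - 1) = 5)%ZZ by ring.
  move/(Z.divide_trans _ _ _ pN)/(@dvdn_Z p 5); rewrite dvdn_prime2 // => /eqP; exact: p5.
- apply: rr; rewrite ek; have := divide_lin 1 (- (l / N) * (2 * l - 1 - N * (l / N))) 0 0 rt (Z.divide_refl N) rt rt.
  by congr (Z.divide _ _); ring.
apply: rr; rewrite ek'; set w := ((1 - l) / N)%ZZ.
have := divide_lin 1 (- w * (1 - 2 * l - N * w)) 0 0 rt (Z.divide_refl N) rt rt.
by congr (Z.divide _ _); ring.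
Qed.

Lemma odd_listed (A : finZmodType) (a : 6.-tuple A) p c m l : prime p -> odd p ->
  Z.divide (zpow p m) (l * l - l - 1) -> Kform a (zpow p c) (PL (zpow p m) l) ->
  (c + m != 0)%N -> exists2 n, listed n & Kform a (Xd n) (XP n).
Proof.
move=> pp op rt ka cm; have [m0|m0] := posnP m.
  have {}ka : Kform a (zpow p c) Pall.
    apply: Kform_ext ka => *; split=> // _; rewrite m0 /PL; split; apply: Z.divide_1_l.
  have c0 : (0 < c)%N by lia.
  have [c1|c1] := leqP c 1.
    by exists (X_p_6 p) => //=; have -> : 1%N = c by lia.
  by exists (Xk6_p_6 c p) => //=; rewrite c1.
have rp : Z.divide (Z.of_nat p) (l * l - l - 1).
  by apply: Z.divide_trans rt; rewrite -(prednK m0) zpowS; apply: Z.divide_factor_r.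
have [p5|/eqP p5] := eqVneq p 5%N.
  (* x^2 - x - 1 has the double root 3 modulo 5 and no root modulo 25, so l is 3 modulo 5 and m =
     1. *)
  subst p; have b := Z.mod_pos_bound l 5; have d := Z.div_mod l 5.
  set q := (l / 5)%ZZ in d; set r := (l mod 5)%ZZ in b d.
  have l3 : r = 3%ZZ.
    case: rp => s es; have [r0|[r0|[r0|[r0|r0]]]] : (r = 0 \/ r = 1 \/ r = 2 \/ r = 3 \/ r = 4)%ZZ by lia.
    - by exfalso; rewrite r0 in d; have e : l = (5 * q)%ZZ by [lia]; rewrite e in es; lia.
    - by exfalso; rewrite r0 in d; have e : l = (5 * q + 1)%ZZ by [lia]; rewrite e in es; lia.
    - by exfalso; rewrite r0 in d; have e : l = (5 * q + 2)%ZZ by [lia]; rewrite e in es; lia.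
    - by [].
    by exfalso; rewrite r0 in d; have e : l = (5 * q + 4)%ZZ by [lia]; rewrite e in es; lia.
  have el : l = (5 * q + 3)%ZZ by lia.
  have m1 : m = 1%N.
    case: m m0 rt {ka cm} => [|[|m]] // _; rewrite !zpowS => -[s].
    rewrite el -[Z.of_nat 5]/5%ZZ => es; exfalso; lia.
  have {}ka : Kform a (zpow 5 c) (PL (zpow 5 1) 3).
    by apply: Kform_ext ka; rewrite m1; apply: PL_congr; exists q; rewrite /zpow /=; lia.
  have [c0|c0] := posnP c; first by rewrite c0 in ka; exists X_5_3.
  by exists (Xk3_5_6 c.+1).
have pm := golden_prime pp op p5 rp.
have [k [k' [rk dk]]] := two_roots_exist pm m0 rt.
have {}ka : Kform a (zpow p c) (PL (zpow p m) (Z.of_nat k)) by apply: Kform_ext ka; apply: PL_congr.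
have [c0|c0] := posnP c.
  have [m1|m1] := leqP m 1.
    have e : m = 1%N by lia.
    by exists (X_p_3 p k k') => /=; [rewrite pm; move: rk; rewrite e expn1 | rewrite -e -c0].
  by exists (Xk3_p_3 m p k k') => /=; [rewrite m1 pm rk | rewrite -c0].
exists (Xkc3_p_6 (c + m) c p k k') => /=; last by rewrite addKn.
by rewrite pm addKn rk c0 /= !andbT; lia.
Qed.

Lemma tau_Kform (A : finZmodType) (a : 6.-tuple A) d x y : Kform a d (Peven x y) ->
  Kform (relab a tau) d (Peven y x).
Proof.
move=> ka h1 h2 h3 h4 h5 h6; rewrite /Kx phi_relab mulM_tau -/(Kx a _ _ _ _ _ _) ka.
split=> -[k1 [k2 [k3 [k4 [k5 [k6 [[e1 e2 e3 [e4 e5 e6]] [q e]]]]]]]].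
  exists k2, k1, (- k6)%ZZ, k5, k4, (- k3)%ZZ; split; first by split; last split; lia.
  by exists (q - x * k3 - y * k6)%ZZ; lia.
exists k2, k1, (- k6)%ZZ, k5, k4, (- k3)%ZZ; split; first by split; last split; lia.
by exists (q - x * k6 - y * k3)%ZZ; lia.
Qed.

Lemma card_kill (A : finZmodType) (x : A) : x *+ #|A| = 0.
Proof.
rewrite -cardsT -FinRing.zmodXgE.
have /dvdnP[q ->] := order_dvdG (in_setT x : x \in [set: A]%G).
by rewrite mulnC expgM expg_order expg1n.
Qed.

Lemma kernel_listed (A : finZmodType) (a : 6.-tuple A) p e : prime p -> #|A| = (p ^ e)%N ->
  (1 < #|A|)%N -> phi_surj a -> invariant a rho1 -> invariant a rho2 ->
  exists2 n, listed n & cov_iso (vcover (reduced a)) (X n).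
Proof.
move=> pp cA A1 su i1 i2.
have kill (x : A) : x *+ p ^ e = 0.
  by rewrite -cA card_kill.
have ntriv : ~ Kform a 1 Pall.
  move=> ka; have all0 (x : A) : x = 0.
    have [h /andP[/eqP/V6P[h1 [h2 [h3 [h4 [h5 [h6 ->]]]]]] /eqP <-]] := su x.
    by apply/ka; exists h1, h2, h3, h4, h5, h6; split=> //; split; last split; lia.
  by case/card_gt1P: A1 => x [y [_ _ /eqP]]; apply; rewrite (all0 x) (all0 y).
have [c [[op [m [l [rt ka]]]]|[p2]]] := kernel_structure pp kill i1 i2.
  have [|n ln kn] := odd_listed pp op rt ka; last by exists n => //; apply: iso_of_Kform.
  apply/eqP=> cm; apply: ntriv; have [c0 m0] : c = 0%N /\ m = 0%N by lia.
  by rewrite c0 in ka; apply: Kform_ext ka => *; split=> // _; rewrite m0 /PL; split; apply: Z.divide_1_l.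
case=> [ka|[x [y [xy ka]]]|ka].
- have [c0|c0] := posnP c; first by case: ntriv; rewrite c0 in ka.
  have [c1|c1] := leqP c 1.
    have e1 : c = 1%N by lia.
    by rewrite e1 in ka; exists (X_p_6 2) => //; apply: iso_of_Kform.
  by exists (Xk6_p_6 c 2); [rewrite /= c1 | apply: iso_of_Kform => //=; rewrite c1].
(* Only one of the two parities that [tau] exchanges is listed, the first for k = 1 and the second
   for k > 1; the other is relabelled. *)
- have sut := relab_surj tau_aut su; have kt := tau_Kform ka.
  have it n : cov_iso (vcover (reduced (relab a tau))) (X n) -> cov_iso (vcover (reduced a)) (X n).
    by apply: cov_iso_trans; apply: cov_iso_sym; apply: iso_relab tau_aut.
  move: xy ka kt; rewrite !inE => /or3P[] /eqP[-> ->] ka kt; have [c0|c0] := posnP c.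
  + by rewrite c0 in ka; exists X'_2_1 => //; apply: iso_of_Kform.
  + by exists (X'k1_2_6 c.+1) => //; apply: it; apply: iso_of_Kform.
  + by rewrite c0 in kt; exists X'_2_1 => //; apply: it; apply: iso_of_Kform.
  + by exists (X'k1_2_6 c.+1) => //; apply: iso_of_Kform.
  + by rewrite c0 in ka; exists X_2_1 => //; apply: iso_of_Kform.
  by exists (Xk1_2_6 c.+1) => //; apply: iso_of_Kform.
have [c0|c0] := posnP c; first by rewrite c0 in ka; exists X_2_2 => //; apply: iso_of_Kform.
by exists (Xk2_2_6 c.+1) => //; apply: iso_of_Kform.
Qed.

Lemma eq_mulM s t : s =1 t -> mulM s =1 mulM t.
Proof.
move=> e h; rewrite /mulM (_ : Mat s = Mat t) //; apply: val_inj.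
by rewrite /= /Mcol /csum /= !e.
Qed.

(* The covering with kernel [d {h : sum of the h_i even}] is not isomorphic to
   one in which only one of the two parities enters. *)
Lemma parity_noniso (A B : finZmodType) (a : 6.-tuple A) (b : 6.-tuple B) d x y :
  (0 < d)%ZZ -> (x, y) \in [:: (1, 0); (0, 1)]%ZZ -> Kform a d (Peven 1 1) ->
  Kform b d (Peven x y) -> ~ cov_iso (vcover (reduced a)) (vcover (reduced b)).
Proof.
move=> d0 xy ka kb /cov_iso_ker[s [sA hs]].
(* This vector lies in the kernel of [a], and every automorphism turns (1, 1, 0, 0, 0, 0) into a
   vector with both partial sums odd. *)
have k0 : phi a (vscale d (V6 1 1 0 0 0 0)) = 0.
  rewrite vscale_map; apply/ka; exists 1%ZZ, 1%ZZ, 0%ZZ, 0%ZZ, 0%ZZ, 0%ZZ.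
  by split; [split; last split; lia | exists 1%ZZ].
have := hs _ k0; rewrite -phi_relab phiZ phi_relab -phiZ.
have [ar e] := isaut_ext sA; rewrite (eq_mulM e).
have /all_arc3P chk : all_arc3 (fun x y z w =>
    if mulM (ext x y z w) (V6 1 1 0 0 0 0) is [:: h1; h2; h3; h4; h5; h6]
    then ~~ Z.even (h1 + h3 + h5) && ~~ Z.even (h2 + h4 + h6) else false).
  by vm_cast_no_check (erefl true).
have := chk _ _ _ _ ar; move: (mulM _ _) => [|h1 [|h2 [|h3 [|h4 [|h5 [|h6 [|//]]]]]]] //.
move=> /andP[/negP n1 /negP n2]; rewrite vscale_map => /kb.
case=> k1 [k2 [k3 [k4 [k5 [k6 [[e1 e2 e3 [e4 e5 e6]] [q eq]]]]]]].
have can u v : (d * u = d * v)%ZZ -> u = v by move=> h; apply: (Z.mul_reg_l _ _ d); lia.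
rewrite -(can _ _ e1) -(can _ _ e2) -(can _ _ e3) -(can _ _ e4) -(can _ _ e5) -(can _ _ e6) in eq.
move: xy eq; rewrite !inE => /orP[] /eqP[-> ->] eq.
  by apply: n1; apply/Z.even_spec; exists q; lia.
by apply: n2; apply/Z.even_spec; exists q; lia.
Qed.

(** The order yields the prime and the logarithm, and annihilators yield the exponent. Names that
    agree in all three differ at most in their roots, or are separated by [parity_noniso]. *)
Lemma X_uniq n n' : listed n -> listed n' -> cov_iso (X n) (X n') ->
  n' = n \/ n' = opposite_sign n.
Proof.
move=> ln ln'; rewrite !XE => iso.
have pp := Xprime_prime ln; have pp' := Xprime_prime ln'.
have cd := cov_iso_card iso; rewrite !X_card // in cd.
have lg m : listed m -> (0 < Xlog m)%N.
  by case: m => [||||p l l'|p|k|k|k|k p l l'|k|k c p l l'|k p] //=;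
    do ?[case/and4P=> ? ? _ _ | case/and3P=> ? _ _ | case/andP=> ? _ | move=> ?]; lia.
have ep : Xprime n = Xprime n'.
  have : (Xprime n %| Xprime n' ^ Xlog n')%N by rewrite -cd dvdn_exp // lg.
  by rewrite Euclid_dvdX // => /andP[]; rewrite dvdn_prime2 // => /eqP.
have el : Xlog n = Xlog n'.
  by move/eqP: cd; rewrite ep eqn_exp2l ?prime_gt1 // => /eqP.
have le m m' : listed m -> listed m' -> Xprime m = Xprime m' ->
    cov_iso (vcover (reduced (Xt m))) (vcover (reduced (Xt m'))) -> (Xexp m' <= Xexp m)%N.
  move=> lm lm' e i; have [k1 _] := X_exp lm; have [_ [k2 k3]] := X_exp lm'.
  have := Zprod_kill (listed_Xm lm') (cov_iso_kill i (X_surj lm') k1) k3.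
  by rewrite k2 e dvdn_Pexp2l // prime_gt1 // Xprime_prime.
have ee : Xexp n = Xexp n'.
  apply/eqP; rewrite eqn_leq (le _ _ ln' ln (esym ep) (cov_iso_sym iso)).
  by rewrite (le _ _ ln ln' ep iso).
have noniso m m' x y : listed m -> listed m' -> Xd m = Xd m' -> (0 < Xd m)%ZZ ->
    XP m = Peven 1 1 -> XP m' = Peven x y -> (x, y) \in [:: (1, 0); (0, 1)]%ZZ ->
    cov_iso (vcover (reduced (Xt m))) (vcover (reduced (Xt m'))) -> False.
  move=> lm lm' ed d0 e e' xy; apply: (parity_noniso d0 xy).
    by rewrite -e; apply: X_Kform.
  by rewrite ed -e'; apply: X_Kform.
have n25 p : pm1_prime p -> p <> 2%N /\ p <> 5%N.
  by move=> pm; have [p5 op] := not5 pm; split=> // p2; rewrite p2 in op.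
have p20 k : (0 < zpow 2 k)%ZZ by apply: zpow_gt0.
case: n ln iso cd ep el ee pp => [||||p l l'|p|k|k|k|k p l l'|k|k c p l l'|k p] ln iso cd ep el ee pp;
case: n' ln' iso cd ep el ee pp' => [||||q r r'|q|j|j|j|j q r r'|j|j d q r r'|j q] ln' iso cd ep el ee pp';
  rewrite /Xprime /Xlog /Xexp in ep el ee; try (by left);
  try (by exfalso; move: (ln) (ln') => /=; do ?[case/and4P=> ? ? /n25[? ?] _ | case/and3P=> ? /n25[? ?] _
     | case/andP=> /n25[? ?] _ | case/andP=> ? _ | move=> ?]; lia).
- by case: (noniso _ _ 1%ZZ 0%ZZ ln ln' erefl (p20 0%N) erefl erefl isT iso).
- by case: (noniso _ _ 1%ZZ 0%ZZ ln' ln erefl (p20 0%N) erefl erefl isT (cov_iso_sym iso)).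
- move: ln ln' => /= /andP[pm r1] /andP[_ r2]; rewrite -ep in r2 *.
  have := two_roots_uniq pm (isT : 0 < 1)%N; rewrite expn1 => /(_ _ _ _ _ r1 r2).
  by case=> -[-> ->]; [left | right].
- by rewrite ep; left.
- by rewrite ee; left.
- by subst j; case: (noniso _ _ 0%ZZ 1%ZZ ln ln' erefl (p20 _) erefl erefl isT iso).
- by subst j; case: (noniso _ _ 0%ZZ 1%ZZ ln' ln erefl (p20 _) erefl erefl isT (cov_iso_sym iso)).
- by rewrite ee; left.
- by rewrite ee; left.
- move: ln ln' => /= /and3P[k1 pm r1] /and3P[_ _ r2]; rewrite -ep -ee in r2 *.
  have k0 : (0 < k)%N by lia.
  by case: (two_roots_uniq pm k0 r1 r2) => -[-> ->]; [left | right].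
- by rewrite ee; left.
- move: ln ln' => /= /and4P[k1 ck pm r1] /and4P[_ _ _ r2]; rewrite -ep -ee in r2 *.
  have ed : d = c by lia.
  rewrite ed in r2 *; have k0 : (0 < k - c)%N by lia.
  by case: (two_roots_uniq pm k0 r1 r2) => -[-> ->]; [left | right].
by rewrite ee ep; left.
Qed.

(** * Transitivity of the listed coverings *)

Section KformInv.
Variables (A : finZmodType) (a : 6.-tuple A) (d : Z) (P : Z -> Z -> Z -> Z -> Z -> Z -> Prop).
Hypothesis ka : Kform a d P.

Lemma Kform_rho1 : (forall h1 h2 h3 h4 h5 h6, P h1 h2 h3 h4 h5 h6 ->
    P (- h3) (- h4) h5 (- h6) (- h1) h2)%ZZ -> invariant a rho1.
Proof.
move=> PP h /V6P[h1 [h2 [h3 [h4 [h5 [h6 ->]]]]]] /ka.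
move=> [k1 [k2 [k3 [k4 [k5 [k6 [[-> -> -> [-> -> ->]] /PP p]]]]]]].
rewrite mulM_rho1; apply/ka; do 6 eexists; split; last exact: p.
by split; last split; lia.
Qed.

Lemma Kform_rho2 : (forall h1 h2 h3 h4 h5 h6, P h1 h2 h3 h4 h5 h6 ->
    P h4 h5 (h5 - h6) (- h2 + h3 - h5 + h6) (- h1 - h3 - h4 - h6) (- h3 - h4))%ZZ ->
  invariant a rho2.
Proof.
move=> PP h /V6P[h1 [h2 [h3 [h4 [h5 [h6 ->]]]]]] /ka.
move=> [k1 [k2 [k3 [k4 [k5 [k6 [[-> -> -> [-> -> ->]] /PP p]]]]]]].
rewrite mulM_rho2; apply/ka; do 6 eexists; split; last exact: p.
by split; last split; lia.
Qed.

Lemma Kform_tau : (forall h1 h2 h3 h4 h5 h6, P h1 h2 h3 h4 h5 h6 ->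
    P h2 h1 (- h6) h5 h4 (- h3))%ZZ -> invariant a tau.
Proof.
move=> PP h /V6P[h1 [h2 [h3 [h4 [h5 [h6 ->]]]]]] /ka.
move=> [k1 [k2 [k3 [k4 [k5 [k6 [[-> -> -> [-> -> ->]] /PP p]]]]]]].
rewrite mulM_tau; apply/ka; do 6 eexists; split; last exact: p.
by split; last split; lia.
Qed.

End KformInv.

Lemma Peven_inv x y :
  (forall h1 h2 h3 h4 h5 h6, Peven x y h1 h2 h3 h4 h5 h6 ->
    Peven x y (- h3) (- h4) h5 (- h6) (- h1) h2)%ZZ /\
  (forall h1 h2 h3 h4 h5 h6, Peven x y h1 h2 h3 h4 h5 h6 ->
    Peven x y h4 h5 (h5 - h6) (- h2 + h3 - h5 + h6) (- h1 - h3 - h4 - h6) (- h3 - h4))%ZZ.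
Proof.
split=> h1 h2 h3 h4 h5 h6 [q e].
  by exists (q - x * (h1 + h3) - y * (h4 + h6))%ZZ; lia.
by exists (q - x * (h1 + h3 + h6) - y * (h2 + h4))%ZZ; lia.
Qed.

Lemma PL_inv M l : Z.divide M (l * l - l - 1) ->
  (forall h1 h2 h3 h4 h5 h6, PL M l h1 h2 h3 h4 h5 h6 ->
    PL M l (- h3) (- h4) h5 (- h6) (- h1) h2)%ZZ /\
  (forall h1 h2 h3 h4 h5 h6, PL M l h1 h2 h3 h4 h5 h6 ->
    PL M l h4 h5 (h5 - h6) (- h2 + h3 - h5 + h6) (- h1 - h3 - h4 - h6) (- h3 - h4))%ZZ.
Proof.
move=> rt; split=> h1 h2 h3 h4 h5 h6 [d1 d2 d3]; split.
- have := divide_lin (- l) 1 (1 - l) (- h3) d1 d2 d3 rt.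
  by congr (Z.divide _ _); rewrite /F1 /F2 /F3; ring.
- have := divide_lin (- l) 0 (-1) (h4 + h5) d1 d2 d3 rt.
  by congr (Z.divide _ _); rewrite /F1 /F2 /F3; ring.
- have := divide_lin l 0 l h3 d1 d2 d3 rt.
  by congr (Z.divide _ _); rewrite /F1 /F2 /F3; ring.
- have := divide_lin 0 (- l) (1 - l) (- h5) d1 d2 d3 rt.
  by congr (Z.divide _ _); rewrite /F1 /F2 /F3; ring.
- have := divide_lin 0 (- l) (-1) (h3 + h4) d1 d2 d3 rt.
  by congr (Z.divide _ _); rewrite /F1 /F2 /F3; ring.
- have := divide_lin l l l (- h4) d1 d2 d3 rt.
  by congr (Z.divide _ _); rewrite /F1 /F2 /F3; ring.
Qed.

Lemma X_lifts n : listed n -> lifts (Xt n) rho1 /\ lifts (Xt n) rho2.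
Proof.
move=> ln; have kx := X_Kform ln; have su := X_surj ln.
suff [P1 P2] : (forall h1 h2 h3 h4 h5 h6, XP n h1 h2 h3 h4 h5 h6 ->
      XP n (- h3) (- h4) h5 (- h6) (- h1) h2)%ZZ /\
    (forall h1 h2 h3 h4 h5 h6, XP n h1 h2 h3 h4 h5 h6 ->
      XP n h4 h5 (h5 - h6) (- h2 + h3 - h5 + h6) (- h1 - h3 - h4 - h6) (- h3 - h4))%ZZ.
  split; [apply: (invariant_lifts rho1_aut su _ ordM_rho1) |
          apply: (invariant_lifts rho2_aut su _ ordM_rho2)].
    exact: (Kform_rho1 kx).
  exact: (Kform_rho2 kx).
have both : (forall h1 h2 h3 h4 h5 h6, Pboth h1 h2 h3 h4 h5 h6 ->
      Pboth (- h3) (- h4) h5 (- h6) (- h1) h2)%ZZ /\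
    (forall h1 h2 h3 h4 h5 h6, Pboth h1 h2 h3 h4 h5 h6 ->
      Pboth h4 h5 (h5 - h6) (- h2 + h3 - h5 + h6) (- h1 - h3 - h4 - h6) (- h3 - h4))%ZZ.
  split=> h1 h2 h3 h4 h5 h6 [[q e] [q' e']]; split.
  - by exists (q - h1 - h3)%ZZ; lia.
  - by exists (q' - h4 - h6)%ZZ; lia.
  - by exists (q - h1 - h3 - h6)%ZZ; lia.
  by exists (q' - h2 - h4)%ZZ; lia.
have r5 : Z.divide (zpow 5 1) (3 * 3 - 3 - 1) by exists 1%ZZ.
have lr N l l' : (1 < N)%N -> two_roots N l l' ->
    Z.divide (Z.of_nat N) (Z.of_nat l * Z.of_nat l - Z.of_nat l - 1).
  by move=> N1 /(two_rootsP N1)[].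
case: n ln {kx su} => [||||p l l'|p|k|k|k|k p l l'|k|k c p l l'|k p] ln;
  rewrite /XP; try exact: Peven_inv; try exact: both; try exact: (PL_inv r5); try by [].
- case/andP: ln => /andP[pp _] rt; apply: PL_inv; rewrite /zpow expn1; apply: lr rt.
  exact: prime_gt1.
- case/and3P: ln => k1 /andP[pp _] rt; apply: PL_inv; apply: lr rt.
  by rewrite -[1%N](exp1n k) ltn_exp2r ?prime_gt1 //; lia.
case/and4P: ln => k1 ck /andP[pp _] rt; apply: PL_inv; apply: lr rt.
by rewrite -[1%N](exp1n (k - c)) ltn_exp2r ?prime_gt1 //; lia.
Qed.

Lemma X_trans3 n : listed n -> (forall h1 h2 h3 h4 h5 h6, XP n h1 h2 h3 h4 h5 h6 ->
    XP n h2 h1 (- h6) h5 h4 (- h3))%ZZ -> s_arc_transitive 3 (X n).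
Proof.
move=> ln pt; rewrite XE; have [h1 h2] := X_lifts ln; apply: lifts_trans3 => //.
apply: (invariant_lifts tau_aut (X_surj ln) _ ordM_tau).
exact: (Kform_tau (X_Kform ln) pt).
Qed.

Lemma X_trans2 n : listed n -> s_arc_transitive 2 (X n).
Proof. by move=> ln; rewrite XE; have [h1 h2] := X_lifts ln; apply: lifts_trans2. Qed.

(** The first excluded vector is a generator in [h2gens] and rules out [small]; then
    3-arc-transitivity would lift [tau], against the second. *)
Lemma X_not3 n h1 h2 h3 h4 h5 h6 : listed n -> ~ Kx (Xt n) 1 0 (-1) 0 0 0 ->
  Kx (Xt n) h1 h2 h3 h4 h5 h6 -> ~ Kx (Xt n) h2 h1 (- h6) h5 h4 (- h3) ->
  ~ s_arc_transitive 3 (X n).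
Proof.
move=> ln ns k nk; rewrite XE => tr; have conn := surj_connected (X_surj ln).
case: (trans3_tau conn tr) => [sm|lt]; first by apply: ns; apply: sm.
by apply: nk; rewrite /Kx -mulM_tau; apply: (lifts_invariant tau_aut lt).
Qed.

Lemma X'k1_not3 k : listed (X'k1_2_6 k) -> ~ s_arc_transitive 3 (X (X'k1_2_6 k)).
Proof.
move=> ln; have kx := X_Kform ln; rewrite /Xd /XP in kx.
have d0 := zpow_gt0 k.-1 (isT : prime 2).
have d1 : (1 < zpow 2 k.-1)%ZZ.
  move: ln => /= k1; have : (1 < 2 ^ k.-1)%N by rewrite -[1%N](exp1n k.-1) ltn_exp2r //; lia.
  by rewrite /zpow; lia.
(* [tau] takes this multiple of the first basis vector to the same multiple of the second, which
   violates the parity condition. *)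
apply: (@X_not3 _ (zpow 2 k.-1) 0 0 0 0 0) => //.
- move/kx=> [k1 [k2 [k3 [k4 [k5 [k6 [[e _ _ _] _]]]]]]].
  have /Z.divide_1_r : Z.divide (zpow 2 k.-1) 1 by exists k1; lia.
  by lia.
- by apply/kx; exists 1%ZZ, 0%ZZ, 0%ZZ, 0%ZZ, 0%ZZ, 0%ZZ; split; [split; last split; lia | exists 0%ZZ].
move/kx=> [k1 [k2 [k3 [k4 [k5 [k6 [[_ e _ [e4 _ e6]] [q eq]]]]]]]].
have f2 : k2 = 1%ZZ by apply: (Z.mul_reg_l _ _ (zpow 2 k.-1)); lia.
have f4 : k4 = 0%ZZ by apply: (Z.mul_reg_l _ _ (zpow 2 k.-1)); lia.
have f6 : k6 = 0%ZZ by apply: (Z.mul_reg_l _ _ (zpow 2 k.-1)); lia.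
by rewrite f2 f4 f6 in eq; lia.
Qed.

Lemma PL_not3 n p c m l l' : listed n -> pm1_prime p -> (0 < m)%N ->
  two_roots (p ^ m) l l' -> Xd n = zpow p c -> XP n = PL (zpow p m) (Z.of_nat l) ->
  ~ s_arc_transitive 3 (X n).
Proof.
move=> ln pm m0 rt ed eP; have kx := X_Kform ln; rewrite ed eP in kx.
have pp := proj1 (andP pm); have [p5 op] := not5 pm.
have N1 : (1 < p ^ m)%N by rewrite -[1%N](exp1n m) ltn_exp2r // prime_gt1.
have [l1 l2 ll' r1 r2] := two_rootsP N1 rt; have [s es] := two_roots_sum pm m0 rt.
have d0 := zpow_gt0 c pp; set D := zpow p c in kx d0.
pose L := Z.of_nat l; pose L' := Z.of_nat l'.
have can u v : (D * u = D * v)%ZZ -> u = v by move=> h; apply: (Z.mul_reg_l _ _ D); lia.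
(* At (L, 1 - L, 1, 0, 0, -1) the three forms vanish as integers. After [tau] the form [F3] becomes
   1 - 2 L, congruent to L' - L and so not 0. *)
apply: (@X_not3 _ (D * L) (D * (1 - L)) D 0 0 (- D)) => //.
- move/kx=> [k1 [k2 [k3 [k4 [k5 [k6 [[e1 e2 e3 [e4 e5 e6]] [[q1 f1] _ _]]]]]]]].
  have z4 : k4 = 0%ZZ by apply: can; lia.
  have z5 : k5 = 0%ZZ by apply: can; lia.
  have z6 : k6 = 0%ZZ by apply: can; lia.
  rewrite /F1 z4 z5 z6 in f1; have f : (k3 = q1 * zpow p m)%ZZ by lia.
  have : (D * q1 * zpow p m = -1)%ZZ by rewrite -Z.mul_assoc -f; lia.
  have : (1 < zpow p m)%ZZ by rewrite /zpow; lia.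
  move=> M1 eM; have /Z.divide_1_r : Z.divide (zpow p m) 1 by exists (- (D * q1))%ZZ; lia.
  by lia.
- apply/kx; exists L, (1 - L)%ZZ, 1%ZZ, 0%ZZ, 0%ZZ, (-1)%ZZ; split.
    by split; last split; lia.
  by rewrite /PL /F1 /F2 /F3 -/L; split; exists 0%ZZ; lia.
move/kx=> [k1 [k2 [k3 [k4 [k5 [k6 [[e1 e2 e3 [e4 e5 e6]] [_ _ [q f]]]]]]]]].
have z1 : k1 = (1 - L)%ZZ by apply: can.
have z3 : k3 = 1%ZZ by apply: can; lia.
have z4 : k4 = 0%ZZ by apply: can; lia.
have z5 : k5 = 0%ZZ by apply: can; lia.
rewrite /F3 z1 z3 z4 z5 -/L in f; case: ll'.
have g : (L' - L = (s + q) * zpow p m)%ZZ by rewrite /L /L' in f es *; lia.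
have l1' : (0 <= L < zpow p m)%ZZ by rewrite /L /zpow; lia.
have l2' : (0 <= L' < zpow p m)%ZZ by rewrite /L' /zpow; lia.
suff : L = L' by rewrite /L /L'; lia.
move: (zpow p m) (s + q)%ZZ g l1' l2' => M w g l1' l2'.
have [w0|[w1|w1]] : (w = 0 \/ 1 <= w \/ w <= -1)%ZZ by lia.
- by rewrite w0 in g; lia.
- by exfalso; nia.
by exfalso; nia.
Qed.

(** * Covering transformations of voltage coverings *)

Section Translations.
Variables (B : finZmodType) (b : 6.-tuple B).
Hypothesis su : phi_surj b.
Local Notation C := (vcover (reduced b)).

Lemma tr_inj (c : B) : injective (fun y : petersen * B => (y.1, c + y.2)).
Proof. by move=> [u x] [v y] [-> /addrI ->]. Qed.

Definition trans (c : B) : {perm C} := perm (@tr_inj c).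

Lemma transE c (y : C) : trans c y = (y.1, c + y.2).
Proof. by rewrite permE. Qed.

Lemma trans_in c : trans c \in cov_trans C.
Proof.
apply/cov_transP; split=> [|x]; last by rewrite transE.
apply/aut1P=> -[u x] [v y]; rewrite !transE /= /vadj /=; congr (_ && _).
by rewrite addrCA (inj_eq (addrI c)).
Qed.

(** Unique lifting of paths, carried along a path from [x]. *)
Lemma cov_trans_eq (s t : {perm C}) x : s \in cov_trans C -> t \in cov_trans C ->
  s x = t x -> s = t.
Proof.
move=> /cov_transP[/aut1P sA sc] /cov_transP[/aut1P tA tc] e; apply/permP=> y.
have /connectP[p + ->] := surj_connected su x y.
elim: p x e => //= z p IH x e /andP[xz zp]; apply: (IH z) zp.
have h1 : adj (s x) (s z) by rewrite sA.
have h2 : adj (s x) (t z) by rewrite e tA.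
by apply: (lft_uniq h1 h2); rewrite sc tc.
Qed.

Lemma cov_trans_trans s : s \in cov_trans C -> exists c, s = trans c.
Proof.
move=> sC; pose y : C := (vx p0, 0); exists (s y).2.
apply: (@cov_trans_eq _ _ y) => //; first exact: trans_in.
have /cov_transP[_ /(_ y) e] := sC.
have e' : (s y).1 = y.1 := e.
by rewrite transE -e' [y.2](_ : _ = 0) // addr0; case: (s y).
Qed.

Lemma vcover_regular : abelian_regular C.
Proof.
split.
  move=> x y e; exists (trans (y.2 - x.2)); split.
    split; first exact: trans_in.
    by rewrite transE subrK -[x.1]/(cmap C x) e; case: (y).
  move=> s [sC sx]; apply: (@cov_trans_eq _ _ x) => //; first exact: trans_in.
  by rewrite sx transE subrK -[x.1]/(cmap C x) e; case: (y).
apply/centsP=> s /cov_trans_trans[c ->] t /cov_trans_trans[d ->].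
by apply/permP=> y; rewrite !permM !transE /= addrCA.
Qed.

Lemma card_cov_trans : #|cov_trans C| = #|B|.
Proof.
have inj : injective trans.
  move=> c d /permP/(_ (vx p0, 0)); rewrite !transE /= !addr0 => h.
  exact: (congr1 snd h).
rewrite -[RHS](card_imset (mem B) inj); apply: eq_card => s; apply/idP/imsetP.
  by case/cov_trans_trans=> c ->; exists c.
by case=> c _ ->; apply: trans_in.
Qed.

Lemma vcover_primary p e : prime p -> (forall x : B, x *+ p ^ e = 0) -> (1 < #|B|)%N ->
  p_primary p C.
Proof.
move=> pp kill B1; split=> //.
  rewrite /pgroup card_cov_trans -cardsT; apply/pgroupP => q pq dq.
  have [x _ ox] := Cauchy pq dq; rewrite inE /=.
  have : (#[x]%g %| p ^ e)%N by rewrite order_dvdn FinRing.zmodXgE kill.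
  by rewrite ox Euclid_dvdX // dvdn_prime2 // => /andP[/eqP ->].
move=> e1; have := card_cov_trans; rewrite e1 cards1 => h.
by rewrite -h in B1.
Qed.

End Translations.

(** * Decomposition into primary coverings *)

Section Torsion.
Variables (A : finZmodType) (q : nat).

Definition tors : {set A} := [set x | x *+ q == 0].

Lemma tors_group : group_set tors.
Proof.
apply/group_setP; split; first by rewrite inE FinRing.zmod1gE mul0rn.
by move=> x y; rewrite !inE FinRing.zmodMgE mulrnDl => /eqP-> /eqP->; rewrite addr0.
Qed.

Definition torsg : {group A} := Group tors_group.

Lemma tors_abelian : abelian torsg.
Proof. exact: FinRing.zmod_abelian. Qed.

Definition TA : finZmodType := zsub tors_abelian.

Definition torv (x : TA) : A := sgval (x : [subg torsg]).
Definition tsub (x : A) : TA := subg torsg x.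

Arguments torv : simpl never.

Lemma tsubK x : x *+ q = 0 -> torv (tsub x) = x.
Proof. by move=> e; rewrite /torv /tsub subgK // inE e. Qed.

Lemma torv_inj : injective torv. Proof. exact: val_inj. Qed.

Lemma torvq x : torv x *+ q = 0.
Proof. by have := subgP (x : [subg torsg]); rewrite inE => /eqP. Qed.

Lemma torvD x y : torv (x + y) = torv x + torv y.
Proof. by []. Qed.

Lemma torv0 : torv 0 = 0.
Proof. by []. Qed.

Lemma torvM x n : torv (x *+ n) = torv x *+ n.
Proof. by elim: n => [|n IH]; rewrite ?torv0 // !mulrS torvD IH. Qed.

Lemma torvN x : torv (- x) = - torv x.
Proof. by apply/eqP; rewrite -addr_eq0 -torvD addNr. Qed.

End Torsion.

Section Primary.
Variables (A : finZmodType) (a : 6.-tuple A) (p : nat).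
Hypotheses (su : phi_surj a) (pp : prime p) (pA : (p %| #|A|)%N).
Let q := (#|A|`_p)%N.
Let r := (#|A|`_p^')%N.

Lemma qr : (q * r = #|A|)%N.
Proof. by rewrite partnC // -cardsT cardG_gt0. Qed.

Lemma killr (x : A) : x *+ r *+ q = 0.
Proof. by rewrite -mulrnA mulnC qr card_kill. Qed.

(** Multiplication by the p'-part of the order kills the p'-part of A and is an automorphism of its
    p-part. *)
Definition pri : 6.-tuple (TA A q) := map_tuple (fun x => tsub q (x *+ r)) a.


Lemma torv_phil (s : seq A) h :
  torv (phil [seq tsub q (x *+ r) | x <- s] h) = phil s h *+ r.
Proof.
have pc (D : finZmodType) (y : D) l w k : phil (y :: l) (w :: k) = y *~ iz w + phil l k by [].
elim: s h => [|x s IH] [|z h]; try by rewrite [phil _ _ in RHS]/= mul0rn.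
rewrite map_cons !pc torvD IH mulrnDl; congr (_ + _).
have tz (y : TA A q) n : torv (y *~ n) = torv y *~ n.
  by case: n => n; rewrite ?NegzE ?mulrNz -!pmulrn ?torvN torvM.
by rewrite tz tsubK ?killr // !pmulrn -!mulrzA mulrC.
Qed.

Lemma torv_phi h : torv (phi pri h) = phi a h *+ r.
Proof. exact: torv_phil. Qed.

Lemma pri_unit : exists u, forall y : A, y *+ q = 0 -> y *+ (r * u) = y.
Proof.
have co : coprime r q by rewrite coprime_sym /q /r coprime_partC.
have q0 : (0 < r)%N by rewrite part_gt0.
have [u v e _] := egcdnP q q0.
exists u => y yq; have -> : (r * u = v * q + 1)%N by rewrite mulnC e (eqP co).
by rewrite mulrnDr mulr1n mulnC mulrnA yq mul0rn add0r.
Qed.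

Lemma pri_surj : phi_surj pri.
Proof.
move=> y; have [u hu] := pri_unit; have [h /andP[sh /eqP ph]] := su (torv y *+ u).
exists h; rewrite sh /=; apply/eqP/torv_inj; rewrite torv_phi ph -mulrnA mulnC hu //.
exact: torvq.
Qed.

Lemma pri_invariant s : invariant a s -> invariant pri s.
Proof.
move=> inv h sh e; apply: torv_inj; rewrite torv_phi torv0.
have := @invariant_scale _ a s r inv h sh; rewrite !phi_scale; apply.
by rewrite -torv_phi e.
Qed.

Lemma pri_primary : p_primary p (vcover (reduced pri)).
Proof.
have qE : q = (p ^ logn p #|A|)%N by rewrite /q p_part.
apply: (vcover_primary pri_surj (e := logn p #|A|)) => // [x|].
  by apply: torv_inj; rewrite torvM torv0 -qE torvq.
have pA' : (p %| #|[set: A]%G|)%N by rewrite /= cardsT.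
have [x _ ox] := Cauchy pp pA'.
have xp : x *+ p = 0 by rewrite -FinRing.zmodXgE -ox expg_order.
have xq : x *+ q = 0.
  have l0 : (0 < logn p #|A|)%N by rewrite logn_gt0 mem_primes pp pA -cardsT cardG_gt0.
  by rewrite qE -(prednK l0) expnS mulrnA xp mul0rn.
apply/card_gt1P; exists (tsub q x), 0; split=> //; apply/eqP=> e.
have := tsubK xq; rewrite e torv0 => x0; move: ox; rewrite -x0 order1 => e1.
by have := pp; rewrite -e1.
Qed.

End Primary.

Section Fibered.
Variables (A : finZmodType) (a : 6.-tuple A).
Local Notation N := #|A|.
Local Notation m := (size (primes N)).

Definition fp (i : 'I_m) : nat := nth 0%N (primes N) i.

Lemma fpP i : [/\ prime (fp i), (fp i %| N)%N & fp i \in primes N].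
Proof.
have h : fp i \in primes N by apply: mem_nth.
by split=> //; move: h; rewrite mem_primes => /and3P[].
Qed.

Lemma fp_inj : injective fp.
Proof.
move=> i j e; apply: val_inj; apply/eqP.
by rewrite -(nth_uniq 0%N (ltn_ord i) (ltn_ord j) (primes_uniq N)); apply/eqP.
Qed.

Definition fA (i : 'I_m) : finZmodType := TA A N`_(fp i).
Definition fphi (i : 'I_m) : voltage petersen (fA i) := reduced (pri a (fp i)).

Definition fmap (x : A) : dprodz fA := [ffun i => tsub N`_(fp i) (x *+ N`_(fp i)^') : fA i].

Lemma fmapE x i : torv (fmap x i) = x *+ N`_(fp i)^'.
Proof. by rewrite ffunE tsubK // killr. Qed.

Lemma fmapD x y : fmap (x + y) = fmap x + fmap y.
Proof.
apply/ffunP=> i; apply: torv_inj; rewrite fmapE [(fmap x + fmap y) i]ffunE torvD !fmapE.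
by rewrite mulrnDl.
Qed.

Lemma N_gt0 : (0 < N)%N. Proof. by rewrite -cardsT cardG_gt0. Qed.

(** The order of an element with trivial image divides the p'-part of the order of A for every prime
    p, so it is 1. *)
Lemma fmap_inj : injective fmap.
Proof.
move=> x y e; apply/eqP; rewrite -subr_eq0; apply/eqP; set z := x - y.
have zi i : z *+ N`_(fp i)^' = 0.
  rewrite /z mulrnBl -!fmapE e subrr //.
have oN : (#[z]%g %| N)%N by rewrite order_dvdn FinRing.zmodXgE card_kill.
suff o1 : #[z]%g = 1%N.
  by have := expg_order z; rewrite o1 FinRing.zmodXgE mulr1n.
apply/eqP; rewrite -[_ == _]negbK; apply/negP=> n1.
have o2 : (1 < #[z]%g)%N by rewrite ltn_neqAle eq_sym n1 order_gt0.
have pd := pdiv_prime o2; have dN := dvdn_trans (pdiv_dvd #[z]%g) oN.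
have pin : pdiv #[z]%g \in primes N by rewrite mem_primes pd N_gt0 dN.
have [i ei] : exists i, fp i = pdiv #[z]%g.
  have li : (index (pdiv #[z]%g) (primes N) < m)%N by rewrite index_mem.
  by exists (Ordinal li); rewrite /fp nth_index.
have : (pdiv #[z]%g %| N`_(fp i)^')%N.
  by apply: dvdn_trans (pdiv_dvd _) _; rewrite order_dvdn FinRing.zmodXgE zi.
have := part_pnat (fp i)^' N => /pnatP-/(_ (part_gt0 _ _)) h /(h _ pd).
by rewrite inE /= ei inE eqxx.
Qed.

Lemma fmap_surj y : exists x, fmap x == y.
Proof.
have U i : exists u, forall x : A, x *+ N`_(fp i) = 0 -> x *+ (N`_(fp i)^' * u) = x.
  by have [pp _ _] := fpP i; have [u hu] := pri_unit A (fp i); exists u.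
have [u hu] : exists u : 'I_m -> nat, forall i (x : A), x *+ N`_(fp i) = 0 ->
    x *+ (N`_(fp i)^' * u i) = x.
  (* The property is made boolean so that [xchoose] can pick the multipliers for all [i] at once. *)
  have V i : exists n, [forall x : A, (x *+ N`_(fp i) == 0) ==> (x *+ (N`_(fp i)^' * n) == x)].
    have [n hn] := U i; exists n; apply/forallP=> x; apply/implyP=> /eqP h; apply/eqP; exact: hn.
  exists (fun i => xchoose (V i)) => i x h; apply/eqP.
  by have /forallP/(_ x)/implyP := xchooseP (V i); apply; apply/eqP.
(* [u i] inverts the p'-part on the i-th Sylow subgroup. The other summands vanish, since the part
   of the order at another prime divides this p'-part. *)
exists (\sum_i torv (y i) *+ u i); apply/eqP/ffunP=> i; apply: torv_inj; rewrite fmapE.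
rewrite (bigD1 i) //= mulrnDl -mulrnA mulnC hu ?torvq // -[RHS]addr0; congr (_ + _).
rewrite -sumrMnl big1 // => j ji; rewrite -mulrnA mulnC mulrnA.
have dv : (N`_(fp j) %| N`_(fp i)^')%N.
  have [pj _ _] := fpP j; have [pi _ _] := fpP i.
  rewrite -(partn_part N (pi := fp j) (rho := (fp i)^')).
    exact: dvdn_part.
  move=> k; rewrite !inE => /eqP ->; apply/eqP=> e; case/eqP: ji; exact: fp_inj.
by case/dvdnP: dv => t ->; rewrite [(t * _)%N]mulnC mulrnA torvq !mul0rn.
Qed.

Lemma fmap_volt u v : fmap (reduced a u v) = fibered_volt fphi u v.
Proof.
apply/ffunP=> i; apply: torv_inj; rewrite fmapE [in RHS]ffunE.
rewrite -[fphi i u v]/(nth 0 (pri a (fp i)) (index ((u : nat), (v : nat)) cotree) -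
  nth 0 (pri a (fp i)) (index ((v : nat), (u : nat)) cotree)).
have e k : torv (nth 0 (pri a (fp i)) k) = nth 0 a k *+ N`_(fp i)^'.
  have [lk|lk] := ltnP k 6.
    by rewrite (nth_map 0) ?size_tuple // tsubK // killr.
  by rewrite !nth_default ?size_tuple // torv0 mul0rn.
by rewrite torvD torvN !e -mulrnBl.
Qed.

Lemma fibered_iso : cov_iso (vcover (reduced a)) (fibered_product fphi).
Proof.
exists 1%g; first exact: aut_id.
exists (fun y => (y.1, fmap y.2)); split; last by move=> y; rewrite perm1.
  exists (fun y => (y.1, xchoose (fmap_surj y.2))) => -[v x] /=; congr pair.
    by apply: fmap_inj; apply/eqP; apply: (xchooseP (fmap_surj (fmap x))).
  by apply/eqP; apply: (xchooseP (fmap_surj x)).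
move=> [u x] [v y] /=; rewrite /vadj /=; congr (_ && _).
by rewrite -fmap_volt -fmapD (inj_eq fmap_inj).
Qed.

End Fibered.

Lemma arc_transitive_voltage (C : covering petersen) : connected C -> arc_transitive C ->
  abelian_regular C -> exists (A : finZmodType) (a : 6.-tuple A),
    [/\ cov_iso C (vcover (reduced a)), #|A| = #|cov_trans C|, phi_surj a,
        lifts a rho1 & lifts a rho2].
Proof.
move=> conn tr reg; have [A [a [iso cA]]] := regular_voltage reg.
case: (iso) => _ _ [f [fb fadj _]].
have conn' : connected (vg a) := iso_connected fb fadj conn.
have tr' : arc_transitive (vg a) := iso_sarc_transitive fb fadj tr.
have [h1 h2] := arc_transitive_lifts conn' tr'.
by exists A, a; split=> //; apply: connected_surj.
Qed.

Theorem theorem4p4 :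
  (* the classification of the primary coverings; X^+ and X^- are counted as
     one, since they are isomorphic coverings *)
  (forall C : covering petersen,
     connected C -> arc_transitive C -> abelian_regular C -> primary C ->
     exists n : Xname,
       [/\ listed n,
           cov_iso C (X n) &
           forall n' : Xname, listed n' -> cov_iso C (X n') ->
             n' = n \/ n' = opposite_sign n]) /\
  (* s-arc-transitivity in the second list *)
  [/\ forall k, listed (Xk1_2_6 k) -> s_arc_transitive 3 (X (Xk1_2_6 k)),
      forall k, listed (Xk2_2_6 k) -> s_arc_transitive 3 (X (Xk2_2_6 k)),
      forall k, listed (Xk3_5_6 k) -> s_arc_transitive 3 (X (Xk3_5_6 k)) &
      forall k p, listed (Xk6_p_6 k p) ->
        s_arc_transitive 3 (X (Xk6_p_6 k p))] /\
  [/\ forall k, listed (X'k1_2_6 k) ->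
        s_arc_transitive 2 (X (X'k1_2_6 k)) /\
        ~ s_arc_transitive 3 (X (X'k1_2_6 k)),
      forall k p l l', listed (Xk3_p_3 k p l l') ->
        s_arc_transitive 2 (X (Xk3_p_3 k p l l')) /\
        ~ s_arc_transitive 3 (X (Xk3_p_3 k p l l')) &
      forall k c p l l', listed (Xkc3_p_6 k c p l l') ->
        s_arc_transitive 2 (X (Xkc3_p_6 k c p l l')) /\
        ~ s_arc_transitive 3 (X (Xkc3_p_6 k c p l l'))] /\
  (* fibered products *)
  (forall C : covering petersen,
     connected C -> arc_transitive C -> abelian_regular C ->
     exists (m : nat) (p : 'I_m -> nat) (A : 'I_m -> finZmodType)
            (phi : forall i, voltage petersen (A i)),
       [/\ injective p,
           forall i, [/\ connected (vcover (phi i)),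
                         arc_transitive (vcover (phi i)),
                         abelian_regular (vcover (phi i)) &
                         p_primary (p i) (vcover (phi i))] &
           cov_iso C (fibered_product phi)]).
Proof.
split; [|split; [|split]].
- move=> C conn tr reg [p [pp pg nt]].
  have [A [a [iso cA su l1 l2]]] := arc_transitive_voltage conn tr reg.
  have [e ce] : exists e, #|A| = (p ^ e)%N.
    by rewrite cA; have /p_natP[e] := pg; exists e.
  have A1 : (1 < #|A|)%N.
    rewrite cA ltnNge; apply/negP=> le1; apply: nt; apply/eqP; rewrite eq_sym.
    rewrite eqEcard cards1 le1 andbT sub1set; apply: (group1 (ctg C)).
  have [n ln ison] := kernel_listed pp ce A1 su (lifts_invariant rho1_aut l1)
    (lifts_invariant rho2_aut l2).
  have isoC := cov_iso_trans iso ison; exists n; split=> // n' ln' iso'.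
  by apply: X_uniq => //; apply: cov_iso_trans (cov_iso_sym isoC) iso'.
- split=> [k|k|k|k p] ln; apply: X_trans3 => // h1 h2 h3 h4 h5 h6; rewrite /XP.
  + by case=> q e; exists (q - h3 - h6)%ZZ; lia.
  + by case=> [[q e] [q' e']]; split; [exists (q' - h6)%ZZ | exists (q - h3)%ZZ]; lia.
  (* [tau] replaces the root l by 1 - l, and 1 - 3 is 3 modulo 5. *)
  + rewrite /PL /F1 /F2 /F3 /zpow /= => -[[q1 e1] [q2 e2] [q3 e3]]; split.
    * by exists (- q1 + h4 + h5)%ZZ; lia.
    * by exists (q3 - 2 * q1 + h3 + 2 * h4 + 2 * h5)%ZZ; lia.
    by exists (q2 + 3 * q1 - h3 - 3 * h4 - 2 * h5)%ZZ; lia.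
- split=> [k|k p l l'|k c p l l'] ln; (split; first exact: X_trans2).
  + exact: X'k1_not3.
  + case/and3P: (ln) => k1 pm rt; apply: (PL_not3 (c := 0%N) ln pm _ rt) => //.
    by lia.
  case/and4P: (ln) => k1 /andP[c1 ck] pm rt; apply: (PL_not3 (c := c) ln pm _ rt) => //.
  by lia.
move=> C conn tr reg; have [A [a [iso cA su l1 l2]]] := arc_transitive_voltage conn tr reg.
exists (size (primes #|A|)), (@fp A), (@fA A), (@fphi A a); split.
- exact: fp_inj.
- move=> i; have [pi pd _] := fpP i; have sui := pri_surj (p := fp i) su.
  have i1 := pri_invariant (p := fp i) (lifts_invariant rho1_aut l1).
  have i2 := pri_invariant (p := fp i) (lifts_invariant rho2_aut l2).
  split.
  + exact: surj_connected.
  + by apply: lifts_trans1; [apply: (invariant_lifts rho1_aut _ _ ordM_rho1) |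
      apply: (invariant_lifts rho2_aut _ _ ordM_rho2)].
  + exact: vcover_regular.
  exact: pri_primary.
exact: cov_iso_trans iso (fibered_iso a).
Qed.
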